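(* Let $\overline{\mathbb{Q}}$ be an algebraic closure of $\mathbb{Q}$ and let $\mathcal{E}$ be the space of all subfields of $\overline{\mathbb{Q}}$, with the topology induced from $2^{\overline{\mathbb{Q}}}$. For $F \in \mathcal{E}$ let $\mathcal{O}_F$ denote its ring of integers. Then the set of all $F \in \mathcal{E}$ such that at least one of the subsets $\mathbb{Z}$, $\mathcal{O}_F$ of $F$ is definable in $F$ is meager in $\mathcal{E}$.
   Context: The space $2^{\overline{\mathbb{Q}}}$ is the power set of $\overline{\mathbb{Q}}$, identified with $\{0,1\}^{\overline{\mathbb{Q}}}$ and given the product topology with $\{0,1\}$ discrete; $\mathcal{E} \subseteq 2^{\overline{\mathbb{Q}}}$ carries the subspace topology. Thus a subbasis of the topology on $\mathcal{E}$ is given by the sets $\{F \in \mathcal{E} : x \in F\}$ and $\{F \in \mathcal{E} : x \notin F\}$ for $x \in \overline{\mathbb{Q}}$. A subset of a topological space is meager if it is a countable union of nowhere dense sets. The ring of integers $\mathcal{O}_F$ of $F \subseteq \overline{\mathbb{Q}}$ is the integral closure of $\mathbb{Z}$ in $F$. A subset $S \subseteq F$ is definable in $F$ if there are a first-order formula $\varphi(x, y_1, \dots, y_m)$ in the language of rings and parameters $c_1, \dots, c_m \in F$ such that $S = \{a \in F : F \models \varphi(a, c_1, \dots, c_m)\}$. *)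

(* Defs.v *)
From HB Require Import structures.
From mathcomp Require Import all_boot all_order all_algebra.
From mathcomp Require Import all_classical all_reals all_analysis.

Set Implicit Arguments.
Unset Strict Implicit.
Unset Printing Implicit Defensive.

Import GRing.Theory.
Local Open Scope classical_set_scope.
Local Open Scope ring_scope.

Section Meager.
Variable T : topologicalType.

Definition nowhere_dense (A : set T) : Prop := interior (closure A) = set0.

Definition meager (A : set T) : Prop :=
  exists2 N : nat -> set T, (forall n, nowhere_dense (N n)) & A = \bigcup_n N n.

End Meager.

Section Definability.
Variable R : unitRingType.

(* [GRing.formula R] also has constants for all elements of R, inverses and a
   unit predicate. The next two predicates select the parameter-free first-order
   formulas in the language of rings; numerals, natural multiples and
   powers abbreviate terms of that language. *)
Fixpoint ring_term (t : GRing.term R) : bool :=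
  match t with
  | GRing.Var _ | GRing.NatConst _ => true
  | GRing.Const _ | GRing.Inv _ => false
  | GRing.Opp t1 | GRing.NatMul t1 _ | GRing.Exp t1 _ => ring_term t1
  | GRing.Add t1 t2 | GRing.Mul t1 t2 => ring_term t1 && ring_term t2
  end.

Fixpoint ring_formula (f : GRing.formula R) : bool :=
  match f with
  | GRing.Bool _ => true
  | GRing.Unit _ => false
  | GRing.Equal t1 t2 => ring_term t1 && ring_term t2
  | GRing.And f1 f2 | GRing.Or f1 f2 | GRing.Implies f1 f2 =>
      ring_formula f1 && ring_formula f2
  | GRing.Not f1 | GRing.Exists _ f1 | GRing.Forall _ f1 => ring_formula f1
  end.

(* The free variable 'X_0 stands for the element, 'X_1, ..., 'X_m for the
   parameters c. [GRing.holds] reads variables beyond the environment as 0, so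
   they amount to additional parameters equal to 0. *)
Definition definable (S : set R) : Prop :=
  exists (phi : GRing.formula R) (c : seq R),
    ring_formula phi /\ S = [set a | GRing.holds (a :: c) phi].

End Definability.

(* The space of subfields of K, with the topology induced from {0,1}^K (product
   of discrete spaces); as 0^-1 = 0, [divring_closed] subsets are subfields. *)
Definition subfields (K : fieldType) : Type :=
  set_type [set F : {ptws K -> bool} | divring_closed (F : {pred K})].

HB.instance Definition _ (K : fieldType) := Topological.on (subfields K).

Section SubfieldAsField.
Variables (K : fieldType) (F : subfields K).

Definition subfield_pred : {pred K} := set_val F.

Fact subfield_pred_closed : divring_closed subfield_pred.
Proof. exact: (set_valP F). Qed.

HB.instance Definition _ :=
  GRing.isDivringClosed.Build K subfield_pred subfield_pred_closed.

Definition subfield_type : Type := {x : K | x \in subfield_pred}.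

HB.instance Definition _ := SubChoice.on subfield_type.
HB.instance Definition _ :=
  [SubChoice_isSubIntegralDomain of subfield_type by <:].
HB.instance Definition _ :=
  [SubIntegralDomain_isSubField of subfield_type by <:].

End SubfieldAsField.

Definition integers (F : fieldType) : set F := range (intr : int -> F).
Arguments integers F : clear implicits.

Definition ring_of_integers (F : fieldType) : set F :=
  [set x | integralOver (intr : int -> F) x].
Arguments ring_of_integers F : clear implicits.

(* Main.v *)
Require Import Defs.
From HB Require Import structures.
From mathcomp Require Import all_boot all_order all_algebra all_field.
From mathcomp Require Import all_classical all_reals all_analysis.
From mathcomp Require Import ring zify polyXY.

Set Implicit Arguments.
Unset Strict Implicit.
Unset Printing Implicit Defensive.

Import Order.TTheory GRing.Theory Num.Theory.
Local Open Scope classical_set_scope.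
Local Open Scope ring_scope.

(** A generic subfield defines neither its rational integers nor its ring of
    integers, and genericity is a conjunction of countably many conditions, each
    of which fails only on a nowhere dense set of subfields.

    A [problem] consists of data over the polynomials in one variable [X]: an
    absolutely irreducible equation [prim_min], an element [gen] of the function
    field that it defines, meant to lie in the subfield, and elements [outs] of
    the function field, meant to stay outside.  The problem is solved by [F] if,
    for some natural number [m], specializing [X] to [m] sends [gen] into [F]
    and every element of [outs] outside of [F].  It is well posed for [F] if
    nothing over [F] forbids this: [gen] has an equation over [F] of the degree
    that it has over all constants, and no element of [outs] lies in the field
    that [gen] generates over [F(X)].  Being solved is an open condition.  It is
    also dense where the problem is well posed ([density]).  Indeed finitely
    many prescribed memberships only concern a number field [k], over which the
    specialized equation stays irreducible for infinitely many [m] by Hilbert's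
    irreducibility theorem ([hilbert_irreducibility_int],
    [hilbert_irreducibility_number_field]).  Adjoin the value of [gen] to the
    intersection of [k] and [F].  If this caught an unwanted element for all
    large [m], the relations responsible would lift to a relation over [F(X)]
    ([pade]).  There are only countably many problems, so the subfields that
    fail to solve a problem well posed for them form a meager set
    ([nongeneric_meager]).

    Let [F] be generic, and let [G] be its ultrapower inside the ultrapower [M]
    of the algebraic closure.  Since the conditions on a problem involve
    polynomials of bounded degree only, [G] is generic as well, [m] now ranging
    over the nonstandard natural numbers ([generic_upow]).  Suppose that a
    countable algebraically closed field [L] is embedded twice in [M], with the
    same trace of [G], over which it is algebraic.  For [x] in [G] outside of
    the first image, a finite set of elements algebraic over [L(x)] amounts to
    a problem.  It is well posed because [L] and [G] are linearly disjoint over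
    their intersection ([disjoint_relation]), hence it has a solution
    ([specialize_finite]).  By countable saturation the finite solutions
    combine into an extension of the second embedding to the whole algebraic
    closure of [L(x)], taking [x] to a nonstandard natural number ([saturate],
    [extend_position]).  So partial isomorphisms extend back and forth, and
    tuples that correspond under one of them satisfy the same formulas in [G]
    ([position_equivalence]).

    Starting from the identity of the algebraic closure, one extension takes
    the half-integer with components [n + 1/2] to a nonstandard natural number.
    If a formula with parameters in [F] holds at all natural numbers, then by
    the theorem of Łoś ([los]) it holds at [n + 1/2] for almost all [n].  But
    [n + 1/2] is not integral ([generic_undefinable]). *)
(** * Almost all natural numbers *)

Lemma nonprincipal_ultrafilter_exists :
  exists U : set_system nat, UltraFilter U /\ forall N, U [set n | (N <= n)%N].
Proof.
pose F : set_system nat := filter_from setT (fun N => [set n | (N <= n)%N]).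
have Ff : Filter F.
  apply: filter_from_filter; first by exists 0%N.
  move=> i j _ _; exists (maxn i j) => //= n /=.
  by rewrite geq_max => /andP[].
have FF : ProperFilter F by apply: filter_from_proper => N _; exists N => /=.
have [U [UU FU]] := ultraFilterLemma FF.
by exists U; split => // N; apply: FU; exists N.
Qed.

Definition omega : set_system nat :=
  projT1 (cid nonprincipal_ultrafilter_exists).

#[local] Instance omega_ultra : UltraFilter omega.
Proof. by case: (projT2 (cid nonprincipal_ultrafilter_exists)). Qed.

(** The quantifier of an ultrafilter commutes with all logical connectives,
    which is what makes truth in ultrapowers computable pointwise. *)
Definition ae (P : nat -> Prop) : Prop := omega P.

Lemma aeT (P : nat -> Prop) : (forall n, P n) -> ae P.
Proof. by move=> h; apply: filterS filterT => n _; exact: h. Qed.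

Lemma ae_imp (P Q : nat -> Prop) : ae P -> (forall n, P n -> Q n) -> ae Q.
Proof. by move=> h PQ; apply: filterS h => n; exact: PQ. Qed.

Lemma ae_and (P Q : nat -> Prop) : ae P -> ae Q -> ae (fun n => P n /\ Q n).
Proof. by move=> p q; apply: filterS2 p q => n; split. Qed.

Lemma ae_imp2 (P Q S : nat -> Prop) :
  ae P -> ae Q -> (forall n, P n -> Q n -> S n) -> ae S.
Proof. by move=> p q h; apply: ae_imp (ae_and p q) _ => n [/h]. Qed.

Lemma ae_andE (P Q : nat -> Prop) : ae (fun n => P n /\ Q n) <-> ae P /\ ae Q.
Proof.
split=> [h|[p q]]; last exact: ae_and.
by split; apply: ae_imp h _ => n [].
Qed.

Lemma ae_ex (P : nat -> Prop) : ae P -> exists n, P n.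
Proof. by move=> h; have [n Pn] := filter_ex h; exists n. Qed.

Lemma ae_const (P : Prop) : ae (fun=> P) -> P.
Proof. by move=> /ae_ex[]. Qed.

Lemma ae_notE (P : nat -> Prop) : ae (fun n => ~ P n) <-> ~ ae P.
Proof.
split=> [nP p|nP].
  by have [n []] := ae_ex (ae_and nP p).
by have [] := in_ultra_setVsetC P omega_ultra.
Qed.

Lemma ae_orE (P Q : nat -> Prop) : ae (fun n => P n \/ Q n) <-> ae P \/ ae Q.
Proof.
split=> [h|[] h]; [|by apply: ae_imp h _ => n; left|by apply: ae_imp h _ => n; right].
have [p|np] := pselect (ae P); first by left.
right; apply: ae_imp2 h ((ae_notE _).2 np) _ => n; by case.
Qed.

Lemma ae_ge N : ae (fun n => (N <= n)%N).
Proof. by case: (projT2 (cid nonprincipal_ultrafilter_exists)) => _; exact. Qed.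

Lemma ae_all_seq (T : eqType) (s : seq T) (P : T -> nat -> Prop) :
  (forall t, t \in s -> ae (P t)) -> ae (fun n => forall t, t \in s -> P t n).
Proof.
elim: s => [|x s IHs] h; first by apply: aeT.
apply: ae_imp2 (h x (mem_head _ _)) (IHs _) _ => [t ts|n Px Ps t].
  by apply: h; rewrite inE ts orbT.
by rewrite inE => /predU1P[->|/Ps].
Qed.

Lemma ae_all_lt N (P : nat -> nat -> Prop) :
  (forall i, (i < N)%N -> ae (P i)) -> ae (fun n => forall i, (i < N)%N -> P i n).
Proof.
move=> h; have H : ae (fun n => forall t, t \in iota 0 N -> P t n).
  by apply: ae_all_seq => t; rewrite mem_iota => /h.
by apply: ae_imp H _ => n Pn i iN; apply: Pn; rewrite mem_iota.
Qed.

Lemma ae_ex_seq (T : eqType) (s : seq T) (P : T -> nat -> Prop) :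
  ae (fun n => exists2 t, t \in s & P t n) -> exists2 t, t \in s & ae (P t).
Proof.
elim: s => [|x s IHs] h; first by have [n []] := ae_ex h.
have /ae_orE[Px|/IHs[t ts Pt]] :
    ae (fun n => P x n \/ exists2 t, t \in s & P t n).
  apply: ae_imp h _ => n [t]; rewrite inE => /predU1P[->|ts]; first by left.
  by right; exists t.
- by exists x; rewrite ?mem_head.
- by exists t; rewrite // inE ts orbT.
Qed.

Lemma ae_fin (T : finType) (P : T -> nat -> Prop) :
  ae (fun n => exists t, P t n) -> exists t, ae (P t).
Proof.
move=> h; have : ae (fun n => exists2 t, t \in enum T & P t n).
  by apply: ae_imp h _ => n [t Pt]; exists t; rewrite ?mem_enum.
by move=> /ae_ex_seq[t _ Pt]; exists t.
Qed.

Lemma ae_choice (T : Type) (t0 : T) (P : nat -> T -> Prop) :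
  ae (fun n => exists t, P n t) -> exists s : nat -> T, ae (fun n => P n (s n)).
Proof.
move=> h; exists (fun n => if pselect (exists t, P n t) is left e
                           then projT1 (cid e) else t0).
apply: ae_imp h _ => n ex; case: pselect => // e; exact: projT2 (cid e).
Qed.

(** Countable saturation: finitely satisfiable increasing conditions can be
    satisfied simultaneously, by meeting at index n as many of the first n
    conditions as possible. *)
Lemma ae_saturation (T : Type) (D : nat -> nat -> T -> Prop) :
  (forall n x, D 0 n x) -> inhabited T ->
  (forall J n x, D J.+1 n x -> D J n x) ->
  (forall J, ae (fun n => exists x, D J n x)) ->
  exists s : nat -> T, forall J, ae (fun n => D J n (s n)).
Proof.
move=> D0 [t0] Ddec Dex.
have Dle J J' n x : (J <= J')%N -> D J' n x -> D J n x.
  by move=> /subnK<-; elim: (J' - J)%N => // k IH /Ddec.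
have best n : exists x, forall J, (J <= n)%N -> (exists y, D J n y) -> D J n x.
  have maxJ m : exists J, [/\ (J <= m)%N, exists y, D J n y &
      forall J', (J' <= m)%N -> (exists y, D J' n y) -> (J' <= J)%N].
    elim: m => [|m [J [Jm Jy Jmax]]].
      by exists 0%N; split => //; exists t0.
    have [ym|nym] := pselect (exists y, D m.+1 n y).
      by exists m.+1; split.
    exists J; split; rewrite ?(leq_trans Jm) // => J' + J'y.
    by rewrite leq_eqVlt => /predU1P[J'E|/Jmax]; [rewrite J'E in J'y|exact].
  have [J [_ [x xJ] Jmax]] := maxJ n.
  exists x => J' J'n J'y.
  exact: Dle (Jmax _ J'n J'y) xJ.
exists (fun n => projT1 (cid (best n))) => J.
apply: ae_imp2 (Dex J) (ae_ge J) _ => n ex Jn.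
exact: (projT2 (cid (best n))) J Jn ex.
Qed.

(** * Ultrapowers of fields *)

Section Ultrapower.
Variable K : closedFieldType.

Definition null_seq : {pred nat -> K} := fun s => `[< ae (fun n => s n = 0) >].

Lemma null_seq_idealr : idealr_closed null_seq.
Proof.
split.
- by apply/asboolP/aeT.
- by apply/asboolPn => /ae_ex[n] /eqP; rewrite (negPf (oner_neq0 K)).
- move=> a u v /asboolP u0 /asboolP v0; apply/asboolP.
  apply: ae_imp2 u0 v0 _ => n un vn.
  have -> : (a * u + v) n = (a n : K) * u n + v n :> K by [].
  by rewrite un vn mulr0 addr0.
Qed.

HB.instance Definition _ := isIdealr.Build (nat -> K) null_seq null_seq_idealr.

Definition upow : Type := {ideal_quot null_seq}.
HB.instance Definition _ := GRing.ComNzRing.on upow.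

Definition ulim (s : nat -> K) : upow := \pi_({ideal_quot null_seq})%qT s.
Definition urep (x : upow) : nat -> K := repr x.

Lemma urepK x : ulim (urep x) = x.
Proof. exact: reprK. Qed.

Lemma ulim_eq s t : (ulim s = ulim t) <-> ae (fun n => s n = t n).
Proof.
have subE n : (s - t) n = s n - t n :> K by [].
have -> : (ulim s = ulim t) <-> null_seq (s - t).
  rewrite /ulim; split=> [/eqP|h]; first by rewrite -Quotient.idealrBE.
  by apply/eqP; rewrite -Quotient.idealrBE.
split=> [/asboolP h|h]; [|apply/asboolP]; apply: ae_imp h _ => n.
  by rewrite subE => /eqP; rewrite subr_eq0 => /eqP.
by rewrite subE => ->; rewrite subrr.
Qed.

Fact ulim_zmod : zmod_morphism ulim.
Proof. by move=> s t; rewrite /ulim !raddfB. Qed.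

Fact ulim_monoid : monoid_morphism ulim.
Proof. by rewrite /ulim; split=> [|s t]; rewrite ?rmorph1 ?rmorphM. Qed.

HB.instance Definition _ :=
  GRing.isZmodMorphism.Build (nat -> K) upow ulim ulim_zmod.
HB.instance Definition _ :=
  GRing.isMonoidMorphism.Build (nat -> K) upow ulim ulim_monoid.

Lemma urep_ulim s : ae (fun n => urep (ulim s) n = s n).
Proof. by apply/ulim_eq; rewrite urepK. Qed.

Definition uinv (x : upow) : upow := ulim (fun n => (urep x n)^-1).

Fact umulVf x : x != 0 -> uinv x * x = 1.
Proof.
move=> x0; rewrite -{2}[x]urepK -rmorphM -[1](rmorph1 ulim); apply/ulim_eq.
have : ae (fun n => ~ urep x n = 0).
  by apply/ae_notE => h; move/eqP: x0; apply; rewrite -[x]urepK -[0](rmorph0 ulim); apply/ulim_eq.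
by move=> h; apply: ae_imp h _ => n /eqP; exact: mulVf.
Qed.

Fact uinv0 : uinv 0 = 0.
Proof.
rewrite -[0 in RHS](rmorph0 ulim); apply/ulim_eq.
have := urep_ulim 0; rewrite rmorph0 => h.
by apply: ae_imp h _ => n ->; rewrite invr0.
Qed.

HB.instance Definition _ := GRing.ComNzRing_isField.Build upow umulVf uinv0.

Fact upow_closed : GRing.closed_field_axiom upow.
Proof.
move=> m P m0.
pose Pn n i := urep (P i) n.
pose x n := projT1 (cid (@solve_monicpoly K m (Pn n) m0)).
exists (ulim x).
under eq_bigr => i _ do rewrite -[P i]urepK -rmorphXn -rmorphM.
rewrite -rmorphXn -rmorph_sum; apply/ulim_eq/aeT => n.
have := projT2 (cid (@solve_monicpoly K m (Pn n) m0)); rewrite -/(x n) => xE.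
have XE k : (x ^+ k) n = x n ^+ k.
  by elim: k => [|k IHk] //; rewrite !exprS -IHk.
rewrite XE xE.
have sumE (I : finType) (F : I -> nat -> K) : (\sum_i F i) n = \sum_i F i n.
  by elim/big_rec2: _ => //= i y1 y2 _ <-.
by rewrite sumE; apply: eq_bigr => i _; rewrite -XE.
Qed.

HB.instance Definition _ := Field_isAlgClosed.Build upow upow_closed.

Definition udiag (a : K) : upow := ulim (fun=> a).

Fact udiag_zmod : zmod_morphism udiag.
Proof. by move=> a b; rewrite /udiag -rmorphB; congr ulim; apply/funext. Qed.
Fact udiag_monoid : monoid_morphism udiag.
Proof.
split=> [|a b]; rewrite /udiag -?rmorphM -?[RHS](rmorph1 ulim);
  by congr ulim; apply/funext.
Qed.
HB.instance Definition _ := GRing.isZmodMorphism.Build K upow udiag udiag_zmod.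
HB.instance Definition _ :=
  GRing.isMonoidMorphism.Build K upow udiag udiag_monoid.

Definition at_ (n : nat) (s : nat -> K) : K := s n.

Fact at_zmod n : zmod_morphism (at_ n). Proof. by []. Qed.
Fact at_monoid n : monoid_morphism (at_ n). Proof. by []. Qed.
HB.instance Definition _ n :=
  GRing.isZmodMorphism.Build (nat -> K) K (at_ n) (at_zmod n).
HB.instance Definition _ n :=
  GRing.isMonoidMorphism.Build (nat -> K) K (at_ n) (at_monoid n).

(** Polynomial identities over the ultrapower are polynomial identities at
    almost every index; polynomials over sequences mediate between the two. *)
Notation ulim1 := (map_poly ulim).
Notation ulim2 := (map_poly (map_poly ulim)).
Notation at1 n := (map_poly (at_ n)).
Notation at2 n := (map_poly (map_poly (at_ n))).

Lemma ulim_eq0 s : ulim s = 0 <-> ae (fun n => at_ n s = 0).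
Proof. by rewrite -(ulim_eq s 0) rmorph0. Qed.

Lemma ulim1_eq0 p : ulim1 p = 0 <-> ae (fun n => at1 n p = 0).
Proof.
split=> [p0|h].
  have : ae (fun n => forall i, (i < size p)%N -> at_ n p`_i = 0).
    by apply: ae_all_lt => i _; apply/ulim_eq0; rewrite -coef_map p0 coef0.
  move=> h; apply: ae_imp h _ => n pn; apply/polyP => i; rewrite coef0 coef_map.
  by case: (ltnP i (size p)) => [/pn//|/(nth_default 0)->].
apply/polyP => i; rewrite coef0 coef_map; apply/ulim_eq0.
by apply: ae_imp h _ => n pn; rewrite -coef_map pn coef0.
Qed.

Lemma ulim2_eq0 p : ulim2 p = 0 <-> ae (fun n => at2 n p = 0).
Proof.
split=> [p0|h].
  have : ae (fun n => forall i, (i < size p)%N -> at1 n p`_i = 0).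
    by apply: ae_all_lt => i _; apply/ulim1_eq0; rewrite -coef_map p0 coef0.
  move=> h; apply: ae_imp h _ => n pn; apply/polyP => i; rewrite coef0 coef_map.
  by case: (ltnP i (size p)) => [/pn//|/(nth_default 0)->]; rewrite raddf0.
apply/polyP => i; rewrite coef0 coef_map; apply/ulim1_eq0.
by apply: ae_imp h _ => n pn; rewrite -coef_map pn coef0.
Qed.

Lemma ulim2_eq p q : ulim2 p = ulim2 q <-> ae (fun n => at2 n p = at2 n q).
Proof.
split=> [h|h].
  have /ulim2_eq0 : ulim2 (p - q) = 0 by rewrite rmorphB /= h subrr.
  by move=> e; apply: ae_imp e _ => n /eqP; rewrite rmorphB /= subr_eq0 => /eqP.
apply/eqP; rewrite -subr_eq0 -rmorphB; apply/eqP/ulim2_eq0.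
by apply: ae_imp h _ => n e; rewrite rmorphB /= e subrr.
Qed.

Lemma ulim1_surj q : exists p, ulim1 p = q.
Proof.
exists (\poly_(i < size q) urep q`_i); apply/polyP => i.
rewrite coef_map coef_poly; case: ltnP => [_|qi]; first by rewrite /= urepK.
by rewrite raddf0 nth_default.
Qed.

Lemma ulim2_surj q : exists p, ulim2 p = q.
Proof.
exists (\poly_(i < size q) projT1 (cid (ulim1_surj q`_i))); apply/polyP => i.
rewrite coef_map coef_poly; case: ltnP => [_|qi].
  exact: (projT2 (cid (ulim1_surj q`_i))).
by rewrite raddf0 nth_default.
Qed.

(** The bound is essential: a family of polynomials of unbounded degree does not
    define a polynomial over the ultrapower. *)
Lemma at2_surj N (q : nat -> {poly {poly K}}) :
  exists p, ae (fun n => (size (q n) <= N)%N ->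
    (forall i, (size ((q n)`_i)%R <= N)%N) -> at2 n p = q n).
Proof.
exists (\poly_(i < N) \poly_(j < N) (fun n => (q n)`_i`_j)).
apply: aeT => n qN qiN; apply/polyP => i; apply/polyP => j.
rewrite coef_map coef_poly; case: ltnP => [iN|iN]; last first.
  have -> : (q n)`_i = 0 by rewrite nth_default // (leq_trans qN).
  by rewrite raddf0 coef0.
rewrite coef_map coef_poly; case: ltnP => [jN|jN] //.
by rewrite raddf0 nth_default // (leq_trans (qiN i)).
Qed.

End Ultrapower.

Notation ulim1 := (map_poly (@ulim _)).
Notation ulim2 := (map_poly (map_poly (@ulim _))).
Notation at1 n := (map_poly (at_ n)).
Notation at2 n := (map_poly (map_poly (at_ n))).

(** * Linear dependence *)

Lemma rV_fun (k : fieldType) (I : finType) (v : 'rV[k]_#|I|) (F : I -> k) :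
  \sum_i v 0 (enum_rank i) * F i = \sum_j v 0 j * F (enum_val j).
Proof.
rewrite (reindex (@enum_val I I)) /=; last first.
  by exists enum_rank => i _; rewrite ?enum_rankK ?enum_valK.
by apply: eq_bigr => j _; rewrite enum_valK.
Qed.

Lemma dependent_field (k : fieldType) (I J : finType) (A : I -> J -> k) :
  (#|J| < #|I|)%N ->
  exists v : I -> k, (exists i, v i != 0) /\ forall j, \sum_i v i * A i j = 0.
Proof.
move=> JI; pose B := \matrix_(i < #|I|, j < #|J|) A (enum_val i) (enum_val j).
have /rowV0Pn[v /sub_kermxP vB v0] : kermx B != 0.
  rewrite -mxrank_eq0 mxrank_ker subn_eq0 -ltnNge.
  exact: leq_ltn_trans (rank_leq_col B) JI.
exists (fun i => v 0 (enum_rank i)); split.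
  have /rV0Pn[i vi] := v0; exists (enum_val i); by rewrite enum_valK.
move=> j; rewrite rV_fun; move/rowP/(_ (enum_rank j)): vB; rewrite !mxE => vB.
by rewrite -[RHS]vB; apply: eq_bigr => i _; rewrite !mxE enum_rankK.
Qed.

(** A system has a nonzero solution when the rank is too small, and the rank of
    a matrix does not change under extension of the field. *)
Lemma dependent_descent (k k' : fieldType) (f : {rmorphism k -> k'})
    (I J : finType) (A : I -> J -> k) (v' : I -> k') :
  (exists i, v' i != 0) -> (forall j, \sum_i v' i * f (A i j) = 0) ->
  exists v : I -> k, (exists i, v i != 0) /\ forall j, \sum_i v i * A i j = 0.
Proof.
move=> [i0 v'0] v'A.
pose B := \matrix_(i < #|I|, j < #|J|) A (enum_val i) (enum_val j).
have : ~~ row_free (map_mx f B).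
  rewrite -kermx_eq0; apply/rowV0Pn; exists (\row_j v' (enum_val j)).
    apply/sub_kermxP/rowP => j; rewrite !mxE -[RHS](v'A (enum_val j)).
    rewrite (reindex (@enum_val I I)) /=; last first.
      by exists enum_rank => i _; rewrite ?enum_rankK ?enum_valK.
    by apply: eq_bigr => i _; rewrite !mxE.
  by apply/rV0Pn; exists (enum_rank i0); rewrite mxE enum_rankK.
rewrite row_free_map -kermx_eq0 => /rowV0Pn[v /sub_kermxP vB v0].
exists (fun i => v 0 (enum_rank i)); split.
  have /rV0Pn[i vi] := v0; exists (enum_val i); by rewrite enum_valK.
move=> j; rewrite rV_fun; move/rowP/(_ (enum_rank j)): vB; rewrite !mxE => vB.
by rewrite -[RHS]vB; apply: eq_bigr => i _; rewrite !mxE enum_rankK.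
Qed.

(** * Subfields given by a predicate *)

(** Membership predicates turned into fields of their own make the theory of
    polynomials and matrices over fields applicable to them. *)
Definition mk_subfield (M : fieldType) (S : {pred M}) (h : divring_closed S) :
  subfields M := exist _ (S : M -> bool) (mem_set h).

Definition sfval (M : fieldType) (F : subfields M) : {rmorphism subfield_type F -> M} :=
  (val : subfield_type F -> M).

Lemma sfval_in (M : fieldType) (S : {pred M}) (h : divring_closed S)
  (x : subfield_type (mk_subfield h)) : sfval _ x \in S.
Proof. exact: (valP x). Qed.

Lemma sfvalP (M : fieldType) (S : {pred M}) (h : divring_closed S) x :
  x \in S -> exists y : subfield_type (mk_subfield h), sfval _ y = x.
Proof. by move=> xS; exists (exist _ x xS). Qed.

(** * The field of fractions of a subring of a field *)

Section Fractions.
Variables (R : idomainType) (M : fieldType) (rho : {rmorphism R -> M}).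
Hypothesis rho_inj : injective rho.

Let rho_eq0 a : (rho a == 0) = (a == 0).
Proof. by rewrite -(inj_eq rho_inj) rmorph0. Qed.

(** The fractions are realized inside [M], so that no compatibility between an
    abstract fraction field and [M] has to be maintained. *)
Definition frac_pred : {pred M} :=
  fun m => `[< exists a b, b != 0 /\ m = rho a / rho b >].

Fact frac_pred_closed : divring_closed frac_pred.
Proof.
split.
- by apply/asboolP; exists 1, 1; rewrite oner_neq0 rmorph1 divr1.
- move=> _ _ /asboolP[a [b [b0 ->]]] /asboolP[c [d [d0 ->]]].
  apply/asboolP; exists (a * d - c * b), (b * d); rewrite mulf_neq0 //; split => //.
  by rewrite rmorphB !rmorphM /=; field; rewrite !rho_eq0 b0 d0.
- move=> _ _ /asboolP[a [b [b0 ->]]] /asboolP[c [d [d0 ->]]].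
  have [->|c0] := eqVneq c 0.
    by apply/asboolP; exists 0, 1; rewrite oner_neq0 !rmorph0 !mul0r invr0 mulr0.
  apply/asboolP; exists (a * d), (b * c); rewrite mulf_neq0 //; split => //.
  by rewrite !rmorphM invf_div mulf_div.
Qed.

Definition frac_field : fieldType := subfield_type (mk_subfield frac_pred_closed).

Lemma frac_fieldP (x : frac_field) :
  exists a b, b != 0 /\ rho b * sfval _ x = rho a.
Proof.
have /asboolP[a [b [b0 ->]]] := sfval_in x.
by exists a, b; rewrite mulrC divfK ?rho_eq0.
Qed.

Fact in_frac_field a : rho a \in frac_pred.
Proof. by apply/asboolP; exists a, 1; rewrite oner_neq0 rmorph1 divr1. Qed.

Definition to_frac (a : R) : frac_field := exist _ (rho a) (in_frac_field a).

Let fval : {rmorphism frac_field -> M} := sfval (mk_subfield frac_pred_closed).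

Lemma to_fracE a : fval (to_frac a) = rho a. Proof. by []. Qed.

Fact to_frac_zmod : zmod_morphism to_frac.
Proof. by move=> a b; apply: (fmorph_inj fval); rewrite rmorphB !to_fracE rmorphB. Qed.
Fact to_frac_monoid : monoid_morphism to_frac.
Proof.
by split=> [|a b]; apply: (fmorph_inj fval); rewrite ?rmorphM !to_fracE ?rmorphM ?rmorph1.
Qed.
HB.instance Definition _ := GRing.isZmodMorphism.Build R frac_field to_frac to_frac_zmod.
HB.instance Definition _ :=
  GRing.isMonoidMorphism.Build R frac_field to_frac to_frac_monoid.

Lemma common_denominator (I : finType) (v : I -> frac_field) :
  exists b : R, b != 0 /\ exists w : I -> R, forall i, rho b * sfval _ (v i) = rho (w i).
Proof.
have /choice[ab abP] i : exists ab : R * R,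
    ab.2 != 0 /\ rho ab.2 * sfval _ (v i) = rho ab.1.
  by have [a [b ?]] := frac_fieldP (v i); exists (a, b).
exists (\prod_i (ab i).2); split; first by apply/prodf_neq0 => i _; case: (abP i).
exists (fun i => (\prod_(j | j != i) (ab j).2) * (ab i).1) => i.
by rewrite (bigD1 i) //= !rmorphM mulrAC (abP i).2 mulrC.
Qed.

Lemma clear_denominators (p : {poly frac_field}) :
  exists b : R, b != 0 /\ exists P : {poly R}, rho b *: map_poly fval p = map_poly rho P.
Proof.
have [b [b0 [w bw]]] := common_denominator (fun i : 'I_(size p) => p`_i).
exists b; split => //.
exists (\poly_(i < size p) (if insub i is Some j then w j else 0)).
apply/polyP => i; rewrite coefZ !coef_map coef_poly.
case: ltnP => [ip|ip]; first by rewrite insubT /= -bw.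
by rewrite nth_default // !raddf0 mulr0.
Qed.

Lemma dependent_idomain (I J : finType) (A : I -> J -> R) :
  (#|J| < #|I|)%N ->
  exists v : I -> R, (exists i, v i != 0) /\ forall j, \sum_i v i * A i j = 0.
Proof.
move=> JI; have [v [[i0 vi0] vA]] := dependent_field (fun i j => to_frac (A i j)) JI.
have [b [b0 [w bw]]] := common_denominator v.
exists w; split.
  by exists i0; rewrite -rho_eq0 -bw mulf_neq0 ?rho_eq0 ?fmorph_eq0.
move=> j; apply: rho_inj; rewrite rmorph0 -[RHS](mulr0 (rho b)).
rewrite -[in RHS](rmorph0 (sfval (mk_subfield frac_pred_closed))) -(vA j).
rewrite !rmorph_sum mulr_sumr; apply: eq_bigr => i _.
by rewrite !rmorphM -bw mulrA.
Qed.

(** ** Minimal polynomials *)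

Definition ann (u : M) (p : {poly R}) : Prop := (map_poly rho p).[u] = 0.
Definition alg_over (u : M) : Prop := exists2 p, p != 0 & ann u p.
(** Monicity makes [P] generate the ideal of all equations of [u]: division by
    [P] leaves no denominators. *)
Definition minimal_at (u : M) (P : {poly R}) : Prop :=
  [/\ P \is monic, ann u P & forall q, q != 0 -> ann u q -> (size P <= size q)%N].

Lemma alg_over_frac u : alg_over u <-> algebraicOver (sfval (mk_subfield frac_pred_closed)) u.
Proof.
split=> [[p p0 pu]|[p p0 /rootP pu]].
  have pE : map_poly fval (map_poly to_frac p) = map_poly rho p.
    by apply/polyP => i; rewrite !coef_map.
  exists (map_poly to_frac p); last by apply/rootP; rewrite pE.
  rewrite -(map_poly_eq0 fval) pE; apply: contraNneq p0 => /polyP p0.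
  by apply/eqP/polyP => i; apply: rho_inj; rewrite -coef_map p0 !coef0 rmorph0.
have [b [b0 [P PE]]] := clear_denominators p.
exists P.
  apply: contraNneq p0 => P0; rewrite -(map_poly_eq0 fval).
  have : rho b *: map_poly fval p = 0 by rewrite PE P0 map_poly0.
  by move/eqP; rewrite scaler_eq0 rho_eq0 (negPf b0).
by rewrite /ann -PE hornerZ pu mulr0.
Qed.

Lemma minimal_dvd u P q : minimal_at u P -> ann u q -> exists s, q = s * P.
Proof.
move=> [Pm Pu Pmin] qu; have qE := Pdiv.RingMonic.rdivp_eq Pm q.
exists (Pdiv.Ring.rdivp q P); rewrite {1}qE.
have [->|r0] := eqVneq (Pdiv.Ring.rmodp q P) 0; first by rewrite addr0.
have ru : ann u (Pdiv.Ring.rmodp q P).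
  by move: qu; rewrite /ann {1}qE rmorphD rmorphM hornerD hornerM Pu mulr0 add0r.
have := Pmin _ r0 ru; rewrite leqNgt Pdiv.Ring.ltn_rmodpN0 //.
exact: monic_neq0.
Qed.

Lemma minimal_size u P : minimal_at u P -> (1 < size P)%N.
Proof.
move=> [Pm Pu _]; rewrite ltnNge; apply/negP => /size1_polyC PE.
have : P`_0 = 1 by move/monicP: Pm; rewrite PE lead_coefC coefC.
by move: Pu; rewrite PE /ann map_polyC hornerC coefC /= => + P1; rewrite P1 rmorph1 => /eqP; rewrite oner_eq0.
Qed.

(** An algebraic element becomes integral after multiplication by the leading
    coefficient of an equation of least degree, and by any multiple of it. *)
Lemma minimal_exists u : alg_over u ->
  exists d, d != 0 /\ forall e, e != 0 -> exists P, minimal_at (rho (d * e) * u) P.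
Proof.
move=> [p1 p10 p1u].
have [p [p0 pu pmin]] : exists p, [/\ p != 0, ann u p &
    forall q, q != 0 -> ann u q -> (size p <= size q)%N].
  have ex : exists n, `[< exists p, [/\ p != 0, ann u p & size p = n] >].
    by exists (size p1); apply/asboolP; exists p1.
  case: (ex_minnP ex) => n /asboolP[p [p0 pu pn]] nmin; exists p; split => //.
  by move=> q q0 qu; rewrite pn; apply: nmin; apply/asboolP; exists q.
have sp : (1 < size p)%N.
  rewrite ltnNge; apply/negP => /size1_polyC pE; move: pu p0.
  rewrite pE /ann map_polyC hornerC polyC_eq0 => /eqP.
  by rewrite rho_eq0 => ->.
exists (lead_coef p); rewrite lead_coef_eq0; split => // e e0.
set c := lead_coef p; have c0 : c != 0 by rewrite lead_coef_eq0.
set D := (size p).-1; have DE : size p = D.+1 by rewrite /D prednK // ltnW.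
have D0 : (0 < D)%N by rewrite -ltnS -DE.
move gE : (c * e) => g; have g0 : g != 0 by rewrite -gE mulf_neq0.
pose P := 'X^D + \poly_(i < D) (p`_i * e * g ^+ (D.-1 - i)).
have sP : size P = D.+1 by rewrite size_polyDl size_polyXn // ltnS size_poly.
exists P; split.
- by rewrite monicE lead_coefDl ?lead_coefXn // size_polyXn ltnS size_poly.
- suff PE : rho g * (map_poly rho P).[rho g * u] = rho e * rho g ^+ D * (map_poly rho p).[u].
    apply: (mulfI (_ : rho g != 0)); first by rewrite rho_eq0.
    by rewrite PE pu !mulr0.
  rewrite !horner_coef !size_map_inj_poly ?rmorph0 // sP DE.
  rewrite !big_ord_recr /= !mulrDr !mulr_sumr; congr (_ + _); last first.
    rewrite !coef_map /= /P coefD coefXn eqxx coef_poly ltnn addr0 rmorph1 mul1r.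
    by rewrite -[p`_D]/c exprMn -gE rmorphM; ring.
  apply: eq_bigr => i _; rewrite !coef_map /= /P coefD coefXn coef_poly ltn_eqF ?ltn_ord //.
  rewrite ?ltn_ord ?add0r !rmorphM !rmorphXn exprMn.
  have -> : rho g ^+ D = rho g * rho g ^+ (D.-1 - i) * rho g ^+ i.
    have iD : (i <= D.-1)%N by rewrite -ltnS (prednK D0).
    by rewrite -mulrA -exprD -exprS (subnK iD) (prednK D0).
  by rewrite -!rmorphXn; ring.
- move=> q q0 qu; rewrite sP -DE.
  have qE : size (q \Po (g *: 'X)) = size q.
    rewrite size_comp_poly2 // size_scale // size_polyX //.
  rewrite -qE; apply: pmin; first by rewrite -size_poly_eq0 qE size_poly_eq0.
  by rewrite /ann map_comp_poly linearZ /= map_polyX horner_comp hornerZ hornerX.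
Qed.

Lemma alg_over_sub u v : alg_over u -> alg_over v -> alg_over (u - v).
Proof. by rewrite !alg_over_frac; exact: algebraic_sub. Qed.

Lemma alg_over_mul u v : alg_over u -> alg_over v -> alg_over (u * v).
Proof. by rewrite !alg_over_frac; exact: algebraic_mul. Qed.

Lemma alg_over_inv u : alg_over u -> alg_over u^-1.
Proof. by rewrite !alg_over_frac; exact: algebraic_inv. Qed.

Lemma alg_over_id a : alg_over (rho a).
Proof. by apply/alg_over_frac; exact: (algebraic_id fval (to_frac a)). Qed.

Lemma alg_over0 : alg_over 0.
Proof. by rewrite -(rmorph0 rho); exact: alg_over_id. Qed.

Lemma alg_over_muln u n : alg_over u -> alg_over (u *+ n).
Proof.
by move=> ua; rewrite -mulr_natl -(rmorph_nat rho); apply: alg_over_mul => //; exact: alg_over_id.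
Qed.

Lemma alg_over_root u p : p != 0 -> root p u -> (forall i, alg_over p`_i) -> alg_over u.
Proof.
move=> p0 pu pa; apply/alg_over_frac/integral_algebraic; apply: integral_root p0 pu _.
by apply/integral_poly => i; apply/integral_algebraic/alg_over_frac.
Qed.

Hypothesis charM : [pchar M] =i pred0.

(** The quantification over [S] expresses that the primitive element is an
    integral combination of the given elements: it lies in each additive group,
    in particular in each subfield, that contains them. *)
Lemma primitive_element (us : seq M) : (forall u, u \in us -> alg_over u) ->
  exists w, [/\ alg_over w,
    forall S : M -> Prop, S 0 -> (forall x y, S x -> S y -> S (x - y)) ->
      (forall u, u \in us -> S u) -> S w &
    exists e, e != 0 /\
      forall u, u \in us -> exists Q : {poly R}, rho e * u = (map_poly rho Q).[w]].
Proof.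
move=> usa; pose inF w u := exists q : {poly frac_field}, (map_poly fval q).[w] = u.
have [w [wa wS wus]] : exists w, [/\ alg_over w,
    forall S : M -> Prop, S 0 -> (forall x y, S x -> S y -> S (x - y)) ->
      (forall u, u \in us -> S u) -> S w &
    forall u, u \in us -> inF w u].
  elim: us usa => [_|u us IHus usa].
    by exists 0; split=> //; exact: alg_over0.
  have [v vus|w [wa wS wus]] := IHus; first by apply: usa; rewrite inE vus orbT.
  have ua : alg_over u by apply: usa; exact: mem_head.
  have /alg_over_frac[p p0 pu] := ua; have /alg_over_frac[q q0 qw] := wa.
  have charF : [pchar frac_field] =i pred0 by move=> i; rewrite -(fmorph_pchar fval).
  have [n [[f fE] [g gE]]] := pchar0_PET p0 pu q0 qw charF.
  set z := w *+ n - u in fE gE.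
  exists z; split.
  - by apply: alg_over_sub => //; exact: alg_over_muln.
  - move=> S S0 Ssub Sus; rewrite /z; apply: (Ssub); last by apply: Sus; exact: mem_head.
    have Sw : S w by apply: wS => // v vus; apply: Sus; rewrite inE vus orbT.
    elim: n {z fE gE} => [|n IHn]; first by rewrite mulr0n.
    have -> : w *+ n.+1 = w *+ n - (0 - w) by rewrite sub0r opprK mulrSr.
    by apply: (Ssub) => //; exact: Ssub.
  - move=> v; rewrite inE => /predU1P[->|/wus[h hE]]; first by exists f.
    by exists (h \Po g); rewrite map_comp_poly horner_comp gE.
exists w; split => //.
elim: us wus {usa wS} => [_|u us IHus wus]; first by exists 1; rewrite oner_neq0.
have [v vus|e [e0 eus]] := IHus; first by apply: wus; rewrite inE vus orbT.
have [q qE] := wus u (mem_head _ _).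
have [b [b0 [Q QE]]] := clear_denominators q.
exists (e * b); split; first by rewrite mulf_neq0.
move=> v; rewrite inE => /predU1P[->|/eus[h hE]].
  by exists (e *: Q); rewrite map_polyZ -QE !hornerZ qE rmorphM mulrA.
by exists (b *: h); rewrite map_polyZ hornerZ -hE mulrA -rmorphM [e * b]mulrC.
Qed.

End Fractions.

(** One of the two factors of a reducible equation would vanish at [u] and have
    a smaller degree. *)
Lemma minimal_irreducible (R : idomainType) (M : fieldType)
    (rho : {rmorphism R -> M}) u P :
  minimal_at rho u P -> irreducible_poly P.
Proof.
move=> Pmin; have := Pmin; case=> Pm Pu Ple.
split; first exact: minimal_size Pmin.
move=> q sq qP; have /Pdiv.Idomain.dvdpP[[c s] /= c0 PE] := qP.
have P0 : P != 0 by exact: monic_neq0.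
have sq0 : s * q != 0 by rewrite -PE -mul_polyC mulf_neq0 ?polyC_eq0.
have [s0 q0] : s != 0 /\ q != 0.
  by apply/andP; rewrite -negb_or -mulf_eq0.
have sPE : size P = (size s + size q).-1 by rewrite -size_mul // -PE size_scale.
have spos : (0 < size s)%N by rewrite size_poly_gt0.
have qpos : (0 < size q)%N by rewrite size_poly_gt0.
have : ann rho u (s * q) by rewrite /ann -PE map_polyZ hornerZ Pu mulr0.
rewrite /ann rmorphM hornerM => /eqP; rewrite mulf_eq0 => /orP[]/eqP vu.
  by have := Ple _ s0 vu; move/eqP: sq; rewrite sPE; lia.
rewrite -dvdp_size_eqp // eqn_leq (Ple _ q0 vu) andbT sPE; lia.
Qed.

(** * Polynomials in two variables over an algebraically closed field *)

Section ClosedBivariate.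
Variable K : closedFieldType.
Implicit Types (P Q A B : {poly {poly K}}).

Lemma poly_root_exists (p : {poly K}) : (1 < size p)%N -> exists c, root p c.
Proof. by move=> sp; apply/closed_rootP; rewrite neq_ltn sp orbT. Qed.

Lemma div_content P c : map_poly (horner_eval c) P = 0 ->
  exists P', P = ('X - c%:P) *: P'.
Proof.
move=> P0; exists (map_poly (fun p => p %/ ('X - c%:P)) P); apply/polyP => i.
rewrite coefZ coef_map_id0 ?div0p // mulrC divpK // dvdp_XsubCl /root.
by have := congr1 (fun p : {poly K} => p`_i) P0; rewrite coef_map coef0 => /eqP.
Qed.

(** Gauss's lemma: a factor over the fraction field of a monic polynomial is
    associated to a monic factor.  The denominators disappear one root at a
    time. *)
Lemma gauss_monic P Q : P \is monic -> Q %| P ->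
  exists A B, [/\ A \is monic, B \is monic, P = A * B & size A = size Q].
Proof.
move=> Pm /Pdiv.Idomain.dvdpP[[c S] /= c0 PE].
have P0 : P != 0 by exact: monic_neq0.
elim: {c}(size c) {-2}c (leqnn (size c)) => [|n IHn] c sc in Q S c0 PE *.
  by move: sc c0; rewrite leqn0 size_poly_eq0 => ->.
have QS0 : S * Q != 0 by rewrite -PE -mul_polyC mulf_neq0 ?polyC_eq0.
have [S0 Q0] : S != 0 /\ Q != 0 by apply/andP; rewrite -negb_or -mulf_eq0.
have [sc1|sc1] := leqP (size c) 1.
  have [k cE] : exists k, c = k%:P by exists c`_0; exact: size1_polyC.
  have k0 : k != 0 by move: c0; rewrite cE polyC_eq0.
  have lc : lead_coef S * lead_coef Q = c.
    by rewrite -lead_coefM -PE lead_coefZ (monicP Pm) mulr1.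
  have [sS sQ] : size (lead_coef S) = 1%N /\ size (lead_coef Q) = 1%N.
    have := congr1 (fun p : {poly K} => size p) lc.
    rewrite size_mul ?lead_coef_eq0 // cE size_polyC k0 => sE.
    have : (0 < size (lead_coef S))%N by rewrite size_poly_gt0 lead_coef_eq0.
    have : (0 < size (lead_coef Q))%N by rewrite size_poly_gt0 lead_coef_eq0.
    move: sE; case: (size (lead_coef S)) => // a; case: (size (lead_coef Q)) => // b.
    by rewrite addSn addnS /= => -[]; case: a b => [|a] [|b].
  have [s sE] : exists s, lead_coef S = s%:P by exists (lead_coef S)`_0; apply: size1_polyC; rewrite sS.
  have [q qE] : exists q, lead_coef Q = q%:P by exists (lead_coef Q)`_0; apply: size1_polyC; rewrite sQ.
  have s0 : s != 0 by rewrite -polyC_eq0 -sE lead_coef_eq0.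
  have q0 : q != 0 by rewrite -polyC_eq0 -qE lead_coef_eq0.
  exists ((q^-1)%:P *: Q), ((s^-1)%:P *: S); split.
  - by rewrite monicE lead_coefZ qE -polyCM mulVf.
  - by rewrite monicE lead_coefZ sE -polyCM mulVf.
  - rewrite -scalerAl -scalerAr scalerA mulrC -[X in _ *: X]mulrC -PE scalerA cE -!polyCM.
    have := lc; rewrite sE qE cE -polyCM => /polyC_inj <-.
    by rewrite -invfM mulVf ?mulf_neq0 // scale1r.
  - by rewrite size_scale // polyC_eq0 invr_eq0.
have [r rc] := poly_root_exists sc1.
have /factor_theorem[c' c'E] := rc.
have c'0 : c' != 0 by apply: contraNneq c0 => c'0; rewrite c'E c'0 mul0r.
have X0 : 'X - r%:P != 0 :> {poly K} by rewrite polyXsubC_eq0.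
have XI (U V : {poly {poly K}}) : ('X - r%:P) *: U = ('X - r%:P) *: V -> U = V.
  by rewrite -!mul_polyC; apply: mulfI; rewrite polyC_eq0.
have sc' : (size c' <= n)%N.
  by move: sc; rewrite c'E size_mul // size_XsubC addn2.
have ev : map_poly (horner_eval r) S * map_poly (horner_eval r) Q = 0.
  rewrite -rmorphM -PE; apply/polyP => i; rewrite coef_map coefZ coef0 /= /horner_eval hornerM.
  by rewrite (rootP rc) mul0r.
move/eqP: ev; rewrite mulf_eq0 => /orP[]/eqP/div_content[T TE].
  apply: (IHn c' sc' Q T c'0); apply: XI.
  by rewrite scalerA mulrC -c'E PE TE -scalerAl.
have [|A [B [Am Bm AB sA]]] := IHn c' sc' T S c'0.
  apply: XI; by rewrite scalerA mulrC -c'E PE TE -scalerAr.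
exists A, B; split => //; by rewrite sA TE size_scale.
Qed.

(** The degrees in the inner variable of the monic factors of a monic
    polynomial are bounded: giving the outer variable a weight larger than all
    inner degrees, every monic polynomial is dominated by its leading term as
    soon as the product is. *)
Lemma factor_degree_bound (a : nat) A B :
  A \is monic -> B \is monic -> (forall i, (size ((A * B)`_i)%R <= a)%N) ->
  forall i, (size (A`_i)%R <= a * size A + 1)%N.
Proof.
move=> Am Bm ABa i.
pose Phi (P : {poly {poly K}}) := P \Po ('X^a *: 'X).
have coefPhi P j : (Phi P)`_j = P`_j * 'X^(a * j).
  have E k : (('X^a *: 'X : {poly {poly K}}) ^+ k)`_j = (j == k)%:R * 'X^(a * k).
    by rewrite exprZn coefZ coefXn -exprM mulrC.
  rewrite /Phi coef_comp_poly; case: (ltnP j (size P)) => [jP|Pj].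
    rewrite (bigD1 (Ordinal jP)) //= big1 ?addr0 => [|k kj]; first by rewrite E eqxx mul1r.
    by rewrite E -[X in _ * X]/(_ * _) (_ : (j == k) = false) ?mul0r ?mulr0 //; apply: contraNF kj => /eqP jk; apply/eqP/val_inj.
  rewrite nth_default // mul0r big1 // => k _.
  by rewrite E (_ : (j == k) = false) ?mul0r ?mulr0 //; apply/negbTE; rewrite neq_ltn (leq_trans (ltn_ord k)) ?orbT.
have XN (p : {poly K}) k : p != 0 -> size (p * 'X^k) = (size p + k)%N.
  by move=> p0; rewrite size_mul ?expf_neq0 ?polyX_eq0 // size_polyXn addnS.
pose wt P := sizeY (Phi P).
have wt_lead P : P \is monic -> (a * (size P).-1 + 1 <= wt P)%N.
  move=> /monicP Pm; apply: leq_trans (max_size_coefXY (Phi P) (size P).-1).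
  by rewrite coefPhi -lead_coefE Pm mul1r size_polyXn addn1.
have Phi0 P : P \is monic -> Phi P != 0.
  by move=> /wt_lead; rewrite /wt -sizeY_eq0; case: (sizeY (Phi P)) => [|//]; rewrite addn1.
have wtM : wt (A * B) = (wt A + wt B).-1.
  rewrite /wt !sizeYE /Phi comp_polyM rmorphM size_mul // swapXY_eq0; exact: Phi0.
have sAB : size (A * B) = (size A + size B).-1 by rewrite size_mul ?monic_neq0.
have wtAB : (wt (A * B)%R <= a * (size (A * B)%R).-1 + 1)%N.
  have ABm : A * B \is monic by rewrite monicMl.
  apply/bigmax_leqP => j _; rewrite coefPhi.
  have [->|Pj0] := eqVneq ((A * B)`_j) 0; first by rewrite mul0r size_poly0.
  rewrite XN //; case: (ltngtP j (size (A * B)).-1) => [jD|jD|jD].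
  - have := ABa j; have : (a * j.+1 <= a * (size (A * B)%R).-1)%N by rewrite leq_mul2l jD orbT.
    by rewrite mulnS; lia.
  - move: Pj0; rewrite nth_default ?eqxx // -(prednK (n := size (A * B))) ?jD //.
    by rewrite size_poly_gt0 monic_neq0.
  - by rewrite {1}jD -lead_coefE (monicP ABm) size_poly1 jD addnC.
have := wt_lead _ Am; have := wt_lead _ Bm; move: wtAB; rewrite wtM sAB => h1 h2 h3.
have rA : (0 < size A)%N by rewrite size_poly_gt0 monic_neq0.
have rB : (0 < size B)%N by rewrite size_poly_gt0 monic_neq0.
have DE : (a * (size A + size B).-1.-1 = a * (size A).-1 + a * (size B).-1)%N.
  by rewrite -mulnDr; congr muln; lia.
have wtA : (wt A <= a * (size A).-1 + 1)%N by lia.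
have [->|Ai0] := eqVneq (A`_i) 0; first by rewrite size_poly0.
apply: (@leq_trans (size (A`_i * 'X^(a * i)))); first by rewrite XN // leq_addr.
rewrite -coefPhi; apply: leq_trans (max_size_coefXY _ _) _; apply: leq_trans wtA _.
by rewrite leq_add2r leq_mul2l leq_pred orbT.
Qed.

End ClosedBivariate.

(** * Absolute irreducibility *)

(** A property, not a structure: the fields to which it applies are subfields
    cut out by a predicate. *)
Definition alg_closed (L : fieldType) : Prop :=
  forall p : {poly L}, (1 < size p)%N -> exists r, root p r.

Lemma alg_closed_split (L : fieldType) (p : {poly L}) : alg_closed L -> p \is monic ->
  exists rs : seq L, p = \prod_(r <- rs) ('X - r%:P).
Proof.
move=> Lc; elim: {p}(size p) {-2}p (leqnn (size p)) => [|n IHn] p sp pm.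
  by move: sp (monic_neq0 pm); rewrite leqn0 size_poly_eq0 => ->.
have [sp1|sp1] := leqP (size p) 1.
  have pE := size1_polyC sp1; exists [::]; rewrite big_nil pE.
  by move/monicP: pm; rewrite [X in lead_coef X]pE lead_coefC => ->.
have [r /factor_theorem[q qE]] := Lc p sp1.
have qm : q \is monic by move: pm; rewrite qE monicMr ?monicXsubC.
have [||rs rsE] := IHn q => //.
  by move: sp; rewrite qE size_Mmonic ?monic_neq0 ?monicXsubC // size_XsubC addn2.
by exists (r :: rs); rewrite big_cons qE rsE mulrC.
Qed.

(** A polynomial over [M] taking values in a subfield at infinitely many points
    of that subfield has its coefficients in it: divide differences. *)
Lemma poly_subfield_values (L M : fieldType) (f : {rmorphism L -> M}) (h : {poly M}) :
  [pchar L] =i pred0 -> (forall c, exists d, h.[f c] = f d) ->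
  exists h0, h = map_poly f h0.
Proof.
move=> /pcharf0P chL hv.
have {hv} : exists s : seq L, forall c, c \notin s -> exists d, h.[f c] = f d.
  by exists [::] => c _.
elim: {h}(size h) {-2}h (leqnn (size h)) => [|n IHn] h sh [s hs].
  by exists 0; move: sh; rewrite leqn0 size_poly_eq0 rmorph0 => /eqP.
have [c cs] : exists c, c \notin s.
  have /allPn[c _ cs] : ~~ all (mem s) (mkseq (fun n => n%:R) (size s).+1).
    apply/negP => /allP sub; have := uniq_leq_size _ sub.
    rewrite size_mkseq ltnn => /(_ _)/notF; apply; apply: mkseq_uniq => i j /eqP.
    rewrite -subr_eq0; wlog ij : i j / (j <= i)%N => [wl|].
      by case: (leqP j i) => [/wl//|/ltnW/wl w]; rewrite -oppr_eq0 opprB => /w.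
    by rewrite -natrB // chL subn_eq0 => ji; apply/eqP; rewrite eqn_leq ij ji.
  by exists c.
have [d dE] := hs c cs.
have /factor_theorem[h1 h1E] : root (h - (f d)%:P) (f c).
  by rewrite /root hornerD hornerN hornerC dE subrr.
have hE : h = h1 * ('X - (f c)%:P) + (f d)%:P by rewrite -h1E subrK.
have sh1 : (size h1 <= n)%N.
  have [->|h10] := eqVneq h1 0; first by rewrite size_poly0.
  have : (size (h - (f d)%:P)%R <= n.+1)%N.
    by rewrite (leq_trans (size_polyD _ _)) // size_polyN geq_max sh (leq_trans (size_polyC_leq1 _)).
  by rewrite h1E size_Mmonic ?monicXsubC // size_XsubC addn2.
have [|h0 h0E] := IHn h1 sh1.
  exists (c :: s) => e; rewrite inE negb_or => /andP[ec es].
  have [g gE] := hs e es; exists ((g - d) / (e - c)).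
  have fec : f e - f c != 0 by rewrite -rmorphB fmorph_eq0 subr_eq0.
  by rewrite fmorph_div !rmorphB -gE hE !hornerE; field.
exists (h0 * ('X - c%:P) + d%:P).
by rewrite rmorphD rmorphM rmorphB /= map_polyX !map_polyC -h0E.
Qed.

(** At a point [c] of [L], the coefficients of a monic factor are symmetric
    functions of some of the roots of the specialization of [P] at [c], which
    lie in [L].  Being polynomials over [M] that take values in [L] at all points
    of [L], these coefficients are polynomials over [L]. *)
Lemma irreducible_extension (L : fieldType) (M : closedFieldType)
    (f : {rmorphism L -> M}) (P : {poly {poly L}}) :
  alg_closed L -> [pchar L] =i pred0 -> P \is monic -> irreducible_poly P ->
  irreducible_poly (map_poly (map_poly f) P).
Proof.
move=> Lc chL Pm [sP Pirr].
have f2 : injective (map_poly f) by exact: map_poly_inj.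
have sfP : size (map_poly (map_poly f) P) = size P by rewrite size_map_inj_poly ?rmorph0.
have fPm : map_poly (map_poly f) P \is monic by rewrite monic_map.
split=> [|q sq qP]; first by rewrite sfP.
have [A [B [Am Bm AB sA]]] := gauss_monic fPm qP.
have descend C D : C \is monic -> map_poly (map_poly f) P = C * D ->
    exists C0, C = map_poly (map_poly f) C0.
  move=> Cm CD.
  have Ci i : exists h0, C`_i = map_poly f h0.
    apply: poly_subfield_values => // c.
    have evP : map_poly (horner_eval (f c)) (map_poly (map_poly f) P) =
               map_poly f (map_poly (horner_eval c) P).
      apply/polyP => j; rewrite !coef_map /= /horner_eval.
      by rewrite horner_map.
    have [rs rsE] := alg_closed_split Lc (monic_map (horner_eval c) Pm).
    have : map_poly (horner_eval (f c)) C %| \prod_(r <- rs) ('X - (f r)%:P).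
      have -> : \prod_(r <- rs) ('X - (f r)%:P) = map_poly f (\prod_(r <- rs) ('X - r%:P)).
        by rewrite rmorph_prod; apply: eq_bigr => r _; rewrite rmorphB /= map_polyX map_polyC.
      by rewrite -rsE -evP CD rmorphM dvdp_mulIl.
    move=> /(dvdp_prod_XsubC (F := f))[m mE].
    have CE : map_poly (horner_eval (f c)) C = map_poly f (\prod_(r <- mask m rs) ('X - r%:P)).
      rewrite rmorph_prod; transitivity (\prod_(r <- mask m rs) ('X - (f r)%:P)).
        apply/eqP; rewrite -eqp_monic //; first exact: monic_map.
        exact: monic_prod_XsubC.
      by apply: eq_bigr => r _; rewrite rmorphB /= map_polyX map_polyC.
    exists (\prod_(r <- mask m rs) ('X - r%:P))`_i.
    by rewrite -coef_map -CE coef_map.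
  exists (\poly_(i < size C) projT1 (cid (Ci i))).
  apply/polyP => i; rewrite coef_map coef_poly; case: ltnP => [iC|iC].
    exact: (projT2 (cid (Ci i))).
  by rewrite nth_default // raddf0.
have [A0 A0E] := descend A B Am AB.
have [B0 B0E] := descend B A Bm (etrans AB (mulrC _ _)).
have P0E : P = A0 * B0.
  by apply: (map_inj_poly f2); rewrite ?rmorph0 // rmorphM /= -A0E -B0E.
have sA0 : size A0 = size q by rewrite -sA A0E size_map_inj_poly ?rmorph0.
rewrite -dvdp_size_eqp // sfP -sA0 dvdp_size_eqp ?Pirr ?sA0 //.
  by rewrite P0E dvdp_mulIl.
by rewrite P0E dvdp_mulIl.
Qed.

(** * Lifting factorizations *)

Section Hensel.
Variables (R : idomainType) (p : R).
Hypothesis p0 : p != 0.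
Implicit Types (a b e s t u P A B : {poly R}).

(** Division by a monic polynomial commutes with reduction modulo [q]. *)
Lemma monic_remainder_mod q a (g r d : {poly R}) : a \is monic -> (size r < size a)%N ->
  g * a + r = q *: d -> exists r' : {poly R}, r = q *: r'.
Proof.
move=> am ra E; exists (Pdiv.Ring.rmodp d a).
have dE := Pdiv.RingMonic.rdivp_eq am d.
set d1 := Pdiv.Ring.rdivp d a in dE; set d2 := Pdiv.Ring.rmodp d a in dE *.
have sd2 : (size d2 < size a)%N by rewrite Pdiv.Ring.ltn_rmodpN0 ?monic_neq0.
have E2 : (g - q *: d1) * a = q *: d2 - r.
  have -> : q *: d2 = q *: d - q *: (d1 * a) by rewrite {1}dE scalerDr addrC addKr.
  by rewrite mulrBl -scalerAl -E; ring.
have [g0|g0] := eqVneq (g - q *: d1) 0.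
  by move/eqP: E2; rewrite g0 mul0r eq_sym subr_eq0 => /eqP.
have : (size ((g - q *: d1) * a)%R < size a)%N.
  rewrite E2 (leq_ltn_trans (size_polyD _ _)) // size_polyN gtn_max ra andbT.
  exact: leq_ltn_trans (size_scale_leq _ _) sd2.
rewrite size_Mmonic // => h; have : (0 < size (g - q *: d1)%R)%N by rewrite size_poly_gt0.
by move: h; case: (size (g - q *: d1)) => // n; rewrite addSn /= ltnNge leq_addl.
Qed.

Lemma monic_perturb q a u : a \is monic -> (size u < size a)%N ->
  a + q *: u \is monic /\ size (a + q *: u) = size a.
Proof.
move=> am ua; have su : (size (q *: u) < size a)%N := leq_ltn_trans (size_scale_leq _ _) ua.
by rewrite monicE lead_coefDl // (monicP am) eqxx size_polyDl.
Qed.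

Lemma size_monic_sub a b : a \is monic -> b \is monic -> size a = size b ->
  (size (a - b)%R < size b)%N.
Proof.
move=> am bm ab; have b0 : (0 < size b)%N by rewrite size_poly_gt0 monic_neq0.
rewrite -(prednK b0) ltnS; apply/leq_sizeP => j; rewrite leq_eqVlt => /predU1P[<-|jb].
  by rewrite coefB -{1}ab -!lead_coefE (monicP am) (monicP bm) subrr.
by rewrite coefB !nth_default ?subrr // ?ab; move: jb; rewrite (prednK b0).
Qed.

(** Newton iteration.  If [P - a1 * b1] is [p ^+ n *: e1], corrections
    [p ^+ n *: al] and [p ^+ n *: be] are found by multiplying the Bezout relation
    by [e1]; reducing [al] and [be] modulo the monic factors keeps the sizes, and
    [monic_remainder_mod] shows that the reduction does no harm. *)
Lemma hensel_lift a b s t u e P : a \is monic -> b \is monic -> P \is monic ->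
  size P = (size a + size b).-1 ->
  s * a + t * b = 1 + p *: u -> P = a * b + p *: e ->
  forall T, exists a' b' e' va vb : {poly R}, [/\ a' \is monic, b' \is monic,
    a' = a + p *: va, b' = b + p *: vb & P = a' * b' + p ^+ T.+1 *: e'] /\
    size a' = size a /\ size b' = size b.
Proof.
move=> am bm Pm sP stE PE; elim=> [|T].
  by exists a, b, e, 0, 0; rewrite expr1 !scaler0 !addr0.
move=> [a1 [b1 [e1 [va [vb [[a1m b1m a1E b1E P1E] [sa1 sb1]]]]]]].
set n := T.+1 in P1E *.
have pn0 : p ^+ n != 0 by rewrite expf_neq0.
have abm : a1 * b1 \is monic by rewrite monicMl.
have sab : size (a1 * b1) = size P by rewrite size_Mmonic ?monic_neq0 // sa1 sb1 sP.
have se : (size e1 < size (a1 * b1)%R)%N.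
  rewrite -(size_scale _ pn0) (_ : p ^+ n *: e1 = P - a1 * b1); last by rewrite P1E addrC addKr.
  exact: size_monic_sub.
have [u1 u1E] : exists u1, s * a1 + t * b1 = 1 + p *: u1.
  exists (u + s * va + t * vb).
  transitivity ((s * a + t * b) + p *: (s * va + t * vb)).
    by rewrite a1E b1E -!mul_polyC; ring.
  by rewrite stE -!mul_polyC; ring.
have etE := Pdiv.RingMonic.rdivp_eq a1m (e1 * t).
set q := Pdiv.Ring.rdivp (e1 * t) a1 in etE; set al := Pdiv.Ring.rmodp (e1 * t) a1 in etE.
have sal : (size al < size a1)%N by rewrite Pdiv.Ring.ltn_rmodpN0 ?monic_neq0.
have btE := Pdiv.RingMonic.rdivp_eq b1m (e1 * s + q * b1).
set be1 := Pdiv.Ring.rdivp _ b1 in btE; set be := Pdiv.Ring.rmodp _ b1 in btE.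
have sbe : (size be < size b1)%N by rewrite Pdiv.Ring.ltn_rmodpN0 ?monic_neq0.
have key : be1 * (a1 * b1) + (be * a1 + al * b1 - e1) = p *: (e1 * u1).
  have -> : p *: (e1 * u1) = e1 * (s * a1 + t * b1) - e1 by rewrite u1E mulrDr -scalerAr; ring.
  have -> : e1 * (s * a1 + t * b1) = (e1 * s) * a1 + (e1 * t) * b1 by ring.
  have -> : e1 * s = be1 * b1 + be - q * b1 by rewrite -btE; ring.
  by rewrite etE; ring.
have b1p : (0 < size b1)%N by rewrite size_poly_gt0 monic_neq0.
have a1p : (0 < size a1)%N by rewrite size_poly_gt0 monic_neq0.
have [|r rE] := monic_remainder_mod abm _ key.
  rewrite (leq_ltn_trans (size_polyD _ _)) // size_polyN gtn_max se andbT.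
  rewrite (leq_ltn_trans (size_polyD _ _)) // gtn_max sab sP -sa1 -sb1.
  have lt_pred (x y z : nat) : (x < z)%N -> (0 < y)%N -> ((x + y).-1 < (y + z).-1)%N by lia.
  apply/andP; split; apply: (leq_ltn_trans (size_polyMleq _ _)).
    exact: lt_pred.
  by rewrite [(size a1 + _)%N]addnC; apply: lt_pred.
have [a2m sa2] := monic_perturb (p ^+ n) a1m sal.
have [b2m sb2] := monic_perturb (p ^+ n) b1m sbe.
exists (a1 + p ^+ n *: al), (b1 + p ^+ n *: be), (- r - p ^+ T *: (al * be)).
exists (va + p ^+ T *: al), (vb + p ^+ T *: be).
rewrite sa2 sb2 sa1 sb1; split => //; split => //.
- by rewrite a1E scalerDr scalerA -exprS addrA.
- by rewrite b1E scalerDr scalerA -exprS addrA.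
have e1E : e1 = be * a1 + al * b1 - p *: r by rewrite -rE; ring.
rewrite P1E {1}e1E /n !exprS -!mul_polyC !rmorphM /= !rmorphXn /=; ring.
Qed.

(** If the two factorizations agree modulo [p ^+ n] with discrepancies [al] and
    [be], then [al * b + be * a] vanishes modulo [p]; by the Bezout relation [a]
    divides [al] modulo [p], and [al] is too small for that unless it vanishes. *)
Lemma hensel_unique a b s t u A B w T : a \is monic -> b \is monic ->
  A \is monic -> B \is monic -> size A = size a -> size B = size b ->
  s * a + t * b = 1 + p *: u ->
  (exists v : {poly R}, A = a + p *: v) -> (exists v : {poly R}, B = b + p *: v) ->
  A * B = a * b + p ^+ T.+1 *: w ->
  (exists v : {poly R}, A = a + p ^+ T.+1 *: v) /\ (exists v : {poly R}, B = b + p ^+ T.+1 *: v).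
Proof.
move=> am bm Am Bm sA sB stE Aa Bb ABE.
suff H n : (n <= T)%N ->
    (exists v : {poly R}, A = a + p ^+ n.+1 *: v) /\ (exists v : {poly R}, B = b + p ^+ n.+1 *: v).
  exact: H.
elim: n => [|n IHn] nT; first by rewrite expr1.
have [[al AE] [be BE]] := IHn (ltnW nT).
have pn0 : p ^+ n.+1 != 0 by rewrite expf_neq0.
have sal : (size al < size a)%N.
  rewrite -(size_scale _ pn0) (_ : _ *: al = A - a); last by rewrite AE addrC addKr.
  exact: size_monic_sub.
have sbe : (size be < size b)%N.
  rewrite -(size_scale _ pn0) (_ : _ *: be = B - b); last by rewrite BE addrC addKr.
  exact: size_monic_sub.
have [w' w'E] : exists w' : {poly R}, al * b + be * a = p *: w'.
  exists (p ^+ (T - n.+1) *: w - p ^+ n *: (al * be)).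
  have pn0' : (p ^+ n.+1)%:P != 0 :> {poly R} by rewrite polyC_eq0.
  apply: (mulfI pn0'); move: ABE; rewrite AE BE.
  have -> : T.+1 = (n.+1 + (T - n.+1).+1)%N by lia.
  rewrite exprD [p ^+ (T - n.+1).+1]exprS [p ^+ n.+1]exprS -!mul_polyC !rmorphM /= !rmorphXn /= => E.
  rewrite -[LHS](addrK (p%:P * p%:P ^+ n * p%:P * p%:P ^+ n * (al * be))).
  apply/eqP; rewrite subr_eq; apply/eqP.
  move: E => /(congr1 (fun z => z - a * b)) E.
  transitivity ((a + p%:P * p%:P ^+ n * al) * (b + p%:P * p%:P ^+ n * be) - a * b); first by ring.
  by rewrite E; ring.
have half (c d x y f g : {poly R}) : c \is monic -> (size x < size c)%N ->
    f * c + g * d = 1 + p *: u -> x * d + y * c = p *: w' -> exists x' : {poly R}, x = p *: x'.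
  move=> cm xc fgE xyE; apply: (@monic_remainder_mod p c (g * y - x * f) x (g * w' - x * u) cm xc).
  have -> : (g * y - x * f) * c + x = g * (x * d + y * c) - x * (f * c + g * d - 1) by ring.
  by rewrite xyE fgE -!mul_polyC; ring.
have [al' alE] := half _ _ _ _ _ _ am sal stE w'E.
have [be' beE] : exists be' : {poly R}, be = p *: be'.
  apply: (half b a be al t s bm sbe); first by rewrite addrC.
  by rewrite addrC.
split; [exists al'; rewrite AE alE|exists be'; rewrite BE beE];
  by rewrite scalerA -exprSr.
Qed.

End Hensel.

(** * Sizes of factors of integer polynomials *)

(** The right-hand side is the value at [1] of the product in which each root [r]
    is replaced by [- `|r|]; this change can only increase the coefficients. *)
Lemma coef_prod_XsubC_bound (rs : seq algC) i :
  `|(\prod_(r <- rs) ('X - r%:P))`_i| <= \prod_(r <- rs) (1 + `|r|).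
Proof.
elim: rs i => [|r rs IHrs] i; first by rewrite !big_nil coef1; case: (i == 0%N); rewrite ?normr1 ?normr0.
rewrite !big_cons mulrBl coefB coefXM coefCM mulrDl mul1r.
apply: le_trans (ler_normB _ _) _; apply: lerD; last by rewrite normrM ler_wpM2l.
case: eqP => // _; rewrite normr0; apply: prodr_ge0 => s _; exact: addr_ge0.
Qed.

Lemma root_bound (h : {poly algC}) r : h \is monic -> root h r ->
  `|r| <= 1 + \sum_(i < (size h).-1) `|h`_i|.
Proof.
move=> hm /rootP hr; set S := \sum_(i < _) _.
have S0 : 0 <= S by apply: sumr_ge0.
have [r1|r1] := real_leP (normr_real r) (real1 algC); first by rewrite (le_trans r1) // lerDl.
have sh : size h = (size h).-1.+1 by rewrite prednK // size_poly_gt0 monic_neq0.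
move: hr; rewrite horner_coef sh big_ord_recr /= -lead_coefE (monicP hm) mul1r.
move/eqP; rewrite addrC addr_eq0 => /eqP rE.
have D0 : (0 < (size h).-1)%N.
  rewrite lt0n; apply/eqP => D0; move: rE; rewrite D0 big_ord0 oppr0 expr0 => /eqP.
  by rewrite oner_eq0.
have : `|r| ^+ (size h).-1 <= S * `|r| ^+ (size h).-1.-1.
  rewrite -normrX rE normrN (le_trans (ler_norm_sum _ _ _)) // mulr_suml.
  apply: ler_sum => i _; rewrite normrM normrX ler_wpM2l //.
  by apply: ler_weXn2l; rewrite ?(ltW r1) // -ltnS (prednK D0).
rewrite -{1}(prednK D0) exprS ler_pM2r ?exprn_gt0 ?(lt_trans ltr01) // => h1.
by rewrite (le_trans h1) // lerDr.
Qed.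

(** The coefficients of a factor are bounded in terms of its roots, which are
    roots of [h] and so bounded in terms of the coefficients of [h].  A crude
    bound suffices, as long as it is polynomial in these coefficients. *)
Lemma int_factor_bound (h A B : {poly int}) : A \is monic -> B \is monic -> h = A * B ->
  forall i, (absz (A`_i)%R <= (2 + \sum_(i < (size h).-1) absz (h`_i)%R) ^ (size h))%N.
Proof.
move=> Am Bm hE i.
pose C (q : {poly int}) : {poly algC} := map_poly intr q.
have hm : h \is monic by rewrite hE monicMl.
have Cm q : q \is monic -> C q \is monic by move=> qm; rewrite monic_map.
have [rs ArE] := closed_field_poly_normal (C A).
move: ArE; rewrite (monicP (Cm _ Am)) scale1r => ArE.
set S := (\sum_(i < (size h).-1) absz (h`_i)%R)%N.
have rb r : r \in rs -> 1 + `|r| <= (2 + S)%:R.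
  move=> rrs; have : root (C h) r.
    by rewrite /C hE rmorphM /= -/(C A) -/(C B) rootM ArE root_prod_XsubC rrs.
  move=> /(root_bound (Cm _ hm)); rewrite size_map_inj_poly ?rmorph0 //; last exact: intr_inj.
  rewrite natrD -[2%:R]/(1 + 1) -addrA lerD2l => /le_trans; apply.
  rewrite lerD2l natr_sum; apply: ler_sum => j _.
  by rewrite coef_map /= -intr_norm natr_absz.
have srs : (size rs <= size h)%N.
  have sA : size (C A) = size A by rewrite size_map_inj_poly ?rmorph0 //; exact: intr_inj.
  have : size (C A) = (size rs).+1 by rewrite ArE size_prod_XsubC.
  rewrite sA hE size_Mmonic ?monic_neq0 // => ->; have : (0 < size B)%N by rewrite size_poly_gt0 monic_neq0.
  by rewrite addSn; lia.
rewrite -(ler_nat algC) natr_absz intr_norm.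
have -> : (A`_i)%:~R = (C A)`_i :> algC by rewrite coef_map.
rewrite ArE (le_trans (coef_prod_XsubC_bound _ _)) //.
apply: (@le_trans _ _ ((2 + S)%:R ^+ size rs)).
  have : {subset rs <= rs} by [].
  elim: {-2}rs => [|r rs' IH] sub; first by rewrite big_nil expr0.
  rewrite big_cons exprS; apply: ler_pM.
  - by rewrite addr_ge0.
  - by apply: prodr_ge0 => j _; rewrite addr_ge0.
  - by apply: rb; apply: sub; rewrite mem_head.
  - by apply: IH => j js; apply: sub; rewrite inE js orbT.
rewrite natrX; apply: ler_weXn2l => //.
by rewrite ler1n.
Qed.

(** * Hilbert's irreducibility theorem over the rationals *)

(** The integer matrix [z] is a multiple of the cokernel of the Vandermonde
    matrix: its columns span the linear relations satisfied by the values of all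
    polynomials of size at most [k]. *)
Lemma interpolation_relations (M k : nat) (l : 'I_M -> nat) :
  exists z : 'I_M -> 'I_M -> int,
    (forall psi : {poly int}, (size psi <= k)%N ->
       forall j, \sum_i psi.[(l i)%:Z] * z i j = 0) /\
    (forall u : 'I_M -> int, (forall j, \sum_i u i * z i j = 0) ->
       exists h : {poly rat}, (size h <= k)%N /\ forall i, h.[(l i)%:R] = (u i)%:~R).
Proof.
pose V : 'M[rat]_(k, M) := \matrix_(j, i) (l i)%:R ^+ j.
pose C := cokermx V.
pose d : int := \prod_ij denq (C ij.1 ij.2).
have dC i j : exists n : int, d%:~R * C i j = n%:~R.
  rewrite /d (bigD1 (i, j)) //=; set r := \prod_(_ | _) _; exists (r * numq (C i j)).
  by rewrite !rmorphM /= numqE; ring.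
pose z i j := projT1 (cid (dC i j)).
have zE i j : (z i j)%:~R = d%:~R * C i j by rewrite -(projT2 (cid (dC i j))).
have d0 : d%:~R != 0 :> rat.
  by rewrite intr_eq0; apply/prodf_neq0 => ij _; rewrite denq_neq0.
exists z; split.
  move=> psi spsi j; apply: (@intr_inj rat).
  pose a : 'rV[rat]_k := \row_t (psi`_t)%:~R.
  have : (a *m V) *m C = 0 by rewrite -mulmxA mulmx_coker mulmx0.
  move=> /rowP/(_ j); rewrite !mxE => /(congr1 ( *%R d%:~R)); rewrite mulr0 mulr_sumr => E.
  rewrite rmorph0 -[RHS]E rmorph_sum; apply: eq_bigr => i _.
  rewrite rmorphM /= zE mulrCA; congr (_ * (_ * _)).
  rewrite !mxE (horner_coef_wide _ spsi) rmorph_sum; apply: eq_bigr => t _.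
  by rewrite !mxE rmorphM rmorphXn /= -pmulrn.
move=> u uz; pose w : 'rV[rat]_M := \row_i (u i)%:~R.
have : (w <= V)%MS.
  rewrite submxE; apply/eqP/rowP => j; rewrite !mxE; apply: (mulfI d0); rewrite mulr0.
  have := congr1 (fun x : int => x%:~R : rat) (uz j); rewrite rmorph0 rmorph_sum => E.
  rewrite -[RHS]E mulr_sumr; apply: eq_bigr => i _.
  have -> : w 0 i = (u i)%:~R by rewrite mxE.
  by rewrite rmorphM /= zE /C; ring.
move=> /submxP[a aE]; exists (rVpoly a); split; first exact: size_poly.
move=> i; have := congr1 (fun x : 'rV[rat]_M => x 0 i) aE; rewrite !mxE => ->.
rewrite (horner_coef_wide _ (size_poly _ _)); apply: eq_bigr => t _.
by rewrite !mxE coef_rVpoly_ord.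
Qed.

(** The linear relations between the values of polynomials of small degree hold
    modulo [q] for the integers [u i]; as these are small compared to [q], the
    relations hold exactly, and they characterize values of polynomials. *)
Lemma small_values_interpolate (M k : nat) (l : 'I_M -> nat) :
  exists W : nat, forall (q U : nat) (u : 'I_M -> int) (psi : {poly int}),
    (size psi <= k)%N -> (forall i, exists v : int, u i = psi.[(l i)%:Z] + q%:Z * v) ->
    (forall i, absz (u i) <= U)%N -> (U * W < q)%N ->
    exists h : {poly rat}, (size h <= k)%N /\ forall i, h.[(l i)%:R] = (u i)%:~R.
Proof.
have [z [zpsi zu]] := interpolation_relations k l.
exists (\sum_i \sum_j absz (z i j))%N => q U u psi spsi uv uU Uq.
apply: zu => j.
have [v vE] := choice uv.
have SE : \sum_i u i * z i j = q%:Z * \sum_i v i * z i j.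
  transitivity (\sum_i psi.[(l i)%:Z] * z i j + \sum_i q%:Z * (v i * z i j)).
    by rewrite -big_split; apply: eq_bigr => i _; rewrite vE /=; ring.
  by rewrite (zpsi _ spsi) add0r mulr_sumr.
have small : (absz (\sum_i u i * z i j)%R < q)%N.
  apply: leq_ltn_trans Uq.
  have tri (I : finType) (F : I -> int) : (absz (\sum_i F i)%R <= \sum_i absz (F i))%N.
    apply: (big_ind2 (fun (x : int) (y : nat) => (absz x <= y)%N)) => // x1 x2 y1 y2; lia.
  apply: leq_trans (tri _ _) _; rewrite big_distrr /=; apply: leq_sum => i _.
  rewrite abszM; apply: leq_mul => //; rewrite (bigD1 j) //= leq_addr //.
move: small; rewrite SE abszM absz_nat -{2}[q]muln1 ltn_pmul2l; last exact: leq_ltn_trans Uq.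
by rewrite ltnS leqn0 absz_eq0 => /eqP ->; rewrite mulr0.
Qed.

Lemma ae_many (P : nat -> Prop) M : ae P ->
  exists l : 'I_M -> nat, injective l /\ forall i, P (l i).
Proof.
move=> aP; have [s [us sM sP]] : exists s : seq nat, [/\ uniq s, size s = M & forall x, x \in s -> P x].
  elim: M => [|M [s [us sM sP]]]; first by exists [::].
  have [n [Pn nlt]] := ae_ex (ae_and aP (ae_ge (\max_(x <- s) x).+1)).
  exists (n :: s); rewrite /= us sM andbT; split => //.
    by apply/negP => ns; move: nlt; rewrite ltnNge (@leq_bigmax_seq _ s xpredT id n ns isT).
  by move=> x; rewrite inE => /predU1P[->|/sP].
exists (fun i => nth 0%N s i); split.
  by move=> i j /eqP; rewrite nth_uniq ?sM // => /eqP/val_inj.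
by move=> i; apply: sP; rewrite mem_nth ?sM.
Qed.

Lemma comp_linear_mod (q : {poly int}) (c p : int) :
  exists w, q \Po (c%:P + p *: 'X) = q.[c]%:P + p *: w.
Proof.
elim/poly_ind: q => [|q a [w wE]]; first by exists 0; rewrite comp_poly0 horner0 scaler0 addr0.
exists (w * (c%:P + p *: 'X) + q.[c] *: 'X).
rewrite comp_polyD comp_polyM comp_polyX comp_polyC wE !hornerE.
by rewrite rmorphD rmorphM /= -!mul_polyC; ring.
Qed.

Lemma poly_int_eqmod (p : nat) (a b : {poly int}) : prime p ->
  (forall i, (a`_i)%:~R = (b`_i)%:~R :> 'F_p) -> exists v, a = b + p%:Z *: v.
Proof.
move=> pp ab; exists (\poly_(i < maxn (size a) (size b)) ((a`_i - b`_i) %/ p)%Z).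
apply/polyP => i; rewrite coefD coefZ coef_poly.
case: ltnP => [_|]; last first.
  by rewrite geq_max => /andP[ia ib]; rewrite !nth_default // mulr0 addr0.
have : (p %| a`_i - b`_i)%Z.
  rewrite (_ : (p %| _)%Z = ((a`_i - b`_i)%:~R == 0 :> 'F_p)).
    by rewrite rmorphB /= ab subrr.
  rewrite dvdzE absz_nat (dvdn_pcharf (pchar_Fp pp)); case: (a`_i - b`_i) => n //.
  by rewrite NegzE rmorphN /= oppr_eq0.
by move=> /divzK; rewrite mulrC => ->; rewrite addrC subrK.
Qed.

Lemma clear_rat_poly (Q : {poly {poly rat}}) :
  exists d (Q' : {poly {poly int}}), d != 0 :> int /\
    map_poly (map_poly intr) Q' = (d%:~R)%:P *: Q.
Proof.
have clear1 (q : {poly rat}) : exists d (q' : {poly int}), d != 0 /\ map_poly intr q' = d%:~R *: q.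
  have [q' [d d0 qE]] := rat_poly_scale q; exists d, q'; split => //.
  by rewrite qE scalerA divff ?intr_eq0 // scale1r.
pose dq i := projT1 (cid (clear1 Q`_i)).
have dqP i : exists q' : {poly int}, dq i != 0 /\ map_poly intr q' = (dq i)%:~R *: Q`_i.
  exact: (projT2 (cid (clear1 Q`_i))).
have [f fE] := choice dqP.
exists (\prod_(i < size Q) dq i).
exists (\poly_(i < size Q) (\prod_(j < size Q | j != i :> nat) dq j *: f i)); split.
  by apply/prodf_neq0 => i _; case: (fE i).
apply/polyP => i; rewrite coef_map coefZ coef_poly; case: ltnP => [iQ|iQ]; last first.
  by rewrite (nth_default 0 iQ) raddf0 mulr0.
rewrite /= map_polyZ (fE i).2 scalerA -mul_polyC -rmorphM; congr (_%:P * _).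
by rewrite /= [in RHS](bigD1 (Ordinal iQ)) //= [in RHS]mulrC.
Qed.

Notation spec m := (map_poly (horner_eval m)).

Lemma horner_bound (q : {poly int}) (m : nat) : (0 < m)%N ->
  (absz q.[m%:Z] <= (\sum_(j < size q) absz (q`_j)%R) * m ^ size q)%N.
Proof.
move=> m0; rewrite horner_coef big_distrl /=.
apply: (big_ind2 (fun (x : int) (y : nat) => (absz x <= y)%N)) => [||j _] //.
  by move=> x1 x2 y1 y2; lia.
rewrite abszM leq_mul2l; apply/orP; right.
by rewrite abszX absz_nat leq_pexp2l // ltnW.
Qed.

(** The coefficients of [spec m P] grow like a power of [m], and those of its
    factors are bounded by a power of them. *)
Lemma factor_power_bound (P : {poly {poly int}}) : P \is monic ->
  exists C k, forall m : nat, (0 < m)%N -> forall A B, A \is monic -> B \is monic ->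
    spec m%:Z P = A * B -> forall i, (absz (A`_i)%R <= C * m ^ k)%N.
Proof.
move=> Pm; set e := sizeY P.
pose H i := (\sum_(j < size (P`_i)%R) absz ((P`_i)`_j)%R)%N.
exists ((2 + \sum_(i < (size P).-1) H i) ^ size P)%N, (e * size P)%N.
move=> m m0 A B Am Bm AB i.
have sP : size (spec m%:Z P) = size P.
  have : spec m%:Z P \is monic by exact: monic_map.
  by move=> hm; rewrite size_map_poly_id0 // (monicP Pm) /horner_eval hornerC oner_eq0.
apply: leq_trans (int_factor_bound Am Bm AB i) _; rewrite sP expnM -expnMn leq_exp2r; last first.
  by rewrite size_poly_gt0 monic_neq0.
have me : (0 < m ^ e)%N by rewrite expn_gt0 m0.
rewrite mulnDl; apply: leq_add; first by rewrite -[X in (X <= _)%N]muln1 leq_mul2l me.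
rewrite big_distrl /=; apply: leq_sum => j _; rewrite coef_map /= /horner_eval.
apply: leq_trans (horner_bound _ m0) _; rewrite leq_mul2l; apply/orP; right.
by rewrite leq_pexp2l // max_size_coefXY.
Qed.

(** The point avoids the zeros of an eliminant [d] of [P] and its derivative, and
    the prime avoids the divisors of the value of [d] there.  The conclusion is
    separability modulo [p] in the form used for lifting. *)
Lemma separable_point (P : {poly {poly int}}) : P \is monic -> irreducible_poly P ->
  exists (c p : nat) (s t u : {poly int}), prime p /\
    s * spec c%:Z P + t * (spec c%:Z P)^`() = 1 + p%:Z *: u.
Proof.
move=> Pm [sP Pirr].
have P0 : P != 0 by exact: monic_neq0.
have coP : coprimep P P^`().
  rewrite /coprimep; apply: contraTT sP => g1.
  have := Pirr _ g1 (dvdp_gcdl _ _); rewrite /eqp => /andP[_ Pg].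
  have PP' := dvdp_trans Pg (dvdp_gcdr P P^`()).
  have [P'0|P'0] := eqVneq P^`() 0; last first.
    by have := dvdp_leq P'0 PP'; rewrite leqNgt lt_size_deriv.
  rewrite -leqNgt leqNgt; apply/negP => sP.
  have := congr1 (fun q : {poly {poly int}} => q`_(size P).-2) P'0.
  rewrite coef_deriv coef0 -subn2 -subSn // subn2 /= -lead_coefE (monicP Pm) => /eqP.
  by rewrite -(rmorph_nat (@polyC int)) polyC_eq0 natz; case: (size P) sP => [|[|n]].
have /Bezout_coprimepP[[u v] /= uvE] := coP.
have [d d0 dE] : exists2 d, d != 0 & u * P + v * P^`() = d%:P.
  by apply/size_poly1P; rewrite size_poly_eq1.
have [c cd] : exists c : nat, d.[c%:Z] != 0.
  have /allPn[_ /mapP[c _ ->] rc] : ~~ all (root d) (map Posz (iota 0 (size d))).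
    apply/negP => /(max_poly_roots d0); rewrite size_map size_iota ltnn => /(_ _)/notF; apply.
    by rewrite map_inj_uniq ?iota_uniq // => x y [].
  by exists c.
have [p pd pp] := prime_above (absz d.[c%:Z]).
have cop : coprimez d.[c%:Z] p%:Z.
  rewrite coprimezE absz_nat coprime_sym prime_coprime // gtnNdvd // absz_gt0 //.
have /coprimezP[[x y] /= xyE] := cop.
exists c, p, (x *: spec c%:Z u), (x *: spec c%:Z v), (- y)%:P; split => //.
have -> : x *: spec c%:Z u * spec c%:Z P + x *: spec c%:Z v * (spec c%:Z P)^`() =
    x *: spec c%:Z (u * P + v * P^`()).
  by rewrite -!scalerAl -scalerDr deriv_map rmorphD !rmorphM.
rewrite dE map_polyC /= /horner_eval.
rewrite -mul_polyC -mul_polyC -!rmorphM /= -[1]/(1%:P) -rmorphD; congr (_%:P).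
by rewrite -xyE; ring.
Qed.

Lemma addn_pred_eq (m n : nat) : (0 < m)%N -> (m + n).-1 = m -> n = 1%N.
Proof. by lia. Qed.

Lemma spec_shift (P : {poly {poly int}}) (c p y : int) :
  spec y (map_poly (comp_poly (c%:P + p *: 'X)) P) = spec (c + p * y) P.
Proof.
apply/polyP => i; rewrite !coef_map /= /horner_eval horner_comp.
by rewrite !hornerE.
Qed.

(** Modulo [p], the polynomial in the variable [c + p * X] is constant in [X]. *)
Lemma shift_mod (P : {poly {poly int}}) (c p : int) :
  exists W, map_poly (comp_poly (c%:P + p *: 'X)) P = map_poly polyC (spec c P) + p%:P *: W.
Proof.
have [w wE] := choice (fun q => comp_linear_mod q c p).
exists (\poly_(i < size P) w P`_i); apply/polyP => i.
rewrite coefD coefZ !coef_map /= coef_poly; case: ltnP => [iP|Pi].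
  by rewrite wE mul_polyC.
by rewrite nth_default // comp_poly0 /horner_eval horner0 polyC0 mulr0 addr0.
Qed.

Lemma horner_truncate (q : {poly int}) (K : nat) (y l : int) :
  exists w, q.[y * l] = (\poly_(t < K) (q`_t * y ^+ t)).[l] + y ^+ K * w.
Proof.
exists (l ^+ K * (drop_poly K q).[y * l]).
rewrite -{1}(poly_take_drop K q) hornerD hornerM hornerXn exprMn; congr (_ + _); last by ring.
rewrite (horner_coef_wide _ (size_take_poly K q)) horner_poly; apply: eq_bigr => t _.
by rewrite coef_take_poly ltn_ord exprMn; ring.
Qed.

(** If all large [m] are bad, each polynomial [spec m P] has a proper monic
    factorization.  At [m = c + p ^ s.+1 * l] it reduces modulo [p] to one of the
    finitely many factorizations of the separable polynomial [spec c P].  Two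
    uses of the ultrafilter give many values of [l], and then one [s], for which
    the reduction and the degrees are always the same.  By Hensel's lemma
    there are polynomials in the variable [X], with [m = c + p * X], that
    factor the whole family up to high powers of [p].  As [X] is [p ^ s * l], a
    coefficient of a factor at [m] is, modulo [p ^ (s * k.+1)], the value at [l]
    of a polynomial of degree at most [k].  But it is also bounded by a constant
    times [p ^ (s * k)].  So, for large [s], it is the value of a rational
    polynomial of degree at most [k], by [small_values_interpolate].  The
    factorizations at sufficiently many [l] are thus values of one
    factorization over the rational polynomials, which contradicts the
    irreducibility of [P]. *)
Theorem hilbert_irreducibility_int (P : {poly {poly int}}) :
  P \is monic -> irreducible_poly P ->
  forall N0, exists m : nat, (N0 < m)%N /\ forall A B : {poly int},
    A \is monic -> B \is monic -> spec m%:Z P = A * B -> size A = 1%N \/ size B = 1%N.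
Proof.
move=> Pm Pirr N0; apply: contrapT => noN.
have P0 : P != 0 by exact: monic_neq0.
have bad m : (N0 < m)%N -> exists AB : {poly int} * {poly int},
    [/\ AB.1 \is monic, AB.2 \is monic, spec m%:Z P = AB.1 * AB.2,
        size AB.1 <> 1%N & size AB.2 <> 1%N].
  move=> Nm; apply: contrapT => nAB; apply: noN; exists m; split => // A B Am Bm AB.
  apply: contrapT => /not_orP[sA sB]; apply: nAB; by exists (A, B).
have [c [p [s0 [t0 [u0 [pp stE]]]]]] := separable_point Pm Pirr.
have [C [k Ck]] := factor_power_bound Pm.
pose F m : {poly int} * {poly int} :=
  if pselect (N0 < m)%N is left h then projT1 (cid (bad m h)) else (1, 1).
have FP m : (N0 < m)%N -> [/\ (F m).1 \is monic, (F m).2 \is monic,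
    spec m%:Z P = (F m).1 * (F m).2, size (F m).1 <> 1%N & size (F m).2 <> 1%N].
  move=> Nm; rewrite /F; case: pselect => // h; exact: (projT2 (cid (bad m h))).
set D := size P.
pose x (s l : nat) := (c + p * p ^ s * l)%N.
pose red (q : {poly int}) : {ffun 'I_D.+1 -> 'F_p} := [ffun i : 'I_D.+1 => (q`_i)%:~R].
pose col s l := (inord (size (F (x s l)).1) : 'I_D.+1, inord (size (F (x s l)).2) : 'I_D.+1,
                 (red (F (x s l)).1, red (F (x s l)).2)).
have colP l : exists z, ae (fun s => col s l = z).
  by apply: ae_fin; apply: aeT => s; exists (col s l).
have [chi chiP] := choice colP.
have [z zP] : exists z, ae (fun l => chi l = z).
  by apply: ae_fin; apply: aeT => l; exists (chi l).
(* The number [M] of points exceeds the degrees of all coefficients of [P] and of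
   a product of two factors with coefficients of size at most [k.+1]. *)
set M := ((2 * k.+1 + sizeY P).+2)%N.
have [l [linj lP]] := ae_many M (ae_and zP (ae_ge 1%N)).
have [W WP] := small_values_interpolate k.+1 l.
set Lm := (\max_i l i)%N.
set U0 := (C * (c + p * Lm) ^ k)%N.
have [s [sz sbig]] : exists s, (forall i, col s (l i) = z) /\ (maxn N0.+1 (U0 * W).+1 <= s)%N.
  apply: ae_ex; apply: ae_and (ae_ge _).
  have h i : ae (fun s => col s (l i) = z) by have [<- _] := lP i; exact: chiP.
  have H := @ae_all_seq _ (enum 'I_M) (fun i s => col s (l i) = z) (fun i _ => h i).
  by apply: ae_imp H _ => s Hs i; apply: Hs; rewrite mem_enum.
have sN : (N0 < s)%N by apply: leq_trans sbig; rewrite leq_max ltnSn.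
have sU : (U0 * W < s)%N by apply: leq_trans sbig; rewrite leq_max ltnSn orbT.
have p1 : (1 < p)%N := prime_gt1 pp.
have sps : (s < p ^ s)%N := ltn_expl s p1.
pose A i := (F (x s (l i))).1; pose B i := (F (x s (l i))).2.
have xN i : (N0 < x s (l i))%N.
  rewrite /x; have [_ l1] := lP i; have : (s <= p * p ^ s * l i)%N.
    by apply: leq_trans (ltnW sps) _; rewrite mulnAC leq_pmull // muln_gt0 (ltnW p1).
  by move: sN; lia.
have FE i : [/\ A i \is monic, B i \is monic, spec (x s (l i))%:Z P = A i * B i,
    size (A i) <> 1%N & size (B i) <> 1%N] by exact: FP.
have sP : forall m, size (spec m P) = D.
  move=> m; rewrite size_map_poly_id0 // (monicP Pm) /horner_eval hornerC; exact: oner_neq0.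
have sAB i : (size (A i) + size (B i)).-1 = D /\ (0 < size (A i))%N /\ (0 < size (B i))%N.
  have [Am Bm AB _ _] := FE i; rewrite -(sP (x s (l i))%:Z) AB size_Mmonic ?monic_neq0 //.
  by rewrite !size_poly_gt0 !monic_neq0.
pose a := A ord0; pose b := B ord0.
have same i : [/\ size (A i) = size a, size (B i) = size b,
    exists v, A i = a + p%:Z *: v & exists v, B i = b + p%:Z *: v].
  have := etrans (sz i) (esym (sz ord0)); rewrite /col -/(A i) -/(B i) -/a -/b => -[sA sB rA rB].
  have [h1 [h2 h3]] := sAB i; have [g1 [g2 g3]] := sAB ord0; rewrite -/a -/b in g1 g2 g3.
  have inordE (m n m' n' : nat) : (m + m').-1 = D -> (n + n').-1 = D -> (0 < m')%N -> (0 < n')%N ->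
      inord m = inord n :> 'I_D.+1 -> m = n.
    move=> hm hn m'0 n'0 /(congr1 (@nat_of_ord _)); rewrite !inordK // -?hm -?hn; lia.
  have sAi : size (A i) = size a := inordE _ _ _ _ h1 g1 h3 g3 sA.
  have sBi : size (B i) = size b.
    by apply: (inordE _ _ (size (A i)) (size a)) sB => //; rewrite addnC.
  have leD (m m' : nat) : (m + m').-1 = D -> (0 < m')%N -> (m <= D)%N by lia.
  have saD : (size a <= D)%N := leD _ _ g1 g3.
  have sbD : (size b <= D)%N by apply: (leD _ (size a)) => //; rewrite addnC.
  split => //; apply: poly_int_eqmod pp _ => j.
    have [jD|/ltnW jD] := ltnP j D.+1; last by rewrite !nth_default ?sAi // (leq_trans _ jD).
    by move/ffunP/(_ (Ordinal jD)): rA; rewrite !ffunE.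
  have [jD|/ltnW jD] := ltnP j D.+1; last by rewrite !nth_default ?sBi // (leq_trans _ jD).
  by move/ffunP/(_ (Ordinal jD)): rB; rewrite !ffunE.
have [am bm abE a1 b1] := FE ord0; rewrite -/a -/b in am bm abE a1 b1.
(* In the variable of [PX], the factorization [a * b] at the first point is a
   factorization modulo [p] of the whole family, with coprime factors. *)
set PX := map_poly (comp_poly (c%:Z%:P + p%:Z *: 'X)) P.
pose y i : int := (p ^ s * l i)%N%:Z.
have specPX i : spec (y i) PX = A i * B i.
  have [_ _ <- _ _] := FE i; rewrite spec_shift; congr (spec _ P).
  by rewrite /y /x !PoszD !PoszM; ring.
have [W1 W1E] := shift_mod P c%:Z p%:Z.
have ev_polyC m (q : {poly int}) : spec m (map_poly polyC q) = q.
  by apply/polyP => j; rewrite !coef_map /= /horner_eval hornerC.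
have specZ m (r : {poly int}) Q : spec m (r *: Q) = r.[m] *: spec m Q.
  by apply/polyP => j; rewrite coefZ !coef_map coefZ /= /horner_eval hornerM.
set e0 := spec (y ord0) W1.
have PcE : a * b = spec c%:Z P + p%:Z *: e0.
  by rewrite -specPX /PX W1E rmorphD /= ev_polyC specZ hornerC.
pose s1 := s0 * b + t0 * b^`(); pose t1 := t0 * a^`(); pose u1 := u0 + s0 * e0 + t0 * e0^`().
have bez : s1 * a + t1 * b = 1 + p%:Z *: u1.
  have dE : a^`() * b + a * b^`() = (spec c%:Z P)^`() + p%:Z *: e0^`().
    by rewrite -derivM PcE derivD derivZ.
  transitivity (s0 * (a * b) + t0 * (a^`() * b + a * b^`())); first by rewrite /s1 /t1; ring.
  rewrite PcE dE; transitivity ((s0 * spec c%:Z P + t0 * (spec c%:Z P)^`()) +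
    p%:Z *: (s0 * e0 + t0 * e0^`())); first by rewrite -!mul_polyC; ring.
  by rewrite stE /u1 -!mul_polyC; ring.
pose up (q : {poly int}) : {poly {poly int}} := map_poly polyC q.
have upm q : q \is monic -> up q \is monic by move=> qm; rewrite monic_map.
have sup q : size (up q) = size q by rewrite size_map_inj_poly //; exact: polyC_inj.
have PXm : PX \is monic by rewrite monic_map.
have upZ r q : up (r *: q) = r%:P *: up q by rewrite /up map_polyZ.
have sPX : size PX = (size (up a) + size (up b)).-1.
  rewrite !sup (sAB ord0).1 size_map_poly_id0 // (monicP Pm) /= comp_polyC polyC1.
  exact: oner_neq0.
have bezX : up s1 * up a + up t1 * up b = 1 + (p%:Z%:P) *: up u1.
  by rewrite -upZ -!rmorphM -rmorphD bez rmorphD rmorph1.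
have PXE : PX = up a * up b + p%:Z%:P *: (W1 - up e0).
  by rewrite /PX W1E -rmorphM /= PcE rmorphD /= map_polyZ /= scalerBr addrA addrAC addrK.
have p0 : (p%:Z : int) != 0 by rewrite -lt0n; apply: ltnW.
have pX0 : p%:Z%:P != 0 :> {poly int} by rewrite polyC_eq0.
pose T := (s * k.+1).-1.
have TE : T.+1 = (s * k.+1)%N by rewrite prednK // muln_gt0 (leq_ltn_trans _ sN).
have [aT [bT [eT [va [vb [[aTm bTm aTE bTE PTE] [saT sbT]]]]]]] :=
  hensel_lift pX0 (upm _ am) (upm _ bm) PXm sPX bezX PXE T.
(* By uniqueness, the actual factors are specializations of the lifted ones. *)
have near_lift i : (exists v, A i = spec (y i) aT + p%:Z ^+ T.+1 *: v) /\
                   (exists v, B i = spec (y i) bT + p%:Z ^+ T.+1 *: v).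
  have [sA sB [vA vAE] [vB vBE]] := same i; have [Am Bm _ _ _] := FE i.
  have aiE : spec (y i) aT = a + p%:Z *: spec (y i) va.
    by rewrite aTE rmorphD /= ev_polyC specZ hornerC.
  have biE : spec (y i) bT = b + p%:Z *: spec (y i) vb.
    by rewrite bTE rmorphD /= ev_polyC specZ hornerC.
  have sizem (Q : {poly {poly int}}) : Q \is monic -> size (spec (y i) Q) = size Q.
    move=> Qm; rewrite size_map_poly_id0 // (monicP Qm) /horner_eval hornerC; exact: oner_neq0.
  apply: (@hensel_unique int p%:Z p0 (spec (y i) aT) (spec (y i) bT) s1 t1
    (u1 + s1 * spec (y i) va + t1 * spec (y i) vb) (A i) (B i) (spec (y i) eT) T) => //.
  - exact: monic_map.
  - exact: monic_map.
  - by rewrite sizem // saT sup.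
  - by rewrite sizem // sbT sup.
  - rewrite aiE biE; transitivity (s1 * a + t1 * b + p%:Z *: (s1 * spec (y i) va + t1 * spec (y i) vb)).
      by rewrite -!mul_polyC; ring.
    by rewrite bez -!mul_polyC; ring.
  - by exists (vA - spec (y i) va); rewrite vAE aiE -!mul_polyC; ring.
  - by exists (vB - spec (y i) vb); rewrite vBE biE -!mul_polyC; ring.
  - by rewrite -specPX PTE rmorphD rmorphM /= specZ -polyC_exp hornerC.
have bound i : (C * x s (l i) ^ k <= U0 * (p ^ s) ^ k)%N.
  rewrite /U0 -mulnA leq_mul2l -expnMn; apply/orP; right.
  have [->|k0] := posnP k; first by rewrite !expn0.
  rewrite leq_exp2r // mulnDl; apply: leq_add.
    by rewrite -[X in (X <= _)%N]muln1 leq_mul2l expn_gt0 (ltnW p1) orbT.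
  rewrite -mulnA -mulnA leq_mul2l mulnC leq_mul2r; apply/orP; right; apply/orP; right.
  exact: (leq_bigmax (F := fun i => l i)).
have interp (Q : 'I_M -> {poly int}) (QT : {poly {poly int}}) j :
    (forall i, exists v, Q i = spec (y i) QT + p%:Z ^+ T.+1 *: v) ->
    (forall i, (absz ((Q i)`_j)%R <= C * x s (l i) ^ k)%N) ->
    exists h : {poly rat}, (size h <= k.+1)%N /\ forall i, h.[(l i)%:R] = ((Q i)`_j)%:~R.
  move=> Qv Qb; apply: (WP (p ^ (s * k.+1))%N (U0 * (p ^ s) ^ k)%N _
      (\poly_(t < k.+1) ((QT`_j)`_t * (p ^ s)%N%:Z ^+ t))) => [|i|i|].
  - exact: size_poly.
  - have [v vE] := Qv i.
    have [w wE] := horner_truncate QT`_j k.+1 (p ^ s)%N%:Z (l i)%:Z.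
    have pTE : p%:Z ^+ T.+1 = (p ^ (s * k.+1))%N%:Z by rewrite TE -!natz natrX.
    have psE : (p ^ s)%N%:Z ^+ k.+1 = (p ^ (s * k.+1))%N%:Z
      by rewrite expnM; move: (p ^ s)%N => q; rewrite -!natz natrX.
    exists (w + v`_j); rewrite vE coefD coefZ coef_map /= /horner_eval pTE /y PoszM wE psE.
    by rewrite mulrDr addrA.
  - exact: leq_trans (Qb i) (bound i).
  - rewrite expnM expnSr mulnAC mulnC ltn_pmul2l ?expn_gt0 ?(ltnW p1) //.
    by rewrite (leq_trans sU) // ltnW.
have hAP j : exists h : {poly rat}, (size h <= k.+1)%N /\ forall i, h.[(l i)%:R] = ((A i)`_j)%:~R.
  apply: (interp A aT) => i; first by case: (near_lift i).
  have [Am Bm AB _ _] := FE i; exact: Ck (leq_ltn_trans (leq0n _) (xN i)) _ _ Am Bm AB j.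
have hBP j : exists h : {poly rat}, (size h <= k.+1)%N /\ forall i, h.[(l i)%:R] = ((B i)`_j)%:~R.
  apply: (interp B bT) => i; first by case: (near_lift i).
  have [Am Bm AB _ _] := FE i; rewrite mulrC in AB.
  exact: Ck (leq_ltn_trans (leq0n _) (xN i)) _ _ Bm Am AB j.
have assemble (Q : 'I_M -> {poly int}) n : (forall i, Q i \is monic) -> (forall i, size (Q i) = n.+1) ->
    (forall j, exists h : {poly rat}, (size h <= k.+1)%N /\ forall i, h.[(l i)%:R] = ((Q i)`_j)%:~R) ->
    exists H : {poly {poly rat}}, [/\ H \is monic, size H = n.+1, forall j, (size (H`_j)%R <= k.+1)%N &
      forall i, spec (l i)%:R H = map_poly intr (Q i)].
  move=> Qm Qs /choice[h hE]; pose H := 'X^n + \poly_(j < n) h j.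
  have sH : size H = n.+1 by rewrite size_polyDl size_polyXn // ltnS size_poly.
  exists H; split => //.
  - by rewrite monicE lead_coefDl ?lead_coefXn // size_polyXn ltnS size_poly.
  - move=> j; rewrite coefD coefXn coef_poly; case: ltngtP => jn; rewrite ?add0r ?addr0 ?size_poly0 ?size_poly1 //.
    by case: (hE j).
  - move=> i; apply/polyP => j; rewrite !coef_map coefD coefXn coef_poly /= /horner_eval.
    case: ltngtP => jn; rewrite ?add0r ?addr0 /=.
    + by have [_ ->] := hE j.
    + by rewrite horner0 nth_default ?Qs.
    + have := monicP (Qm i); rewrite lead_coefE Qs /= jn => ->; by rewrite hornerC rmorph1.
have [HA [HAm sHA HAk HAl]] : exists H : {poly {poly rat}},
    [/\ H \is monic, size H = (size a).-1.+1, forall j, (size (H`_j)%R <= k.+1)%N &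
      forall i, spec (l i)%:R H = map_poly intr (A i)].
  apply: assemble hAP => i; first by case: (FE i).
  by have [-> _ _ _] := same i; rewrite prednK //; case: (sAB ord0) => _ [].
have [HB [HBm sHB HBk HBl]] : exists H : {poly {poly rat}},
    [/\ H \is monic, size H = (size b).-1.+1, forall j, (size (H`_j)%R <= k.+1)%N &
      forall i, spec (l i)%:R H = map_poly intr (B i)].
  apply: assemble hBP => i; first by case: (FE i).
  by have [_ -> _ _] := same i; rewrite prednK //; case: (sAB ord0) => _ [].
have a0 : (0 < size a)%N by case: (sAB ord0) => _ [].
have b0 : (0 < size b)%N by case: (sAB ord0) => _ [].
rewrite prednK // in sHA; rewrite prednK // in sHB.
pose r : rat := (p * p ^ s)%N%:R.
have r0 : r != 0 by rewrite pnatr_eq0 -lt0n muln_gt0 expn_gt0 (ltnW p1).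
pose PQ : {poly {poly rat}} := map_poly (map_poly intr) P.
pose PQs := map_poly (comp_poly (c%:R%:P + r *: 'X)) PQ.
have PQsE : PQs = HA * HB.
  apply/eqP; rewrite -subr_eq0; apply/eqP/polyP => j; rewrite coef0.
  set q := (_)`_j.
  have sq : (size q <= M)%N.
    rewrite /q coefB (leq_trans (size_polyD _ _)) // size_polyN geq_max; apply/andP; split.
      rewrite coef_map /=; apply: leq_trans (size_comp_poly_leq _ _) _.
      have sl : ((size (c%:R%:P + r *: 'X : {poly rat})%R).-1 <= 1)%N.
        rewrite -subn1 leq_subLR (leq_trans (size_polyD _ _)) // geq_max.
        rewrite (leq_trans (size_polyC_leq1 _)) // (leq_trans (size_scale_leq _ _)) // size_polyX //.
      have sj : (size ((PQ`_j)%R) <= sizeY P)%N.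
        rewrite coef_map /= size_map_inj_poly ?rmorph0 //; [exact: max_size_coefXY | exact: intr_inj].
      apply: (@leq_ltn_trans (sizeY P)); last by rewrite /M ltnS leqW // leq_addl.
      rewrite -[X in (_ <= X)%N]muln1; apply: leq_mul => //; exact: leq_trans (leq_pred _) sj.
    rewrite coefM; apply: (big_ind (fun z : {poly rat} => (size z <= M)%N)).
    - by rewrite size_poly0.
    - by move=> z1 z2 h1 h2; rewrite (leq_trans (size_polyD _ _)) // geq_max h1.
    - move=> i _; apply: leq_trans (size_polyMleq _ _) _.
      apply: leq_trans (leq_pred _) _; apply: leq_trans (leq_add (HAk i) (HBk (j - i)%N)) _.
      by rewrite addnn -mul2n /M; do 2 apply: leqW; rewrite leq_addr.
  apply: (@roots_geq_poly_eq0 _ _ [seq (l i)%:R | i <- enum 'I_M]).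
  - apply/allP => _ /mapP[i _ ->]; rewrite /root /q.
    have -> : ((PQs - HA * HB)`_j).[(l i)%:R] = (spec (l i)%:R (PQs - HA * HB))`_j by rewrite coef_map.
    have -> : spec (l i)%:R (PQs - HA * HB) = 0.
      rewrite rmorphB rmorphM /= HAl HBl -rmorphM /=.
      have [_ _ <- _ _] := FE i.
      apply/eqP; rewrite subr_eq0; apply/eqP/polyP => t; rewrite !coef_map /= /horner_eval.
      rewrite horner_comp !hornerE -(horner_map intr) /=; congr (_.[_]).
      by rewrite /x /r -pmulrn !natrD !natrM.
    by rewrite coef0.
  - by rewrite map_inj_uniq ?enum_uniq // => i1 i2 /eqP; rewrite eqr_nat => /eqP/linj.
  - by rewrite size_map size_enum_ord.
(* Undo the substitution [c + p ^ s.+1 * X], then clear denominators. *)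
pose L : {poly rat} := (r^-1) *: 'X - (c%:R / r)%:P.
have LK (q : {poly rat}) : (q \Po (c%:R%:P + r *: 'X)) \Po L = q.
  rewrite -comp_polyA comp_polyD comp_polyC comp_polyZ comp_polyX /L.
  rewrite scalerBr scalerA divff // scale1r -[r *: (_)%:P]mul_polyC -polyCM mulrC divfK //.
  by rewrite addrC subrK comp_polyXr.
have PQE : PQ = map_poly (comp_poly L) HA * map_poly (comp_poly L) HB.
  rewrite -rmorphM -PQsE; apply/polyP => j; by rewrite !coef_map /= LK.
have [dA [A2 [dA0 A2E]]] := clear_rat_poly (map_poly (comp_poly L) HA).
have [dB [B2 [dB0 B2E]]] := clear_rat_poly (map_poly (comp_poly L) HB).
have inj2 : injective (map_poly (map_poly intr) : {poly {poly int}} -> {poly {poly rat}}).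
  apply: map_inj_poly; last by rewrite rmorph0.
  apply: map_inj_poly; [exact: intr_inj | by rewrite rmorph0].
have PAB : (dA * dB)%:P *: P = B2 * A2.
  apply: inj2; rewrite map_polyZ /= map_polyC rmorphM /= A2E B2E -/PQ PQE.
  by rewrite -!mul_polyC !rmorphM /=; ring.
have A2P : A2 %| P.
  by apply/Pdiv.Idomain.dvdpP; exists ((dA * dB)%:P, B2); rewrite //= polyC_eq0 mulf_neq0.
have sL : forall Q : {poly {poly rat}}, Q \is monic -> size (map_poly (comp_poly L) Q) = size Q.
  move=> Q Qm; rewrite size_map_poly_id0 // (monicP Qm) /= comp_polyC polyC1; exact: oner_neq0.
have sA2 : size A2 = size a.
  transitivity (size (map_poly (map_poly (intr : int -> rat)) A2)).
    rewrite size_map_inj_poly ?rmorph0 //; apply: map_inj_poly; [exact: intr_inj | by rewrite rmorph0].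
  by rewrite A2E -mul_polyC size_Cmul ?polyC_eq0 ?intr_eq0 // sL.
have := Pirr.2 A2; rewrite sA2 => /(_ (introN eqP a1) A2P)/eqp_size; rewrite sA2 => saD.
have [sabD _] := sAB ord0; rewrite -/a -/b in sabD.
rewrite saD in sabD; apply: b1; apply: (@addn_pred_eq (size P)) => //.
by rewrite size_poly_gt0.
Qed.

(** * Hilbert's irreducibility theorem over number fields *)

(** An equation of smaller degree would be coprime to [P], and Bezout's identity
    would give a nonzero constant that vanishes at [w]. *)
Lemma irreducible_ann (R : idomainType) (M : fieldType) (rho : {rmorphism R -> M}) w P q :
  injective rho -> irreducible_poly P -> ann rho w P -> q != 0 -> ann rho w q ->
  (size P <= size q)%N.
Proof.
move=> rho_inj [sP Pirr] Pw q0 qw; rewrite leqNgt; apply/negP => sq.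
have [g1|g1] := boolP (coprimep P q).
  have /Bezout_coprimepP[[u v] /= uvE] := g1.
  have [d d0 dE] : exists2 d, d != 0 & u * P + v * q = d%:P.
    by apply/size_poly1P; rewrite size_poly_eq1.
  have : ann rho w d%:P by rewrite -dE /ann rmorphD !rmorphM hornerD !hornerM Pw qw !mulr0 addr0.
  rewrite /ann map_polyC hornerC /= -[0](rmorph0 rho) => /rho_inj dd.
  by rewrite dd eqxx in d0.
have := Pirr _ g1 (dvdp_gcdl _ _); rewrite /eqp => /andP[_ Pg].
have := dvdp_leq q0 (dvdp_trans Pg (dvdp_gcdr P q)).
by rewrite leqNgt sq.
Qed.

Lemma irreducible_minimal (R : idomainType) (M : fieldType) (rho : {rmorphism R -> M}) w P :
  injective rho -> irreducible_poly P -> P \is monic -> ann rho w P -> minimal_at rho w P.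
Proof. by move=> ri Pi Pm Pw; split=> // q; exact: irreducible_ann. Qed.

Section Adjoin.
Variables (k K : fieldType) (f : {rmorphism k -> K}) (y : K).
Hypothesis y_alg : algebraicOver f y.

Definition adjoin : {pred K} := fun z => `[< exists g : {poly k}, z = (map_poly f g).[y] >].

(** The polynomials in an algebraic element form a field, by Bezout's identity
    with its minimal polynomial. *)
Lemma adjoin_closed : divring_closed adjoin.
Proof.
split.
- by apply/asboolP; exists 1; rewrite rmorph1 hornerC.
- move=> _ _ /asboolP[g ->] /asboolP[h ->]; apply/asboolP.
  by exists (g - h); rewrite rmorphB hornerD hornerN.
- move=> _ _ /asboolP[g ->] /asboolP[h ->]; apply/asboolP.
  have [h0|h0] := eqVneq ((map_poly f h).[y]) 0.
    by exists 0; rewrite h0 invr0 mulr0 rmorph0 horner0.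
  have [p p0 /rootP py] := y_alg.
  have [d [d0 dP]] := minimal_exists (@fmorph_inj _ _ f) (ex_intro2 _ _ p p0 py).
  have [P Pmin] := dP d^-1 (invr_neq0 d0).
  rewrite divff // rmorph1 mul1r in Pmin.
  have [Pm Py Ple] := Pmin; have [sP Pirr] := minimal_irreducible Pmin.
  have co : coprimep P h.
    apply: contraT => g1; have := Pirr _ g1 (dvdp_gcdl _ _).
    rewrite /eqp => /andP[_ Pg]; have := dvdp_trans Pg (dvdp_gcdr P h).
    by move=> /dvdpP[s sE]; move: h0; rewrite sE rmorphM hornerM Py mulr0 eqxx.
  have /Bezout_eq1_coprimepP[[u v] /= uvE] := co.
  exists (g * v); rewrite rmorphM hornerM; congr (_ * _).
  apply: (mulIf h0); rewrite mulVf // -hornerM -rmorphM.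
  have := congr1 (fun q => (map_poly f q).[y]) uvE.
  by rewrite /= rmorphD !rmorphM hornerD !hornerM Py mulr0 add0r rmorph1 hornerC => ->.
Qed.

Lemma adjoin_gen : y \in adjoin.
Proof. by apply/asboolP; exists 'X; rewrite map_polyX hornerX. Qed.

Lemma adjoin_base a : f a \in adjoin.
Proof. by apply/asboolP; exists a%:P; rewrite map_polyC hornerC. Qed.

Lemma adjoin_reduce (q g : {poly k}) : q != 0 -> (map_poly f q).[y] = 0 ->
  exists h : {poly k}, (size h < size q)%N /\ (map_poly f g).[y] = (map_poly f h).[y].
Proof.
move=> q0 qy; exists (g %% q); rewrite ltn_modp q0; split => //.
by rewrite {1}(divp_eq g q) rmorphD rmorphM hornerD hornerM qy mulr0 add0r.
Qed.

End Adjoin.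

Lemma poly_lift (M : fieldType) (S : {pred M}) (h : divring_closed S) (q : {poly M}) :
  (forall i, q`_i \in S) ->
  exists q0 : {poly subfield_type (mk_subfield h)}, q = map_poly (sfval _) q0.
Proof.
move=> qS; have [f fE] := choice (fun i => sfvalP h (qS i)).
exists (\poly_(i < size q) f i); apply/polyP => i; rewrite coef_map coef_poly.
by case: ltnP => [_|sq]; [exact/esym/fE | rewrite nth_default // raddf0].
Qed.

(** An element of [k(th)(w)] has degree at most the product of the degrees of
    [th] and [w]: its powers live in a space of that dimension. *)
Lemma tower_degree (k K : fieldType) (f : {rmorphism k -> K}) (th w v : K)
    (tha : algebraicOver f th) (Pi : {poly k})
    (q g : {poly subfield_type (mk_subfield (adjoin_closed tha))}) :
  Pi != 0 -> (map_poly f Pi).[th] = 0 ->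
  q != 0 -> (map_poly (sfval _) q).[w] = 0 -> v = (map_poly (sfval _) g).[w] ->
  exists h : {poly k}, [/\ h != 0, (map_poly f h).[v] = 0 &
    (size h <= ((size Pi).-1 * (size q).-1).+1)%N].
Proof.
move=> Pi0 Pith q0 qw vE; set n := (size Pi).-1; set D := (size q).-1.
have powE (e : 'I_(n * D).+1) : exists A : 'I_n * 'I_D -> k,
    v ^+ e = \sum_i f (A i) * (th ^+ i.1 * w ^+ i.2).
  have [r [sr rE]] := adjoin_reduce (g ^+ e) q0 qw.
  have coE (t : 'I_D) : exists c : {poly k}, (size c <= n)%N /\ sfval _ r`_t = (map_poly f c).[th].
    have /asboolP[c cE] := sfval_in r`_t.
    have [c' [sc c'E]] := adjoin_reduce c Pi0 Pith.
    exists c'; rewrite cE c'E; split => //.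
    by rewrite -ltnS prednK // size_poly_gt0.
  have [c cP] := choice coE.
  exists (fun i : 'I_n * 'I_D => (c i.2)`_i.1).
  rewrite vE -horner_exp -rmorphXn rE.
  rewrite (horner_coef_wide _ (_ : (size (map_poly (sfval _) r) <= D)%N)); last first.
    by rewrite size_map_poly -ltnS prednK // size_poly_gt0.
  rewrite -(pair_bigA _ (fun (i : 'I_n) (t : 'I_D) => f (c t)`_i * (th ^+ i * w ^+ t))) exchange_big.
  apply: eq_bigr => t _; rewrite coef_map; have [sc cE] := cP t.
  rewrite [X in X * _]cE.
  rewrite (horner_coef_wide _ (_ : (size (map_poly f (c t)) <= n)%N)) ?size_map_poly //.
  by rewrite mulr_suml; apply: eq_bigr => i _; rewrite coef_map mulrA.
have [A AE] := choice powE.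
have [|x [[e0 xe0] xE]] := @dependent_field k 'I_(n * D).+1 ('I_n * 'I_D)%type A.
  by rewrite card_prod !card_ord.
exists (\poly_(e < (n * D).+1) x (inord e)); split; last exact: size_poly.
  apply: contraNneq xe0 => /polyP/(_ e0); rewrite coef_poly ltn_ord coef0.
  by rewrite inord_val => ->.
rewrite (horner_coef_wide _ (_ : (size (map_poly f _) <= (n * D).+1)%N)); last first.
  by rewrite size_map_poly size_poly.
transitivity (\sum_e \sum_i f (x e * A e i) * (th ^+ i.1 * w ^+ i.2)).
  apply: eq_bigr => e _; rewrite coef_map coef_poly ltn_ord inord_val AE mulr_sumr.
  by apply: eq_bigr => i _; rewrite (rmorphM f) -[RHS]mulrA.
rewrite exchange_big big1 // => i _; by rewrite -mulr_suml -rmorph_sum xE rmorph0 mul0r.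
Qed.

(** Gauss's lemma turns a rational factor of [H] into an integral one, monic up
    to a sign [e]. *)
Lemma int_irreducible_minimal (K : fieldType) (iota : {rmorphism rat -> K}) (H : {poly int}) (v : K) :
  H \is monic -> (1 < size H)%N ->
  (forall A B : {poly int}, A \is monic -> B \is monic -> H = A * B -> size A = 1%N \/ size B = 1%N) ->
  (map_poly intr H).[v] = 0 ->
  forall h : {poly rat}, h != 0 -> (map_poly iota h).[v] = 0 -> (size H <= size h)%N.
Proof.
move=> Hm sH Hirr Hv h h0 hv.
pose HQ : {poly rat} := map_poly intr H.
have sHQ : size HQ = size H by rewrite size_map_inj_poly ?rmorph0 //; exact: intr_inj.
have HQv : ann iota v HQ.
  rewrite /ann -[RHS]Hv; congr (_.[v]); apply/polyP => i; rewrite !coef_map /=.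
  by rewrite rmorph_int.
rewrite -sHQ; apply: (irreducible_ann (fmorph_inj iota) _ HQv h0 hv).
split=> [|q sq qH]; first by rewrite sHQ.
have [p [a a0 qE] [r rE]] := dvdpP_rat_int qH.
have p0 : p != 0 by apply: contraTneq Hm => p0; rewrite rE p0 mul0r monicE lead_coef0.
have lpr : lead_coef p * lead_coef r = 1 by rewrite -lead_coefM -rE (monicP Hm).
have sqp : size q = size p.
  by rewrite qE size_scale // size_map_inj_poly ?rmorph0 //; exact: intr_inj.
pose e := lead_coef p.
have ee : e * e = 1.
  have : e \is a GRing.unit by apply/unitrPr; exists (lead_coef r).
  by rewrite qualifE /= => /orP[]/eqP ->.
have re : lead_coef r = e by rewrite -[RHS]mulr1 -lpr mulrA ee mul1r.
have spr : size H = (size p + size r).-1.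
  by rewrite rE size_mul // -lead_coef_eq0 re; apply: contra_eq_neq ee => ->; rewrite mul0r eq_sym oner_eq0.
have e0 : e != 0 by rewrite lead_coef_eq0.
have [|||s1|s1] := Hirr (e *: p) (e *: r).
- by rewrite monicE lead_coefZ ee.
- by rewrite monicE lead_coefZ re ee.
- by rewrite -scalerAl -scalerAr scalerA ee scale1r.
- by move: sq; rewrite sqp -(size_scale p e0) s1 eqxx.
by rewrite -dvdp_size_eqp // sqp sHQ spr -(size_scale r e0) s1 addn1.
Qed.

(** The elements of [M] that are polynomials in [v] up to a denominator in [R]
    stand for the field generated by [v]. *)
Section Reach.
Variables (R : idomainType) (M : fieldType) (rho : {rmorphism R -> M}) (v : M).

Definition reach (m : M) : Prop :=
  exists b (q : {poly R}), b != 0 /\ rho b * m = (map_poly rho q).[v].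

Lemma reach_base a : reach (rho a).
Proof. by exists 1, a%:P; rewrite oner_neq0 rmorph1 mul1r map_polyC hornerC. Qed.

Lemma reach_gen : reach v.
Proof. by exists 1, 'X; rewrite oner_neq0 rmorph1 mul1r map_polyX hornerX. Qed.

Lemma reach_add m n : reach m -> reach n -> reach (m + n).
Proof.
move=> [b [q [b0 qE]]] [c [r [c0 rE]]]; exists (b * c), (c *: q + b *: r).
rewrite mulf_neq0 // rmorphD /= !map_polyZ hornerD !hornerZ -qE -rE rmorphM; split => //; ring.
Qed.

Lemma reach_mul m n : reach m -> reach n -> reach (m * n).
Proof.
move=> [b [q [b0 qE]]] [c [r [c0 rE]]]; exists (b * c), (q * r).
rewrite mulf_neq0 // !rmorphM hornerM -qE -rE; split => //; ring.
Qed.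

Lemma reach_exp m n : reach m -> reach (m ^+ n).
Proof.
move=> mr; elim: n => [|n IHn]; last by rewrite exprS; exact: reach_mul.
by rewrite expr0 -(rmorph1 rho); exact: reach_base.
Qed.

Lemma reach_horner (q : {poly R}) m : reach m -> reach (map_poly rho q).[m].
Proof.
move=> mr; elim/poly_ind: q => [|q a IHq].
  by rewrite rmorph0 horner0 -(rmorph0 rho); exact: reach_base.
rewrite rmorphD rmorphM /= map_polyX map_polyC !hornerE.
by apply: reach_add; [exact: reach_mul|exact: reach_base].
Qed.

Lemma reach_div b m : b != 0 -> reach (rho b * m) -> reach m.
Proof.
move=> b0 [c [q [c0 qE]]]; exists (c * b), q; rewrite mulf_neq0 //; split => //.
by rewrite rmorphM -mulrA.
Qed.

End Reach.

Lemma map_linear (R S : nzRingType) (f : {rmorphism R -> S}) (a b c : R) :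
  map_poly f (a%:P * (b%:P + c%:P * 'X)) = (f a)%:P * ((f b)%:P + (f c)%:P * 'X).
Proof. by rewrite rmorphM rmorphD rmorphM /= map_polyX !map_polyC. Qed.

Lemma map_linear_horner (R : nzRingType) (S : comNzRingType) (f : {rmorphism R -> S}) (a b c : R) x :
  (map_poly f (a%:P * (b%:P + c%:P * 'X))).[x] = f a * (f b + f c * x).
Proof. by rewrite map_linear !hornerE. Qed.

Section NumberField.
Variables (K M : closedFieldType) (iota : {rmorphism rat -> K}) (j : {rmorphism K -> M}) (tau : M).
Hypothesis K_alg : forall a : K, algebraicOver iota a.
Hypothesis tau_trans : forall q : {poly K}, (map_poly j q).[tau] = 0 -> q = 0.

Let charK : [pchar K] =i pred0.
Proof. by move=> p; rewrite (fmorph_pchar iota) pchar_num. Qed.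

Let charM : [pchar M] =i pred0.
Proof. by move=> p; rewrite (fmorph_pchar j) charK. Qed.

Let intK_inj : injective (intr : int -> K).
Proof.
by move=> a b; rewrite -!(rmorph_int iota) => /fmorph_inj/intr_inj.
Qed.

Let rhoK : {rmorphism {poly K} -> M} := horner_eval tau \o map_poly j.
Let rhoZ : {rmorphism {poly int} -> M} := rhoK \o map_poly (intr : int -> K).

Let rhoK_inj : injective rhoK.
Proof.
move=> p q /eqP; rewrite -subr_eq0 -rmorphB => /eqP/tau_trans/eqP.
by rewrite subr_eq0 => /eqP.
Qed.

Let rhoZ_inj : injective rhoZ.
Proof. by move=> p q /rhoK_inj; apply: map_inj_poly. Qed.

Let alg_const (a : K) : alg_over rhoZ (j a).
Proof.
have [p p0 /rootP pa] := K_alg a.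
have [q [d d0 pE]] := rat_poly_scale p.
exists (map_poly polyC q).
  rewrite map_polyC_eq0; apply: contraNneq p0 => q0.
  by rewrite pE q0 rmorph0 scaler0.
rewrite /ann; have -> : map_poly rhoZ (map_poly polyC q) = map_poly j (map_poly iota (d%:~R *: p)).
  rewrite pE scalerA divff ?intr_eq0 // scale1r.
  apply/polyP => i; rewrite !coef_map /= /horner_eval !map_polyC hornerC /=.
  by rewrite (rmorph_int iota).
by rewrite map_polyZ /= map_polyZ /= hornerZ horner_map pa rmorph0 mulr0.
Qed.

Let alg_rhoK (q : {poly K}) : alg_over rhoZ (rhoK q).
Proof.
elim/poly_ind: q => [|q c IHq]; first by rewrite rmorph0; exact: (alg_over0 rhoZ_inj).
rewrite rmorphD rmorphM; have -> : rhoK q * rhoK 'X + rhoK c%:P = rhoK q * rhoK 'X - (0 - j c).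
  by rewrite sub0r opprK /= /horner_eval !map_polyC hornerC.
apply: alg_over_sub => //; last by apply: alg_over_sub => //; exact: (alg_over0 rhoZ_inj).
apply: alg_over_mul => //.
have -> : rhoK 'X = rhoZ 'X by rewrite /= /horner_eval !map_polyX.
exact: alg_over_id.
Qed.

(** The number field [k] is generated by an algebraic integer [th] of degree [n].
    Together, [th] and a root [w0] of [P], which has degree [D] over all
    constants, have a primitive element [v1] over the rational functions with
    rational coefficients, a multiple of a linear combination of both.  The
    minimal polynomial [N] of [v1] has integer coefficients and degree at least
    [n * D].  At a point where [N] stays irreducible, the
    specialization of [v1] has at least this degree over the rationals.  It lies
    in the field generated by [th] and a root [w] of the specialization of [P],
    so [w] has degree at least [D] over [k].  The element [tau] of [M] plays
    the role of the variable. *)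
Theorem hilbert_irreducibility_number_field (P : {poly {poly K}}) (S : seq K) :
  P \is monic -> irreducible_poly P ->
  exists2 k : {pred K}, divring_closed k & {subset S <= k} /\
    forall N0, exists m : nat, (N0 < m)%N /\ forall w, (spec m%:R P).[w] = 0 ->
      forall q : {poly K}, (forall i, q`_i \in k) -> (size q < size P)%N -> q.[w] = 0 -> q = 0.
Proof.
move=> Pm Pirr; have [sP _] := Pirr.
have Sa u : u \in S -> alg_over iota u by move=> _; case: (K_alg u) => p p0 /rootP pu; exists p.
have [th0 [th0a _ [e [e0 eus]]]] := primitive_element (@fmorph_inj _ _ iota) charK Sa.
have [d [d0 dP]] := minimal_exists (@fmorph_inj _ _ iota) th0a.
have [Pi Pimin] := dP 1 (oner_neq0 _); rewrite mulr1 in Pimin.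
set th := iota d * th0 in Pimin.
have [Pim Pith Pile] := Pimin; have sPi := minimal_size Pimin.
have tha : algebraicOver iota th by exists Pi; [exact: monic_neq0|exact/rootP].
pose k := adjoin iota th.
have Sk u : u \in S -> u \in k.
  move=> uS; have [Q QE] := eus u uS.
  apply/asboolP; exists ((e^-1 *: Q) \Po (d^-1 *: 'X)).
  rewrite map_comp_poly !map_polyZ /= map_polyX horner_comp hornerZ hornerZ hornerX.
  by rewrite /th !fmorphV mulKf ?fmorph_eq0 // -QE mulKf ?fmorph_eq0.
exists k; first exact: adjoin_closed.
split=> [|N0]; first exact: Sk.
have [w0 w0P] : exists w0, ann rhoK w0 P.
  have : (1 < size (map_poly rhoK P))%N by rewrite size_map_inj_poly ?rmorph0.
  by move=> /poly_root_exists[w0 /rootP w0P]; exists w0.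
have w0a : alg_over rhoZ w0.
  apply: (@alg_over_root _ _ _ rhoZ_inj w0 (map_poly rhoK P)) => [||i].
  - by rewrite monic_neq0 // monic_map.
  - exact/rootP.
  - by rewrite coef_map; exact: alg_rhoK.
have [v [va vS [e1 [e10 e1us]]]] : exists v, [/\ alg_over rhoZ v,
    forall S : M -> Prop, S 0 -> (forall x y, S x -> S y -> S (x - y)) ->
      (forall u, u \in [:: j th; w0] -> S u) -> S v &
    exists e, e != 0 /\ forall u, u \in [:: j th; w0] ->
      exists Q : {poly {poly int}}, rhoZ e * u = (map_poly rhoZ Q).[v]].
  apply: (primitive_element rhoZ_inj charM) => u; rewrite !inE => /orP[]/eqP ->//.
have [c1 [c2 vE]] : exists c1 c2 : int, v = c1%:~R * j th + c2%:~R * w0.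
  apply: (vS (fun v => exists c1 c2 : int, v = c1%:~R * j th + c2%:~R * w0)).
  - by exists 0, 0; rewrite !mul0r addr0.
  - move=> _ _ [a1 [a2 ->]] [b1 [b2 ->]]; exists (a1 - b1), (a2 - b2).
    by rewrite !rmorphB /=; ring.
  - move=> u; rewrite !inE => /orP[]/eqP ->; first by exists 1, 0; rewrite rmorph1 mul1r mul0r addr0.
    by exists 0, 1; rewrite rmorph1 mul1r mul0r add0r.
have [d1 [d10 d1P]] := minimal_exists rhoZ_inj va.
have [N Nmin] := d1P 1 (oner_neq0 _); rewrite mulr1 in Nmin.
set v1 := rhoZ d1 * v in Nmin; have [Nm Nv1 Nle] := Nmin.
have Nirr := minimal_irreducible Nmin; have sN := minimal_size Nmin.
have reachv : reach rhoZ v1 v by apply: (reach_div d10); exact: reach_gen.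
have reachu u : u \in [:: j th; w0] -> reach rhoZ v1 u.
  move=> /e1us[Q QE]; apply: (reach_div e10); rewrite QE; exact: reach_horner.
set n := (size Pi).-1; set D := (size P).-1; set E := (size N).-1.
(* The monomials [th ^ i * w0 ^ t] are independent over the rational functions
   and are all polynomials in [v1], up to denominators. *)
have nDE : (n * D <= E)%N.
  rewrite leqNgt; apply/negP => EnD.
  pose mon (i : 'I_n * 'I_D) := j th ^+ i.1 * w0 ^+ i.2.
  have monr i : exists b (q : {poly {poly int}}), [/\ b != 0, (size q <= E)%N & rhoZ b * mon i = (map_poly rhoZ q).[v1]].
    have [b [q [b0 qE]]] : reach rhoZ v1 (mon i).
      by apply: reach_mul; apply: reach_exp; apply: reachu; rewrite !inE eqxx ?orbT.
    exists b, (Pdiv.Ring.rmodp q N); split => //.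
      by rewrite -ltnS prednK ?(ltnW sN) // Pdiv.Ring.ltn_rmodpN0 ?monic_neq0.
    by rewrite qE {1}(Pdiv.RingMonic.rdivp_eq Nm q) rmorphD rmorphM hornerD hornerM Nv1 mulr0 add0r.
  have [b bP] := choice monr; have [q qP] := choice bP.
  have [|c [[i0 ci0] cE]] := @dependent_idomain _ _ _ rhoZ_inj ('I_n * 'I_D)%type 'I_E (fun i t => (q i)`_t).
    by rewrite card_prod !card_ord.
  have S0 : \sum_i rhoZ (c i * b i) * mon i = 0.
    transitivity (\sum_i \sum_(t < E) rhoZ (c i * (q i)`_t) * v1 ^+ t).
      apply: eq_bigr => i _; have [_ sq qE] := qP i.
      rewrite rmorphM -mulrA qE (horner_coef_wide _ (_ : (size (map_poly rhoZ (q i)) <= E)%N)); last first.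
        by rewrite size_map_inj_poly ?rmorph0.
      by rewrite mulr_sumr; apply: eq_bigr => t _; rewrite coef_map rmorphM /= mulrA.
    rewrite exchange_big big1 // => t _.
    by rewrite -mulr_suml -rmorph_sum cE rmorph0 mul0r.
  pose h (t : 'I_D) : {poly K} := \sum_(i < n) map_poly intr (c (i, t) * b (i, t)) * (th ^+ i)%:P.
  have h0 t : h t = 0.
    pose G : {poly {poly K}} := \poly_(s < D) (if insub s is Some t then h t else 0).
    have GE : (map_poly rhoK G).[w0] = 0.
      rewrite (horner_coef_wide _ (_ : (size (map_poly rhoK G) <= D)%N)); last first.
        by rewrite size_map_inj_poly ?rmorph0 // size_poly.
      rewrite -[RHS]S0 (eq_bigr (fun i : 'I_n * 'I_D => rhoZ (c (i.1, i.2) * b (i.1, i.2)) * mon (i.1, i.2))); last by case.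
      rewrite -(pair_bigA _ (fun i t => rhoZ (c (i, t) * b (i, t)) * mon (i, t))) exchange_big.
      apply: eq_bigr => s _; rewrite coef_map coef_poly ltn_ord valK.
      rewrite /h raddf_sum mulr_suml; apply: eq_bigr => i _.
      transitivity (rhoK (map_poly intr (c (i, s) * b (i, s))) * rhoK (th ^+ i)%:P * w0 ^+ s).
        by congr (_ * _); exact: (rmorphM rhoK).
      rewrite -mulrA; congr (_ * (_ * _)).
      by rewrite /rhoK /= /horner_eval map_polyC hornerC /= rmorphXn.
    have G0 : G = 0.
      apply: contraTeq isT => G0; have := irreducible_ann rhoK_inj Pirr w0P G0 GE.
      by rewrite leqNgt (leq_ltn_trans (size_poly _ _)) // /D prednK // ltnW.
    by have /polyP/(_ t) := G0; rewrite coef_poly ltn_ord coef0 valK.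
  pose c' i : {poly int} := c (i, i0.2) * b (i, i0.2).
  have c'0 i : c' i = 0.
    apply/polyP => l; rewrite coef0; have := congr1 (fun p : {poly K} => p`_l) (h0 i0.2).
    rewrite coef0 /h coef_sum => hl.
    pose p : {poly rat} := \poly_(s < n) (if insub s is Some s' then ((c' s')`_l)%:~R else 0).
    have p0 : p = 0.
      apply: contraTeq isT => p0; have := Pile p p0; rewrite leqNgt.
      rewrite (leq_ltn_trans (size_poly _ _)) ?prednK ?(ltnW sPi) //.
      apply.
      rewrite /ann (horner_coef_wide _ (_ : (size (map_poly iota p) <= n)%N)); last first.
        by rewrite size_map_poly size_poly.
      rewrite -[RHS]hl; apply: eq_bigr => s _.
      rewrite coef_map coef_poly ltn_ord valK.
      by rewrite coefMC coef_map /= -(rmorph_int iota).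
    have /polyP/(_ i) := p0; rewrite coef_poly ltn_ord coef0 valK.
    by move=> /eqP; rewrite intr_eq0 => /eqP.
  have := c'0 i0.1; rewrite /c' -surjective_pairing => /eqP; apply/negP.
  by rewrite mulf_neq0 //; have [] := qP i0.
(* [ell] expresses [v1] as a linear polynomial in [w0], hence [P] divides the
   composition of [N] with [ell], and this divisibility can be specialized. *)
pose NK : {poly {poly K}} := map_poly (map_poly intr) N.
pose ell : {poly {poly K}} := (map_poly intr d1)%:P * ((c1%:~R * th)%:P%:P + (c2%:~R)%:P%:P * 'X).
have [s sE] : exists s, NK \Po ell = s * P.
  apply: (minimal_dvd (irreducible_minimal rhoK_inj Pirr Pm w0P)).
  rewrite /ann map_comp_poly horner_comp.
  have -> : (map_poly rhoK ell).[w0] = v1.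
    rewrite map_linear_horner /v1 vE; congr (_ * (_ + _ * _)).
    + by rewrite /rhoK /= /horner_eval !map_polyC !hornerC /= rmorphM !rmorph_int.
    + by rewrite /rhoK /= /horner_eval !map_polyC !hornerC /= !rmorph_int.
  by rewrite -[RHS]Nv1 /NK -map_poly_comp.
have [m [mN0 mP]] := hilbert_irreducibility_int Nm Nirr N0.
exists m; split => // w wP q qk sq qw; apply: contraTeq isT => q0.
pose ellm : {poly K} := spec m%:R ell.
have specN : spec m%:R NK = map_poly intr (spec m%:Z N).
  apply/polyP => i; rewrite !coef_map /= /horner_eval -[m%:R](rmorph_nat (intr : {rmorphism int -> K})).
  by rewrite horner_map /= natz.
have Nv0 : (map_poly intr (spec m%:Z N)).[ellm.[w]] = 0.
  rewrite -specN -horner_comp /ellm.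
  have -> : spec m%:R NK \Po spec m%:R ell = spec m%:R s * spec m%:R P.
    by rewrite -map_comp_poly sE rmorphM.
  by rewrite hornerM wP mulr0.
have sNm : size (spec m%:Z N) = size N.
  by rewrite size_map_poly_id0 // (monicP Nm) /horner_eval hornerC oner_eq0.
have [q1 q1E] := poly_lift (adjoin_closed tha) qk.
have [th1 th1E] := sfvalP (adjoin_closed tha) (adjoin_gen iota th).
pose F := subfield_type (mk_subfield (adjoin_closed tha)).
pose g : {poly F} := ((d1.[m%:Z])%:~R)%:P * ((c1%:~R * th1)%:P + (c2%:~R)%:P * 'X).
have gE : ellm = map_poly (sfval _) g.
  rewrite /ellm /ell /g !map_linear; congr (_%:P * (_%:P + _%:P * 'X)).
  - rewrite (rmorph_int (sfval _)) -[m%:R](rmorph_nat (intr : {rmorphism int -> K})) natz.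
    exact: horner_map.
  - by rewrite (rmorphM (sfval _)) th1E (rmorph_int (sfval _)); exact: hornerC.
  - by rewrite (rmorph_int (sfval _)); exact: hornerC.
have q10 : q1 != 0 by apply: contraNneq q0 => q10; rewrite q1E q10 rmorph0.
have q1w : (map_poly (sfval _) q1).[w] = 0 by rewrite -q1E.
have [h [h0 hv sh]] := tower_degree (monic_neq0 Pim) Pith q10 q1w (congr1 (fun p : {poly K} => p.[w]) gE).
have := int_irreducible_minimal (monic_map _ Nm) _ mP Nv0 h0 hv.
rewrite sNm => /(_ sN) sNh.
have := leq_trans sNh sh; rewrite -(size_map_poly (sfval _) q1) -q1E -/n.
have sq1 : (size q <= D)%N by rewrite -ltnS prednK // ltnW.
have sq2 : ((size q).-1 < D)%N by rewrite (leq_trans _ sq1) // prednK // size_poly_gt0.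
have n0 : (0 < n)%N by rewrite -ltnS prednK // ltnW.
rewrite -(ltn_predK sN) ltnS -/E => Eh.
by have := leq_trans nDE Eh; rewrite leq_pmul2l // leqNgt sq2.
Qed.

End NumberField.

(** * Generic subfields *)

Definition coefs_in (K : nzSemiRingType) (F : {pred K}) (p : {poly K}) := forall i, p`_i \in F.

Lemma spec_scale (K : comNzRingType) (x : K) (p : {poly K}) (q : {poly {poly K}}) :
  spec x (p%:P * q) = p.[x] *: spec x q.
Proof. by rewrite rmorphM /= map_polyC /= /horner_eval mul_polyC. Qed.

Lemma natr_inj (R : idomainType) : [pchar R] =i pred0 -> injective (fun n => n%:R : R).
Proof.
move=> /pcharf0P ch m n; wlog mn : m n / (m <= n)%N.
  by move=> h; case/orP: (leq_total m n) => mn e; [exact: h|symmetry; exact: h].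
move=> /esym/eqP; rewrite -subr_eq0 -natrB // ch subn_eq0 => nm.
by apply/eqP; rewrite eqn_leq mn.
Qed.

Section Pade.
Variables (K : fieldType) (k : {pred K}) (k_closed : divring_closed k).
Hypothesis charK : [pchar K] =i pred0.
Variables (d B : nat) (V : nat -> {poly {poly K}}) (z : {poly {poly K}}).
Hypothesis sV : forall j, (j < d)%N -> forall i, (size ((V j)`_i)%R <= B.+1)%N.
Hypothesis sz : forall i, (size (z`_i)%R <= B.+1)%N.

(** Pade approximation: a relation that holds at enough points lifts to a
    relation with polynomial coefficients.  The [d.+1] polynomials [p] and [ps]
    of degree [d * B] have more coefficients than the conditions imposed at
    [d * B + B + 1] points, and this number of points exceeds the degree of the
    relation to be proved. *)
Lemma pade :
  (forall N, exists m : nat, (N < m)%N /\ exists c : 'I_d -> K, (forall j, c j \in k) /\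
     spec m%:R z = \sum_(j < d) c j *: spec m%:R (V j)) ->
  exists (p : {poly K}) (ps : 'I_d -> {poly K}),
    [/\ coefs_in k p, (size p <= (d * B).+1)%N, forall j, coefs_in k (ps j) /\ (size (ps j) <= (d * B).+1)%N,
        p%:P * z = \sum_(j < d) (ps j)%:P * V j & p != 0 \/ exists j, ps j != 0].
Proof.
move=> bad; have [g gP] := choice bad.
pose a i := iter i.+1 g 0%N.
have aS i : (a i < a i.+1)%N by have [] := gP (a i).
have a_inj : injective a.
  move=> i j; have lt u v : (u < v)%N -> (a u < a v)%N.
    by elim: v => // v IHv; rewrite ltnS leq_eqVlt => /orP[/eqP->//|/IHv h]; exact: ltn_trans (aS v).
  by case: (ltngtP i j) => // /lt + e; rewrite e ltnn.
pose L := (d * B + B).+1.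
have cP i : exists c : 'I_d -> subfield_type (mk_subfield k_closed),
    spec (a i)%:R z = \sum_(j < d) sfval _ (c j) *: spec (a i)%:R (V j).
  have [_ [c [ck cE]]] := gP (iter i g 0%N).
  have [c' c'E] := choice (fun j => sfvalP k_closed (ck j)).
  by exists c'; rewrite [LHS]cE; apply: eq_bigr => j _; rewrite c'E.
have [c cE] := choice cP.
pose A (u : option 'I_d * 'I_(d * B).+1) (e : 'I_L * 'I_d) : subfield_type (mk_subfield k_closed) :=
  (if u.1 is Some j then (if j == e.2 then -1 else 0) else c e.1 e.2) * (a e.1)%:R ^+ u.2.
have [|v [[[u0 l0] v0] vE]] := @dependent_field _ _ _ A.
  by rewrite !card_prod card_option !card_ord; lia.
pose q (u : option 'I_d) : {poly subfield_type (mk_subfield k_closed)} := \poly_(l < (d * B).+1) v (u, inord l).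
have qE u i : (map_poly (sfval _) (q u)).[(a i)%:R] = sfval _ (\sum_(l < (d * B).+1) v (u, l) * (a i)%:R ^+ l).
  rewrite -(rmorph_nat (sfval (mk_subfield k_closed))) horner_map horner_poly.
  by congr (sfval _ _); apply: eq_bigr => l _; rewrite inord_val.
have qrel i (j : 'I_d) : (i < L)%N ->
    (map_poly (sfval _) (q (Some j))).[(a i)%:R] = (map_poly (sfval _) (q None)).[(a i)%:R] * sfval _ (c i j).
  move=> iL; rewrite !qE -rmorphM; congr (sfval _ _).
  have := vE (Ordinal iL, j).
  rewrite (eq_bigr (fun u => v (u.1, u.2) * A (u.1, u.2) (Ordinal iL, j))); last by case.
  rewrite -(pair_bigA _ (fun u l => v (u, l) * A (u, l) (Ordinal iL, j))) /=.
  rewrite (bigD1 None) // (bigD1 (Some j)) //= [X in _ + (_ + X)]big1 ?addr0; last first.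
    move=> [j'|//] /= jj; rewrite big1 // => l _; rewrite /A /=.
    have /negPf-> : j' != j by apply: contraNneq jj => ->.
    by rewrite mul0r mulr0.
  rewrite (_ : \sum_l v (None, l) * _ = (\sum_l v (None, l) * (a i)%:R ^+ l) * c i j); last first.
    by rewrite mulr_suml; apply: eq_bigr => l _; rewrite /A /=; ring.
  rewrite (_ : \sum_l v (Some j, l) * _ = - \sum_l v (Some j, l) * (a i)%:R ^+ l); last first.
    by rewrite -sumrN; apply: eq_bigr => l _; rewrite /A /= eqxx mulN1r mulrN.
  by move/eqP; rewrite subr_eq0 => /eqP.
exists (map_poly (sfval _) (q None)), (fun j => map_poly (sfval _) (q (Some j))).
have ck u : coefs_in k (map_poly (sfval _) (q u)) by move=> i; rewrite coef_map; exact: sfval_in.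
have sq u : (size (map_poly (sfval _) (q u)) <= (d * B).+1)%N by rewrite size_map_poly; exact: size_poly.
split=> //; last first.
  have [q0|q0] := eqVneq (q u0) 0.
    have /polyP/(_ l0) := q0; rewrite coef_poly ltn_ord inord_val coef0 => vv.
    by rewrite vv eqxx in v0.
  case: u0 {v0} q0 => [j|] q0; last by left; rewrite map_poly_eq0.
  by right; exists j; rewrite map_poly_eq0.
apply/eqP; rewrite -subr_eq0; apply/eqP; set D := _ - _.
apply/polyP => t; rewrite coef0.
apply: (@roots_geq_poly_eq0 _ _ [seq (a i)%:R | i <- iota 0 L]).
- apply/allP => x /mapP[i]; rewrite mem_iota add0n => /andP[_ iL] -> {x}.
  have : spec (a i)%:R D = 0.
    rewrite /D rmorphB rmorph_sum /= spec_scale cE scaler_sumr -sumrB big1 // => j _.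
    by rewrite spec_scale qrel // scalerA subrr.
  by move=> /polyP/(_ t); rewrite coef_map coef0 => /= h; apply/rootP.
- by rewrite map_inj_uniq ?iota_uniq // => i j /(natr_inj charK)/a_inj.
- rewrite size_map size_iota /D coefB coef_sum coefCM.
  have sM (p r : {poly K}) : (size p <= (d * B).+1)%N -> (size r <= B.+1)%N -> (size (p * r)%R <= L)%N.
    by move=> sp sr; rewrite (leq_trans (size_polyMleq _ _)) // /L; lia.
  rewrite (leq_trans (size_polyD _ _)) // geq_max sM ?size_polyN //=.
  rewrite (leq_trans (size_sum _ _ _)) //; apply/bigmax_leqP => j _.
  by rewrite coefCM sM ?sV.
Qed.

End Pade.

(** The data of a specialization problem. In the applications [prim_min] is the
    minimal polynomial of a primitive element over the polynomials in one variable, the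
    generator [gen] of the part inside the subfield satisfies [gen_min], and
    [outs] are elements that stay outside of the subfield. *)
Record problem (R : nzRingType) := Problem {
  deg : nat;
  bound : nat;
  prim_min : {poly {poly R}};
  gen_min : {poly {poly R}};
  gen : {poly {poly R}};
  outs : seq {poly {poly R}};
  avoid : {poly R} }.

Section Problems.
Variable (K : idomainType).
Implicit Types (F : {pred K}) (D : problem K).

(** The power of the generator, as the reduced polynomial in the primitive
    element. *)
Definition gen_pow D j : {poly {poly K}} := Pdiv.Ring.rmodp (gen D ^+ j) (prim_min D).

Definition combination D (ps : 'I_(deg D) -> {poly K}) : {poly {poly K}} :=
  \sum_(j < deg D) (ps j)%:P * gen_pow D j.

(** The degree that [pade] produces.  A fixed bound makes the conditions below
    first order in the coefficients, so that they hold in an ultrapower if and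
    only if they hold at almost all indices. *)
Definition small D (p : {poly K}) := (size p <= (deg D * bound D).+1)%N.

(** The element [z] of the function field is not in the field generated by
    [gen D] over the rational functions with coefficients in [F], as far as
    relations with [small] coefficients can tell. *)
Definition outside F D (z : {poly {poly K}}) :=
  [/\ (size z < size (prim_min D))%N, forall i, (size (z`_i)%R <= (bound D).+1)%N &
    forall (p : {poly K}) (ps : 'I_(deg D) -> {poly K}),
      small D p -> coefs_in F p -> (forall j, small D (ps j) /\ coefs_in F (ps j)) ->
      p%:P * z = combination ps -> p = 0].

(** The degree of [gen D] over all rational functions is [deg D]; again as far as
    [small] coefficients can tell. *)
Definition independent_powers D :=
  forall ps : 'I_(deg D) -> {poly K}, (forall j, small D (ps j)) ->
    combination ps = 0 -> forall j, ps j = 0.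

Definition well_posed F D : Prop :=
  [/\ [/\ (0 < deg D)%N, avoid D != 0 &
        forall j, (j < deg D)%N -> forall i, (size ((gen_pow D j)`_i)%R <= (bound D).+1)%N],
      prim_min D \is monic /\ irreducible_poly (prim_min D),
      [/\ gen_min D \is monic, size (gen_min D) = (deg D).+1,
        forall i, coefs_in F (gen_min D)`_i &
        exists s, gen_min D \Po gen D = s * prim_min D],
      independent_powers D &
      forall z, z \in outs D -> outside F D z].

(** The predicate [pt] is that of being a natural number, or a nonstandard one in
    an ultrapower.  The polynomial [avoid D] excludes finitely many points, where
    denominators vanish. *)
Definition solved F (pt : K -> Prop) D : Prop :=
  exists x w, [/\ pt x, (spec x (prim_min D)).[w] = 0, (avoid D).[x] != 0,
    (spec x (gen D)).[w] \in F & forall z, z \in outs D -> (spec x z).[w] \notin F].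

End Problems.

Lemma eventually_all (T : eqType) (s : seq T) (Q : T -> nat -> Prop) :
  (forall t, t \in s -> exists N, forall m, (N < m)%N -> Q t m) ->
  exists N, forall t, t \in s -> forall m, (N < m)%N -> Q t m.
Proof.
elim: s => [|t s IHs] h; first by exists 0%N.
have [N1 N1P] := h t (mem_head _ _).
have [|N2 N2P] := IHs; first by move=> u us; apply: h; rewrite inE us orbT.
exists (maxn N1 N2) => u; rewrite inE => /orP[/eqP->|us] m; rewrite gtn_max => /andP[m1 m2].
  exact: N1P.
exact: N2P.
Qed.

Lemma eventually_nonroot (K : closedFieldType) (q : {poly K}) : [pchar K] =i pred0 -> q != 0 ->
  exists N, forall m, (N < m)%N -> q.[m%:R] != 0.
Proof.
move=> charK q0; have [rs rsE] := closed_field_poly_normal q.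
have [|N NP] := @eventually_all _ rs (fun r m => m%:R != r).
  move=> r _; have [[m0 <-]|no] := pselect (exists m0, m0%:R = r).
    by exists m0 => m mm0; apply/eqP => /(natr_inj charK) e; rewrite e ltnn in mm0.
  by exists 0%N => m _; apply/eqP => e; apply: no; exists m.
exists N => m /(fun mN r rs => NP r rs m mN) mP.
rewrite rsE hornerZ mulf_neq0 ?lead_coef_eq0 // -/(root _ _).
by apply/negP; rewrite -/(root _ _) root_prod_XsubC => /mP; rewrite eqxx.
Qed.

(** A nonzero polynomial has finitely many roots, so its value at the index is
    nonzero from some index on. *)
Lemma index_transcendental (K : closedFieldType) (q : {poly K}) : [pchar K] =i pred0 ->
  (map_poly (@udiag K) q).[ulim (fun n => n%:R)] = 0 -> q = 0.
Proof.
move=> charK; have -> : (map_poly (@udiag K) q).[ulim (fun n => n%:R)] = ulim (fun n => q.[n%:R]).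
  elim/poly_ind: q => [|q c IHq].
    by rewrite rmorph0 horner0 -(rmorph0 (@ulim K)); congr ulim; apply/funext => n; rewrite horner0.
  rewrite rmorphD rmorphM /= map_polyX map_polyC !hornerE IHq -rmorphM -rmorphD.
  by congr ulim; apply/funext => n; rewrite !hornerE.
move=> /ulim_eq0 h; apply: contraTeq isT => q0.
have [N NP] := eventually_nonroot charK q0.
have [n [/eqP qn /NP]] := ae_ex (ae_and h (ae_ge N.+1)).
by rewrite qn.
Qed.

Definition generic (K : idomainType) (F : {pred K}) (pt : K -> Prop) : Prop :=
  forall D, well_posed F D -> solved F pt D.

Lemma natural_closed (K : fieldType) (k : {pred K}) : divring_closed k -> forall m : nat, m%:R \in k.
Proof.
move=> [k1 ksub _] m; have k0 : 0 \in k by rewrite -(subrr 1) ksub.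
elim: m => [//|m IHm]; rewrite -addn1 natrD -[X in _ + X]opprK ksub //.
by rewrite -sub0r ksub.
Qed.

Section Density.
Variables (K : closedFieldType) (iota : {rmorphism rat -> K}).
Hypothesis K_alg : forall a : K, algebraicOver iota a.

Definition natural : K -> Prop := fun x => exists m : nat, x = m%:R.

(** The ultrapower of [K] serves as a field with an element transcendental over
    [K]: the class of the sequence of all natural numbers. *)
Theorem hilbert_irreducibility (P : {poly {poly K}}) (S : seq K) :
  P \is monic -> irreducible_poly P ->
  exists2 k : {pred K}, divring_closed k & {subset S <= k} /\
    forall N0, exists m : nat, (N0 < m)%N /\ forall w, (spec m%:R P).[w] = 0 ->
      forall q : {poly K}, coefs_in k q -> (size q < size P)%N -> q.[w] = 0 -> q = 0.
Proof.
have charK : [pchar K] =i pred0 by move=> p; rewrite (fmorph_pchar iota) pchar_num.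
by apply: (hilbert_irreducibility_number_field K_alg) => q; exact: index_transcendental.
Qed.

(** Each problem that is well posed for [F0] is solved by a subfield that agrees
    with [F0] on a given finite set: adjoin the specialized generator, at a point
    given by Hilbert's theorem, to a number field inside [F0].  Were an element
    of [outs D], or an element of [s] outside of [F0], caught for arbitrarily
    large points, Pade approximation would give a relation over [F0] that
    contradicts well-posedness. *)
Theorem density (F0 : {pred K}) (D : problem K) (s : seq K) :
  divring_closed F0 -> well_posed F0 D ->
  exists F1 : {pred K}, [/\ divring_closed F1, {in s, forall x, (x \in F1) = (x \in F0)} &
    solved F1 natural D].
Proof.
move=> F0c [[d0 zeta0 sV] [Pm Pirr] [fm sf fF [q0 fq]] indep outsF].
set d := deg D in d0 sV sf *; set B := bound D in sV *.
set P := prim_min D in Pm Pirr fq *.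
have charK : [pchar K] =i pred0 by move=> p; rewrite (fmorph_pchar iota) pchar_num.
have P0 : P != 0 := monic_neq0 Pm; have [sP _] := Pirr.
pose coefs (q : {poly {poly K}}) : seq K := flatten (map (@polyseq K) (polyseq q)).
have coefsP (k : {pred K}) q : divring_closed k -> {subset coefs q <= k} -> forall i, coefs_in k q`_i.
  move=> kc sub i l; have [li|li] := ltnP l (size (q`_i)%R); last by rewrite nth_default // (natural_closed kc 0).
  have [iq|iq] := ltnP i (size q); last by rewrite (nth_default _ iq) size_poly0 in li.
  apply: sub; apply/flattenP; exists (polyseq q`_i); last exact: mem_nth.
  by apply: map_f; exact: mem_nth.
pose S := s ++ flatten (map coefs ([:: gen_min D] ++ [seq gen_pow D j | j <- index_iota 0 d] ++ outs D)).
have [k1 k1c [Sk1 hilb]] := hilbert_irreducibility S Pm Pirr.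
have memS q : q \in [:: gen_min D] ++ [seq gen_pow D j | j <- index_iota 0 d] ++ outs D ->
    forall i, coefs_in k1 q`_i.
  move=> qin; apply: coefsP => // c cq; apply: Sk1; rewrite mem_cat; apply/orP; right.
  by apply/flattenP; exists (coefs q) => //; exact: map_f.
have specin m (k : {pred K}) (q : {poly {poly K}}) : divring_closed k -> (forall i, coefs_in k q`_i) -> coefs_in k (spec m%:R q).
  move=> kc qk i; rewrite coef_map /= /horner_eval.
  have [f fE] := poly_lift kc (qk i).
  rewrite fE -(rmorph_nat (sfval (mk_subfield kc))) horner_map; exact: sfval_in.
pose k : {pred K} := fun x => (x \in k1) && (x \in F0).
have kc : divring_closed k.
  have [k11 k1s k1d] := k1c; have [F01 F0s F0d] := F0c.
  split=> [|x y /andP[x1 x2] /andP[y1 y2]|x y /andP[x1 x2] /andP[y1 y2]].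
  - by apply/andP.
  - by apply/andP; split; [exact: k1s|exact: F0s].
  - by apply/andP; split; [exact: k1d|exact: F0d].
have fk i : coefs_in k (gen_min D)`_i.
  by move=> l; apply/andP; split; [exact: memS (mem_head _ _) i l|exact: fF].
pose V := gen_pow D.
(* The constants outside of [F0] are treated like the elements of [outs D]. *)
pose zs := outs D ++ [seq b%:P%:P | b <- s & b \notin F0].
pose Bad z m := exists c : 'I_d -> K, (forall j, c j \in k) /\
     spec m%:R z = \sum_(j < d) c j *: spec m%:R (V j).
have [N1 N1P] : exists N, forall z, z \in zs -> forall m, (N < m)%N -> ~ Bad z m.
  apply: eventually_all => z zzs.
  apply: contrapT => nobound.
  have zB i : (size (z`_i)%R <= B.+1)%N.
    move: zzs; rewrite mem_cat => /orP[/outsF[]//|/mapP[b _ ->]].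
    by rewrite coefC; case: eqP => _; rewrite ?size_poly0 // (leq_trans (size_polyC_leq1 _)).
  have [|p [ps [pk sp psk pE p0]]] := pade kc charK sV zB.
    move=> N; apply: contrapT => none; apply: nobound; exists N => m mN bad.
    by apply: none; exists m.
  have p00 : p = 0.
    move: zzs; rewrite mem_cat => /orP[/outsF[_ _ out]|/mapP[b]].
      apply: (out p ps) => // [i|j]; first by have /andP[] := pk i.
      by have [psk1 ?] := psk j; split => // i; have /andP[] := psk1 i.
    rewrite mem_filter => /andP[bF0 bs] zE.
    pose o : 'I_d := Ordinal d0.
    pose ps' j := if j == o then ps j - p * b%:P else ps j.
    have ps'0 : ps' o = 0.
      apply: indep => [j|].
        rewrite /small /ps'; have [_ sj] := psk j; case: eqP => _ //.
        rewrite (leq_trans (size_polyD _ _)) // geq_max sj size_polyN mulrC mul_polyC.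
        by rewrite (leq_trans (size_scale_leq _ _)).
      rewrite /combination (bigD1 o) //= /ps' eqxx.
      rewrite (eq_bigr (fun j => (ps j)%:P * gen_pow D j)); last by move=> j /negPf->.
      rewrite polyCB mulrBl addrAC -(bigD1 (P := xpredT) (F := fun j => (ps j)%:P * gen_pow D j) o) // -pE zE.
      rewrite /gen_pow expr0 Pdiv.Ring.rmodp_small ?size_poly1 //.
      by rewrite mulr1 polyCM subrr.
    apply: contraTeq isT => pn0; move/eqP: ps'0; rewrite /ps' eqxx subr_eq0 => /eqP psE.
    have lk : lead_coef p \in F0 by have /andP[] := pk (size p).-1.
    have lbk : lead_coef p * b \in F0.
      by have [/(_ (size p).-1)/andP[_]] := psk o; rewrite psE coefMC.
    move: bF0; rewrite -[b](mulKf (x := lead_coef p)) ?lead_coef_eq0 //.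
    have [_ _ F0d] := F0c; rewrite mulrC F0d //.
  have [|j0] : p != 0 \/ exists j, ps j != 0 by [].
    by rewrite p00 eqxx.
  case: j0 => j; rewrite (indep ps) ?eqxx // => [i|]; first by have [] := psk i.
  by rewrite /combination -pE p00 mul0r.
have [N2 N2P] := eventually_nonroot charK zeta0.
have [m [mN mgood]] := hilb (maxn N1 N2).
move: mN; rewrite gtn_max => /andP[mN1 mN2].
have sPm : size (spec m%:R P) = size P.
  by rewrite size_map_poly_id0 // (monicP Pm) /horner_eval hornerC oner_eq0.
have [w0 /rootP w0P] : exists w0, root (spec m%:R P) w0 by apply: poly_root_exists; rewrite sPm.
pose y0 := (spec m%:R (gen D)).[w0].
have Vy j : (spec m%:R (V j)).[w0] = y0 ^+ j.
  have /(congr1 (fun q => (spec m%:R q).[w0])) := Pdiv.RingMonic.rdivp_eq Pm (gen D ^+ j).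
  by rewrite rmorphXn rmorphD rmorphM hornerD hornerM horner_exp [X in _ * X]w0P mulr0 add0r.
have [ft ftE] := poly_lift kc (specin m _ _ kc fk).
have sft : size ft = d.+1.
  rewrite -(size_map_poly (sfval (mk_subfield kc))) -ftE size_map_poly_id0 //.
  by rewrite (monicP fm) /horner_eval hornerC oner_eq0.
have ft0 : ft != 0 by rewrite -size_poly_gt0 sft.
have fty : (map_poly (sfval _) ft).[y0] = 0.
  rewrite -ftE /y0 -horner_comp.
  have -> : spec m%:R (gen_min D) \Po spec m%:R (gen D) = spec m%:R q0 * spec m%:R P.
    by rewrite -map_comp_poly fq rmorphM.
  by rewrite hornerM w0P mulr0.
have ya : algebraicOver (sfval (mk_subfield kc)) y0 by exists ft => //; exact/rootP.
exists (adjoin (sfval (mk_subfield kc)) y0).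
have zout z : z \in zs -> (spec m%:R z).[w0] \notin adjoin (sfval (mk_subfield kc)) y0.
  move=> zzs; apply/negP => /asboolP[g gE].
  have [h [sh hE]] := adjoin_reduce g ft0 fty.
  apply: (N1P z zzs m mN1); exists (fun j => sfval _ h`_j); split=> [j|]; first exact: sfval_in.
  apply/eqP; rewrite -subr_eq0; apply/eqP; apply: (mgood w0 w0P).
  - have zk1 i : coefs_in k1 z`_i.
      move: zzs; rewrite mem_cat => /orP[zD|/mapP[b]].
        by apply: memS; rewrite !mem_cat zD !orbT.
      rewrite mem_filter => /andP[_ bs] -> l; rewrite coefC.
      case: eqP => _; rewrite ?coef0 ?coefC; last exact: (natural_closed k1c 0).
      case: eqP => _; last exact: (natural_closed k1c 0).
      by apply: Sk1; rewrite mem_cat bs.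
    move=> i; rewrite coefB coef_sum.
    apply: (@rpredB _ (subfield_pred (mk_subfield k1c))); first exact: (specin m k1 z k1c zk1).
    apply: rpred_sum => j _; rewrite coefZ; apply: rpredM.
      have [x <-] : exists x, sfval (mk_subfield kc) x = sfval _ h`_j by exists h`_j.
      by have /andP[] := sfval_in x.
    apply: (specin m k1 _ k1c); apply: memS; rewrite !mem_cat; apply/orP; right; apply/orP; left.
    by apply/mapP; exists (val j) => //; rewrite mem_index_iota ltn_ord.
  - rewrite (leq_ltn_trans (size_polyD _ _)) // gtn_max size_polyN; apply/andP; split.
      have zP : (size z < size P)%N.
        move: zzs; rewrite mem_cat => /orP[/outsF[]|/mapP[b _ ->]] //.
        exact: leq_ltn_trans (size_polyC_leq1 _) sP.
      exact: leq_ltn_trans (size_poly _ _) zP.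
    rewrite (leq_ltn_trans (size_sum _ _ _)) //.
    rewrite -(ltn_predK sP) ltnS; apply/bigmax_leqP => j _.
    rewrite -ltnS (ltn_predK sP) (leq_ltn_trans (size_scale_leq _ _)) //.
    by rewrite (leq_ltn_trans (size_poly _ _)) // Pdiv.Ring.ltn_rmodpN0.
  - rewrite hornerD hornerN horner_sum gE hE; apply/eqP; rewrite subr_eq0.
    rewrite (horner_coef_wide _ (_ : (size (map_poly (sfval (mk_subfield kc)) h) <= d)%N)); last first.
      by rewrite size_map_poly -ltnS -sft.
    by apply/eqP; apply: eq_bigr => j _; rewrite coef_map hornerZ Vy.
split; first exact: adjoin_closed.
- move=> x xs; have [xF|xF] := boolP (x \in F0).
    have xk : x \in k by apply/andP; split => //; apply: Sk1; rewrite mem_cat xs.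
    by have [x' <-] := sfvalP kc xk; exact: adjoin_base.
  have -> : x = (spec m%:R x%:P%:P).[w0] by rewrite map_polyC hornerC /= /horner_eval hornerC.
  apply/negbTE/zout; rewrite mem_cat; apply/orP; right.
  by apply/mapP; exists x => //; rewrite mem_filter xF.
- exists m%:R, w0; split=> //; first by exists m.
  + exact: N2P.
  + exact: adjoin_gen.
  + by move=> z zD; apply: zout; rewrite mem_cat zD.
Qed.

End Density.

(** * Enumerations *)

Definition enumerable (T : Type) := exists e : nat -> T, forall t, exists n, e n = t.

Lemma enumerable_countType (T : countType) (t0 : T) : enumerable T.
Proof.
exists (fun n => odflt t0 (unpickle n)) => t; exists (pickle t).
by rewrite pickleK.
Qed.

Lemma enumerable_image (A B : Type) (f : A -> B) :
  enumerable A -> (forall b, exists a, f a = b) -> enumerable B.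
Proof.
by move=> [e eP] fP; exists (f \o e) => b; have [a <-] := fP b; have [n <-] := eP a; exists n.
Qed.

Lemma enumerable_prod (A B : Type) : enumerable A -> enumerable B -> enumerable (A * B).
Proof.
move=> [a aP] [b bP].
apply: (@enumerable_image (nat * nat) _ (fun n => (a n.1, b n.2))).
  exact: (enumerable_countType (0%N, 0%N)).
by move=> [x y]; have [m <-] := aP x; have [n <-] := bP y; exists (m, n).
Qed.

Lemma enumerable_seq (A : Type) : enumerable A -> enumerable (seq A).
Proof.
move=> [a aP]; apply: (@enumerable_image (seq nat) _ (map a)); first exact: (enumerable_countType [::]).
elim=> [|x s [t <-]]; first by exists [::].
by have [n <-] := aP x; exists (n :: t).
Qed.

Lemma enumerable_poly (R : nzRingType) : enumerable R -> enumerable {poly R}.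
Proof.
move=> eR; apply: (@enumerable_image (seq R) _ (@Poly R)); first exact: enumerable_seq.
by move=> p; exists p; rewrite polyseqK.
Qed.

(** An algebraic element is determined by an equation and the position of the
    element among its roots. *)
Lemma enumerable_algebraic (R : idomainType) (M : closedFieldType) (rho : {rmorphism R -> M}) :
  injective rho -> enumerable R ->
  exists s : nat -> M, forall m, alg_over rho m -> exists n, s n = m.
Proof.
move=> rho_inj eR.
have [e eP] : enumerable ({poly R} * nat).
  by apply: enumerable_prod; [exact: enumerable_poly|exact: (enumerable_countType 0%N)].
pose rts (p : {poly M}) := sval (closed_field_poly_normal p).
exists (fun n => nth 0 (rts (map_poly rho (e n).1)) (e n).2) => m [p p0 pm].
have [n nE] := eP (p, index m (rts (map_poly rho p))); exists n; rewrite nE /= nth_index //.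
have := svalP (closed_field_poly_normal (map_poly rho p)); rewrite -/(rts _) => pE.
have : root (map_poly rho p) m by exact/rootP.
rewrite {1}pE rootZ; first by rewrite root_prod_XsubC.
rewrite lead_coef_eq0 -size_poly_gt0.
by rewrite size_map_inj_poly ?rmorph0 // size_poly_gt0.
Qed.

Lemma enumerable_closure (K : closedFieldType) (iota : {rmorphism rat -> K}) :
  (forall x : K, algebraicOver iota x) -> enumerable K.
Proof.
move=> K_alg.
have [s sP] := enumerable_algebraic (fmorph_inj iota) (enumerable_countType 0).
by exists s => x; apply: sP; have [p p0 /rootP px] := K_alg x; exists p.
Qed.

Lemma enumerable_problem (R : nzRingType) : enumerable R -> enumerable (problem R).
Proof.
move=> eR; have e1 := enumerable_poly eR; have e2 := enumerable_poly e1.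
have e0 := @enumerable_countType nat 0%N.
apply: (@enumerable_image (nat * nat * {poly {poly R}} * {poly {poly R}} * {poly {poly R}} *
    seq {poly {poly R}} * {poly R}) _
  (fun t => let: (d, B, P, f, g, zs, q) := t in Problem d B P f g zs q)).
  by do !apply: enumerable_prod => //; exact: enumerable_seq.
by case=> d B P f g zs q; exists (d, B, P, f, g, zs, q).
Qed.

(** * Transfer of genericity to the ultrapower *)

Lemma size_eq_support (R S : nzRingType) (p : {poly R}) (q : {poly S}) :
  (forall i, (p`_i == 0) = (q`_i == 0)) -> size p = size q.
Proof.
have le (R1 S1 : nzRingType) (p1 : {poly R1}) (q1 : {poly S1}) :
    (forall i, (p1`_i == 0) = (q1`_i == 0)) -> (size p1 <= size q1)%N.
  move=> h; apply/leq_sizeP => i qi; apply/eqP; rewrite h; apply/eqP.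
  exact: nth_default.
by move=> h; apply/eqP; rewrite eqn_leq !le.
Qed.

Lemma spec_horner_morph (R S : comNzRingType) (h : {rmorphism R -> S}) (p : {poly {poly R}}) x w :
  (spec (h x) (map_poly (map_poly h) p)).[h w] = h (spec x p).[w].
Proof.
rewrite -horner_map; congr (_.[_]); apply/polyP => i.
by rewrite !coef_map /= /horner_eval horner_map.
Qed.

Lemma gen_pow_eq (R : idomainType) (D : problem R) j : prim_min D \is monic ->
  exists2 q : {poly {poly R}}, gen D ^+ j = q * prim_min D + gen_pow D j &
    (size (gen_pow D j) < size (prim_min D))%N.
Proof.
move=> Pm; exists (Pdiv.Ring.rdivp (gen D ^+ j) (prim_min D)).
  exact: Pdiv.RingMonic.rdivp_eq.
by rewrite Pdiv.Ring.ltn_rmodpN0 // monic_neq0.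
Qed.

Section Transfer.
Variables (K : closedFieldType) (F : {pred K}) (F_closed : divring_closed F).
Notation M := (upow K).

(** The ultrapower of [F], as a subset of the ultrapower of [K]. *)
Definition upred : {pred M} := fun x => `[< ae (fun n => urep x n \in F) >].

Lemma upredP s : ulim s \in upred <-> ae (fun n => s n \in F).
Proof.
split=> [/asboolP h|h]; first by apply: ae_imp2 h (urep_ulim s) _ => n + <-.
by apply/asboolP; apply: ae_imp2 h (urep_ulim s) _ => n + ->.
Qed.

Lemma upred_closed : divring_closed upred.
Proof.
have [F1 Fs Fd] := F_closed; split.
- by rewrite -(rmorph1 (@ulim K)); apply/upredP; exact: aeT.
- move=> x y; rewrite -(urepK x) -(urepK y) => /upredP xF /upredP yF.
  by rewrite -rmorphB; apply/upredP; apply: ae_imp2 xF yF _ => n; exact: Fs.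
- move=> x y; rewrite -(urepK x) -(urepK y) => /upredP xF /upredP yF.
  have [->|y0] := eqVneq (ulim (urep y)) 0.
    rewrite invr0 mulr0 -(subrr (@ulim K 1)) -rmorphB; apply/upredP; apply: aeT => n.
    exact: Fs.
  have -> : ulim (urep x) / ulim (urep y) = ulim (fun n => urep x n / urep y n).
    apply: (mulIf y0); rewrite divfK // -rmorphM; apply/ulim_eq.
    have /ae_notE : ~ ae (fun n => urep y n = 0) by move=> /ulim_eq0 e; rewrite e eqxx in y0.
    by move=> h; apply: ae_imp h _ => n /eqP yn; rewrite /= [RHS]divfK.
  by apply/upredP; apply: ae_imp2 xF yF _ => n; exact: Fd.
Qed.

Definition unatural : M -> Prop := fun x => exists s : nat -> nat, x = ulim (fun n => (s n)%:R).

Lemma ae_support1 p : ae (fun n => forall i, ((at1 n p)`_i == 0) = ((ulim1 p : {poly M})`_i == 0)).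
Proof.
have h : ae (fun n => forall i, (i < size p)%N -> ((at1 n p)`_i == 0) = ((ulim1 p : {poly M})`_i == 0)).
  apply: ae_all_lt => i _; rewrite coef_map.
  have [/ulim_eq0 e|] := eqVneq (ulim p`_i) 0.
    by apply: ae_imp e _ => n e; rewrite coef_map /= e eqxx.
  move=> /eqP e; have /ae_notE e' : ~ ae (fun n => at_ n p`_i = 0) by move=> /ulim_eq0.
  by apply: ae_imp e' _ => n /eqP/negPf; rewrite coef_map.
apply: ae_imp h _ => n hn i; have [/hn//|ip] := ltnP i (size p).
by rewrite !coef_map (nth_default _ ip) !raddf0 !eqxx.
Qed.

Lemma ae_size1 p : ae (fun n => size (at1 n p) = size (ulim1 p : {poly M})).
Proof. by apply: ae_imp (ae_support1 p) _ => n; exact: size_eq_support. Qed.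

Lemma ae_support2 p : ae (fun n => forall i, ((at2 n p)`_i == 0) = ((ulim2 p : {poly {poly M}})`_i == 0)).
Proof.
have h : ae (fun n => forall i, (i < size p)%N -> ((at2 n p)`_i == 0) = ((ulim2 p : {poly {poly M}})`_i == 0)).
  apply: ae_all_lt => i _; apply: ae_imp (ae_size1 p`_i) _ => n e.
  by rewrite !coef_map -!size_poly_eq0 /= e.
apply: ae_imp h _ => n hn i; have [/hn//|ip] := ltnP i (size p).
by rewrite !coef_map (nth_default _ ip) !raddf0 !eqxx.
Qed.

Lemma ae_size2 p : ae (fun n => size (at2 n p) = size (ulim2 p : {poly {poly M}}) /\
  forall i, size ((at2 n p)`_i) = size ((ulim2 p : {poly {poly M}})`_i)).
Proof.
apply: ae_and; first by apply: ae_imp (ae_support2 p) _ => n; exact: size_eq_support.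
have h : ae (fun n => forall i, (i < size p)%N -> size ((at2 n p)`_i) = size ((ulim2 p : {poly {poly M}})`_i)).
  by apply: ae_all_lt => i _; apply: ae_imp (ae_size1 p`_i) _ => n e; rewrite !coef_map.
apply: ae_imp h _ => n hn i; have [/hn//|ip] := ltnP i (size p).
by rewrite !coef_map (nth_default _ ip) !raddf0 !size_poly0.
Qed.

Lemma ae_monic p : (ulim2 p : {poly {poly M}}) \is monic -> ae (fun n => at2 n p \is monic).
Proof.
rewrite monicE => /eqP pm; set s := size (ulim2 p) in pm.
have : ulim1 (p`_s.-1 - 1) = 0 by rewrite rmorphB rmorph1 /= -coef_map -[X in X - _]/(lead_coef _) pm subrr.
move=> /ulim1_eq0 e; apply: ae_imp2 e (ae_size2 p) _ => n e [sn _].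
rewrite monicE lead_coefE sn -/s -subr_eq0; apply/eqP.
by move: e; rewrite rmorphB rmorph1 /= -coef_map.
Qed.

Lemma ae_coefs_in p : (forall i, coefs_in upred (ulim2 p)`_i) ->
  ae (fun n => forall i, coefs_in F (at2 n p)`_i).
Proof.
move=> pG.
have h : ae (fun n => forall i, (i < size p)%N -> forall l, (l < size (p`_i)%R)%N -> at_ n p`_i`_l \in F).
  apply: ae_all_lt => i _; apply: ae_all_lt => l _; apply/upredP.
  by have := pG i l; rewrite !coef_map.
have F0 : 0 \in F by have [F1 Fs _] := F_closed; rewrite -(subrr 1) Fs.
apply: ae_imp h _ => n hn i l; rewrite !coef_map.
have [ip|ip] := ltnP i (size p); last by rewrite (nth_default _ ip) /= coef0.
have [lp|lp] := ltnP l (size (p`_i)%R); first exact: hn.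
by rewrite (nth_default _ lp).
Qed.

(** Factors at almost all indices can be taken monic by [gauss_monic], and then
    have bounded degrees by [factor_degree_bound]; so they are the components of
    a factorization over the ultrapower. *)
Lemma ae_irreducible p : (ulim2 p : {poly {poly M}}) \is monic -> irreducible_poly (ulim2 p : {poly {poly M}}) ->
  ae (fun n => irreducible_poly (at2 n p)).
Proof.
move=> pm [sp pirr]; apply: contrapT => /ae_notE bad.
pose p' : {poly {poly M}} := ulim2 p.
pose s := size p'; pose a := (\max_(i < s) size (p'`_i)%R)%N.
have aP i : (size (p'`_i)%R <= a)%N.
  have [ip|ip] := ltnP i s; last by rewrite nth_default ?size_poly0.
  exact: (leq_bigmax (F := fun i : 'I_s => size (p'`_i)%R) (Ordinal ip)).
pose N := (s + (a * s + 1))%N.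
have fac : ae (fun n => exists AB : {poly {poly K}} * {poly {poly K}},
    [/\ at2 n p = AB.1 * AB.2, (1 < size AB.1 < s)%N, (size AB.2 <= s)%N &
      forall i, (size ((AB.1)`_i)%R <= N)%N /\ (size ((AB.2)`_i)%R <= N)%N]).
  apply: ae_imp2 (ae_and bad (ae_monic pm)) (ae_size2 p) _ => n [nirr nm] [ns nsi].
  have [Q [sQ1 Qp Qp']] : exists Q : {poly {poly K}}, [/\ size Q != 1%N, Q %| at2 n p & ~~ (Q %= at2 n p)].
    apply: contrapT => none; apply: nirr; split; first by rewrite ns.
    move=> Q sQ Qp; apply: contraT => Qp'; exfalso; apply: none; by exists Q.
  have [A [B [Am Bm AB sA]]] := gauss_monic nm Qp.
  have A0 := monic_neq0 Am; have B0 := monic_neq0 Bm.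
  have sAB : (size A + size B = s.+1)%N.
    by rewrite /s -ns AB size_mul // prednK // addn_gt0 size_poly_gt0 A0.
  have sA1 : (1 < size A)%N by rewrite ltn_neqAle eq_sym sA sQ1 -sA size_poly_gt0.
  have sB1 : (0 < size B)%N by rewrite size_poly_gt0.
  have sAs : (size A < s)%N.
    rewrite ltn_neqAle; apply/andP; split; last by rewrite -ltnS -sAB -addn1 leq_add2l.
    by apply: contra Qp' => /eqP e; rewrite -(dvdp_size_eqp Qp) -sA e ns.
  have ABa i : (size ((A * B)`_i)%R <= a)%N by rewrite -AB nsi.
  have BAa i : (size ((B * A)`_i)%R <= a)%N by rewrite mulrC -AB nsi.
  have sBs : (size B <= s)%N by lia.
  exists (A, B); split; rewrite //= ?sA1 // => i; split.
    rewrite (leq_trans (factor_degree_bound Am Bm ABa i)) // /N.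
    by rewrite (leq_trans _ (leq_addl _ _)) // leq_add2r leq_mul2l (ltnW sAs) orbT.
  rewrite (leq_trans (factor_degree_bound Bm Am BAa i)) // /N.
  by rewrite (leq_trans _ (leq_addl _ _)) // leq_add2r leq_mul2l sBs orbT.
have [AB ABP] := ae_choice (0, 0) fac.
have [A AE] := at2_surj N (fun n => (AB n).1).
have [B BE] := at2_surj N (fun n => (AB n).2).
have {}AE : ae (fun n => at2 n A = (AB n).1).
  apply: ae_imp2 AE ABP _ => n h [_ /andP[_ s1] _ si]; apply: h => [|i]; last by case: (si i).
  by rewrite (leq_trans (ltnW s1)) // leq_addr.
have {}BE : ae (fun n => at2 n B = (AB n).2).
  apply: ae_imp2 BE ABP _ => n h [_ _ s1 si]; apply: h => [|i]; last by case: (si i).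
  by rewrite (leq_trans s1) // leq_addr.
have pAB : ulim2 p = ulim2 A * ulim2 B.
  rewrite -rmorphM; apply/ulim2_eq; apply: ae_imp2 ABP (ae_and AE BE) _ => n [h _ _ _] [a1 a2].
  by rewrite h rmorphM /= a1 a2.
have [n [[[h1 h2 _ _] a1] [sA _]]] := ae_ex (ae_and (ae_and ABP AE) (ae_size2 A)).
move: h2; rewrite -a1 sA => /andP[A1 As].
have dvA : ulim2 A %| ulim2 p by rewrite pAB dvdp_mulr.
have := pirr _ _ dvA; rewrite gtn_eqF // => /(_ isT).
by rewrite -(dvdp_size_eqp dvA) -/s ltn_eqF.
Qed.

Lemma at1_surj N (q : nat -> {poly K}) :
  exists p : {poly (nat -> K)}, (size p <= N)%N /\ forall n, (size (q n) <= N)%N -> at1 n p = q n.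
Proof.
exists (\poly_(j < N) (fun n => (q n)`_j)); split; first exact: size_poly.
move=> n qN; apply/polyP => j; rewrite coef_map coef_poly.
case: ltnP => [_//|jN]; rewrite raddf0 nth_default //; exact: leq_trans jN.
Qed.

Lemma map2_combination (R S : nzRingType) (h : {rmorphism R -> S}) d (ps : 'I_d -> {poly R}) (V : nat -> {poly {poly R}}) :
  map_poly (map_poly h) (\sum_(j < d) (ps j)%:P * V j) =
  \sum_(j < d) (map_poly h (ps j))%:P * map_poly (map_poly h) (V j).
Proof.
by rewrite rmorph_sum; apply: eq_bigr => j _; rewrite rmorphM /= map_polyC.
Qed.

(** A problem well posed for [G] is given by sequences of problems, of the same
    degree and bound, and these are almost all well posed for [F]: a sequence of
    counterexamples of bounded degree would be a counterexample over the
    ultrapower.  The solutions in [F] then form a solution in [G]. *)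
Theorem generic_upow : generic F (@natural K) -> generic upred unatural.
Proof.
move=> genF [d B P f g zs q] [/= [d0 q0 sV] [Pm Pirr] [fm sf fF [s fs]] indep outsG].
have [P' PE] := ulim2_surj P; have [f' fE] := ulim2_surj f.
have [g' gE] := ulim2_surj g; have [q' qE] := ulim1_surj q.
have [s' sE] := ulim2_surj s.
have [zs' zsE] : exists zs', zs = [seq ulim2 z | z <- zs'].
  elim: (zs) => [|z l [l' ->]]; first by exists [::].
  by have [z' <-] := ulim2_surj z; exists (z' :: l').
have Pm0 := Pm; rewrite -PE in Pm Pirr; rewrite -fE in fm fF sf.
pose D := Problem d B P f g zs q.
pose Dn n := Problem d B (at2 n P') (at2 n f') (at2 n g') [seq at2 n z | z <- zs'] (at1 n q').
have gp j : exists V', ulim2 V' = gen_pow D j /\ ae (fun n => gen_pow (Dn n) j = at2 n V').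
  have [V' VE] := ulim2_surj (gen_pow D j).
  have [Q gQ sV'] := @gen_pow_eq _ D j Pm0.
  have [Q' QE] := ulim2_surj Q.
  exists V'; split => //.
  have e : ulim2 (g' ^+ j) = ulim2 (Q' * P' + V').
    by rewrite rmorphXn rmorphD rmorphM /= gE PE QE VE.
  have sVP : (size (ulim2 V') < size (ulim2 P'))%N by rewrite VE PE.
  move/ulim2_eq: e => e.
  apply: ae_imp2 (ae_and e (ae_monic Pm)) (ae_and (ae_size2 V') (ae_size2 P')) _ => n [en nm] [[sv _] [sp _]].
  move: en; rewrite rmorphXn rmorphD rmorphM /= => en; rewrite /gen_pow /= en.
  by apply: Pdiv.RingMonic.rmodp_addl_mul_small; rewrite ?sv ?sp.
have [V' VP] := choice gp.
have VE j : ulim2 (V' j) = gen_pow D j by have [] := VP j.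
have Vae : ae (fun n => forall j, (j < d)%N -> gen_pow (Dn n) j = at2 n (V' j)).
  by apply: ae_all_lt => j _; have [] := VP j.
have combM (ps : 'I_d -> {poly (nat -> K)}) :
    ulim2 (\sum_(j < d) (ps j)%:P * V' j) = combination (D := D) (fun j => ulim1 (ps j)).
  by rewrite map2_combination; apply: eq_bigr => j _; rewrite VE.
have combn n (ps : 'I_d -> {poly (nat -> K)}) (qs : 'I_d -> {poly K}) :
    (forall j, (j < d)%N -> gen_pow (Dn n) j = at2 n (V' j)) -> (forall j, at1 n (ps j) = qs j) ->
    at2 n (\sum_(j < d) (ps j)%:P * V' j) = combination (D := Dn n) qs.
  by move=> h hq; rewrite map2_combination; apply: eq_bigr => j _; rewrite h // hq.
pose N := (d * B).+1.
have smallM (p : {poly (nat -> K)}) : (size p <= N)%N -> (size (ulim1 p : {poly M}) <= N)%N.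
  by move=> sp; rewrite (leq_trans (size_poly _ _)).
have ae_indep : ae (fun n => independent_powers (Dn n)).
  apply: contrapT => /ae_notE bad.
  have [qs qsP] : exists qs : nat -> 'I_d -> {poly K}, ae (fun n =>
      [/\ forall j, (size (qs n j) <= N)%N, combination (D := Dn n) (qs n) = 0 & exists j, qs n j != 0]).
    apply: (@ae_choice ('I_d -> {poly K}) (fun=> 0) (fun n qs =>
      [/\ forall j, (size (qs j) <= N)%N, combination (D := Dn n) qs = 0 & exists j, qs j != 0])).
    apply: ae_imp bad _ => n nind; apply: contrapT => none; apply: nind => ps sps ps0 j.
    by apply: contrapT => /eqP psj; apply: none; exists ps; split => //; exists j.
  have [ps psP] := choice (fun j => at1_surj N (fun n => qs n j)).
  have psE : ae (fun n => forall j, at1 n (ps j) = qs n j).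
    by apply: ae_imp qsP _ => n [sq _ _] j; have [_] := psP j; exact.
  have c0 : combination (D := D) (fun j => ulim1 (ps j)) = 0.
    rewrite -combM; apply/ulim2_eq0; apply: ae_imp2 (ae_and qsP psE) Vae _ => n [[_ q00 _] e] v.
    by rewrite (combn n ps (qs n) v e).
  have all0 := indep (fun j => ulim1 (ps j)) (fun j => smallM _ (psP j).1) c0.
  have z0 : ae (fun n => forall j, (j < d)%N -> forall jd : (j < d)%N, at1 n (ps (Ordinal jd)) = 0).
    apply: ae_all_lt => j jd; have /ulim1_eq0 h := all0 (Ordinal jd).
    by apply: ae_imp h _ => n h jd'; rewrite (bool_irrelevance jd' jd).
  have [n [[[_ _ [j /eqP j0]] e] z]] := ae_ex (ae_and (ae_and qsP psE) z0).
  by apply: j0; rewrite -e; case: j => j jd; exact: z.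
have ae_outs : ae (fun n => forall z', z' \in zs' -> outside F (Dn n) (at2 n z')).
  apply: ae_all_seq => z' z'zs; have [] := outsG (ulim2 z'); first by rewrite zsE map_f.
  move=> szP szB out; rewrite /= -PE in szP.
  have : ae (fun n => forall (p : {poly K}) (ps : 'I_d -> {poly K}),
      small (Dn n) p -> coefs_in F p -> (forall j, small (Dn n) (ps j) /\ coefs_in F (ps j)) ->
      p%:P * at2 n z' = combination (D := Dn n) ps -> p = 0).
    apply: contrapT => /ae_notE bad.
    have [qs qsP] : exists qs : nat -> {poly K} * ('I_d -> {poly K}), ae (fun n =>
      [/\ (size (qs n).1 <= N)%N /\ coefs_in F (qs n).1,
          forall j, (size ((qs n).2 j) <= N)%N /\ coefs_in F ((qs n).2 j),
          (qs n).1%:P * at2 n z' = combination (D := Dn n) (qs n).2 & (qs n).1 != 0]).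
      apply: (@ae_choice ({poly K} * ('I_d -> {poly K})) (0, fun=> 0) (fun n qs =>
        [/\ (size qs.1 <= N)%N /\ coefs_in F qs.1,
          forall j, (size (qs.2 j) <= N)%N /\ coefs_in F (qs.2 j),
          qs.1%:P * at2 n z' = combination (D := Dn n) qs.2 & qs.1 != 0])).
      apply: ae_imp bad _ => n nind; apply: contrapT => none; apply: nind => p ps sp pF sps rel.
      by apply: contrapT => /eqP p0; apply: none; exists (p, ps).
    have [ps psP] := choice (fun j => at1_surj N (fun n => (qs n).2 j)).
    have [p [sp pP]] := at1_surj N (fun n => (qs n).1).
    have psE : ae (fun n => forall j, at1 n (ps j) = (qs n).2 j).
      by apply: ae_imp qsP _ => n [_ sq _ _] j; have [_] := psP j; apply; case: (sq j).
    have pE : ae (fun n => at1 n p = (qs n).1).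
      by apply: ae_imp qsP _ => n [[sq _] _ _ _]; exact: pP.
    have coefG (r : {poly (nat -> K)}) : ae (fun n => coefs_in F (at1 n r)) -> coefs_in upred (ulim1 r).
      by move=> h i; rewrite coef_map; apply/upredP; apply: ae_imp h _ => n /(_ i); rewrite coef_map.
    have p0 : ulim1 p = 0.
      apply: (out (ulim1 p) (fun j => ulim1 (ps j))).
      - exact: smallM.
      - by apply: coefG; apply: ae_imp2 qsP pE _ => n [[_ h] _ _ _] ->.
      - move=> j; split; first exact: smallM (psP j).1.
        by apply: coefG; apply: ae_imp2 qsP psE _ => n [_ h _ _] ->; case: (h j).
      - transitivity (ulim2 (p%:P * z')); first by rewrite rmorphM /= map_polyC.
        transitivity (ulim2 (\sum_(j < d) (ps j)%:P * V' j)); last exact: combM.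
        apply/ulim2_eq; apply: ae_imp2 (ae_and qsP Vae) (ae_and psE pE) _ => n [[_ _ h _] v] [e1 e2].
        by rewrite (combn n ps _ v e1) rmorphM /= map_polyC /= e2.
    move/ulim1_eq0: p0 => p0; have [n [[[_ _ _ /eqP nz] e1] e2]] := ae_ex (ae_and (ae_and qsP pE) p0).
    by apply: nz; rewrite -e1.
  move=> h; apply: ae_imp2 h (ae_and (ae_size2 z') (ae_size2 P')) _ => n hn [[s1 s2] [s3 _]].
  by split; rewrite /= ?s1 ?s3 // => i; rewrite s2.
have wp : ae (fun n => well_posed F (Dn n)).
  have q'0 : ae (fun n => at1 n q' != 0).
    have /ae_notE : ~ ae (fun n => at1 n q' = 0) by move=> /ulim1_eq0 e; rewrite -qE e eqxx in q0.
    by move=> h; apply: ae_imp h _ => n /eqP.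
  have sVn : ae (fun n => forall j, (j < d)%N -> forall i, (size ((at2 n (V' j))`_i)%R <= B.+1)%N).
    apply: ae_all_lt => j jd; apply: ae_imp (ae_size2 (V' j)) _ => n [_ h] i.
    by rewrite h VE; exact: sV.
  have fsn : ae (fun n => at2 n f' \Po at2 n g' = at2 n s' * at2 n P').
    have : ulim2 (f' \Po g') = ulim2 (s' * P').
      by rewrite map_comp_poly rmorphM /= fE gE sE PE.
    move=> /ulim2_eq h; apply: ae_imp h _ => n; by rewrite map_comp_poly rmorphM.
  have A1 := ae_and (ae_and ae_indep ae_outs) (ae_and (ae_monic Pm) (ae_irreducible Pm Pirr)).
  have A2 := ae_and (ae_and (ae_monic fm) (ae_coefs_in fF)) (ae_and fsn (ae_size2 f')).
  have A3 := ae_and q'0 (ae_and sVn Vae).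
  apply: ae_imp2 (ae_and A1 A2) A3 _ => n [[[a1 a2] [a3 a4]] [[b1 b2] [b3 [b4 _]]]] [c1 [c2 c3]].
  split=> //; first by split=> // j jd i; rewrite c3 //; exact: c2.
    by split => //; [rewrite b4|exists (at2 n s')].
  by move=> z /mapP[z' z'zs ->]; exact: a2.
have sol : ae (fun n => exists xw : nat * K, [/\ (spec (xw.1)%:R (at2 n P')).[xw.2] = 0, (at1 n q').[(xw.1)%:R] != 0,
    (spec (xw.1)%:R (at2 n g')).[xw.2] \in F &
    forall z', z' \in zs' -> (spec (xw.1)%:R (at2 n z')).[xw.2] \notin F]).
  apply: ae_imp wp _ => n /genF[x [w [[m ->] h1 h2 h3 h4]]]; exists (m, w); split => // z' z'zs.
  by apply: h4; rewrite /= map_f.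
have [xw xwP] := ae_choice (0%N, 0) sol.
pose x : nat -> K := fun n => (xw n).1%:R; pose w : nat -> K := fun n => (xw n).2.
have ev (p : {poly {poly (nat -> K)}}) : (spec (ulim x) (ulim2 p)).[ulim w] = ulim (fun n => (spec (x n) (at2 n p)).[w n]).
  rewrite (spec_horner_morph (@ulim K)); congr ulim; apply/funext => n.
  exact/esym/(spec_horner_morph (at_ n)).
exists (ulim x), (ulim w); split => /=.
- by exists (fun n => (xw n).1).
- by rewrite -PE ev; apply/ulim_eq0; apply: ae_imp xwP _ => n [].
- rewrite -qE; have -> : (ulim1 q').[ulim x] = ulim (fun n => (at1 n q').[x n]).
    by rewrite horner_map; congr ulim; apply/funext => n; rewrite -[x n]/(at_ n x) horner_map.
  apply/eqP => /ulim_eq0 h; have [n [[_ /eqP h1 _ _] h2]] := ae_ex (ae_and xwP h).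
  exact: h1.
- by rewrite -gE ev; apply/upredP; apply: ae_imp xwP _ => n [].
- move=> z; rewrite zsE => /mapP[z' z'zs ->]; rewrite ev; apply/negP => /upredP h.
  by have [n [[_ _ _ /(_ z' z'zs)/negP h1] h2]] := ae_ex (ae_and xwP h).
Qed.

End Transfer.

(** * Linear disjointness *)

Section Disjoint.
Variables (L : fieldType) (M : closedFieldType) (i : {rmorphism L -> M}).
Variables (G : {pred M}) (A : {pred L}) (G_closed : divring_closed G) (A_closed : divring_closed A).
Hypothesis AG : forall l, (i l \in G) = (l \in A).
Hypothesis L_closed : alg_closed L.
Hypothesis L_alg : forall l : L, algebraicOver (sfval (mk_subfield A_closed)) l.
Hypothesis charL : [pchar L] =i pred0.

Notation Af := (subfield_type (mk_subfield A_closed)).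
Notation Gf := (subfield_type (mk_subfield G_closed)).

Lemma field_minimal (k K : fieldType) (f : {rmorphism k -> K}) (u : K) :
  alg_over f u -> exists P, minimal_at f u P.
Proof.
move=> ua; have [d [d0 dP]] := minimal_exists (@fmorph_inj _ _ f) ua.
have [P PP] := dP d^-1 (invr_neq0 d0).
by exists P; rewrite divff // rmorph1 mul1r in PP.
Qed.

(** The roots of a factor are among the roots of [q], which lie in [L]. *)
Lemma split_factor (q : {poly L}) (h : {poly M}) :
  q \is monic -> h \is monic -> h %| map_poly i q -> exists h0, h = map_poly i h0.
Proof.
move=> qm hm; have [rs ->] := alg_closed_split L_closed qm.
have -> : map_poly i (\prod_(r <- rs) ('X - r%:P)) = \prod_(r <- map i rs) ('X - r%:P).
  by rewrite rmorph_prod big_map; apply: eq_bigr => r _; rewrite rmorphB /= map_polyX map_polyC.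
move=> /dvdp_prod_XsubC[m]; rewrite eqp_monic ?monic_prod_XsubC // => /eqP ->.
exists (\prod_(r <- mask m rs) ('X - r%:P)).
rewrite -map_mask big_map rmorph_prod; apply: eq_bigr => r _.
by rewrite rmorphB /= map_polyX map_polyC.
Qed.

(** Finitely many elements of [L] are combinations over [A] of powers of one
    element, and these powers stay independent over [G]: the coefficients of
    the minimal polynomial over [G] are symmetric functions of elements of
    [L], so they lie in [A]. *)
Lemma disjoint_powers (ls : seq L) : exists n (th : L),
  (forall l, l \in ls -> exists a : 'I_n -> Af, l = \sum_t sfval _ (a t) * th ^+ t) /\
  (forall g : 'I_n -> M, (forall t, g t \in G) -> \sum_t g t * i th ^+ t = 0 -> forall t, g t = 0).
Proof.
have [|th [tha _ [e [e0 eus]]]] := primitive_element (@fmorph_inj _ _ (sfval (mk_subfield A_closed))) charL (us := ls).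
  by move=> l _; have [p p0 /rootP pl] := L_alg l; exists p.
have [Pi Pimin] := field_minimal tha; have [Pim Pith Pile] := Pimin.
have sPi := minimal_size Pimin.
exists (size Pi).-1, th; split=> [l lls|g gG g0 t].
  have [Q QE] := eus l lls.
  have [h [sh hE]] := adjoin_reduce (e^-1 *: Q) (monic_neq0 Pim) Pith.
  exists (fun t => h`_t).
  have -> : l = (map_poly (sfval (mk_subfield A_closed)) (e^-1 *: Q)).[th].
    by rewrite map_polyZ hornerZ -QE mulrA -rmorphM mulVf // rmorph1 mul1r.
  rewrite hE (horner_coef_wide _ (_ : (_ <= (size Pi).-1)%N)); last first.
    by rewrite size_map_poly -ltnS (ltn_predK sPi).
  by apply: eq_bigr => t _; rewrite coef_map.
have [PG PGE] : exists PG : {poly Gf}, map_poly i (map_poly (sfval (mk_subfield A_closed)) Pi) = map_poly (sfval _) PG.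
  by apply: poly_lift => l; rewrite !coef_map AG; exact: sfval_in.
have PGm : PG \is monic.
  by rewrite -(map_monic (sfval (mk_subfield G_closed))) -PGE !map_monic.
have PGth : ann (sfval (mk_subfield G_closed)) (i th) PG.
  by rewrite /ann -PGE horner_map [X in i X]Pith rmorph0.
have [h hmin] := field_minimal (ex_intro2 _ _ PG (monic_neq0 PGm) PGth : alg_over _ _).
have [hm hth hle] := hmin.
have [s sE] := minimal_dvd hmin PGth.
have [h0 h0E] : exists h0, map_poly (sfval (mk_subfield G_closed)) h = map_poly i h0.
  apply: (split_factor (monic_map (sfval (mk_subfield A_closed)) Pim)); first exact: monic_map.
  by rewrite PGE sE rmorphM dvdp_mulIr.
have [h1 h1E] : exists h1 : {poly Af}, h0 = map_poly (sfval _) h1.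
  by apply: poly_lift => l; rewrite -AG -coef_map -h0E coef_map; exact: sfval_in.
have h1th : ann (sfval (mk_subfield A_closed)) th h1.
  apply: (fmorph_inj i); rewrite rmorph0 -horner_map -h1E -h0E; exact: hth.
have sh : size h1 = size h by rewrite -(size_map_poly (sfval (mk_subfield A_closed))) -h1E -(size_map_poly i) -h0E size_map_poly.
have h10 : h1 != 0 by rewrite -size_poly_gt0 sh size_poly_gt0 monic_neq0.
have Pih : (size Pi <= size h)%N by rewrite -sh; exact: Pile.
have [g' g'E] := choice (fun t => sfvalP G_closed (gG t)).
pose q : {poly Gf} := \poly_(s < (size Pi).-1) (if insub s is Some t then g' t else 0).
have q0 : q = 0.
  apply: contraTeq isT => q0; have := hle q q0; rewrite leqNgt.
  rewrite (leq_ltn_trans (size_poly _ _)) ?(leq_trans _ Pih) ?(ltn_predK sPi) //.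
  apply; rewrite /ann (horner_coef_wide _ (_ : (_ <= (size Pi).-1)%N)); last first.
    by rewrite size_map_poly size_poly.
  rewrite -[RHS]g0; apply: eq_bigr => u _; rewrite coef_map coef_poly ltn_ord valK.
  by congr (_ * _); exact: g'E.
have /polyP/(_ t) := q0; rewrite coef_poly ltn_ord valK coef0 => g'0.
by rewrite -g'E g'0 rmorph0.
Qed.

(** Linear disjointness.  Expanding the entries in the powers provided by
    [disjoint_powers] turns the system over [L], solvable in [G], into a system
    over [A] that is solvable in [G], hence in [A]. *)
Lemma disjoint_relation (I J : finType) (E : I -> J -> L) (v : I -> M) :
  (exists u, v u != 0) -> (forall u, v u \in G) -> (forall j, \sum_u v u * i (E u j) = 0) ->
  exists a : I -> L, [/\ exists u, a u != 0, forall u, a u \in A & forall j, \sum_u a u * E u j = 0].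
Proof.
move=> v0 vG vE.
have [n [th [span free]]] := disjoint_powers [seq E u.1 u.2 | u <- enum {: I * J}].
have memE (u : I * J) : E u.1 u.2 \in [seq E u.1 u.2 | u <- enum {: I * J}].
  by apply/mapP; exists u => //; rewrite mem_enum.
have [a aE] := choice (fun u => span _ (memE u)).
have [v' v'E] := choice (fun u => sfvalP G_closed (vG u)).
have iA (x : Af) : i (sfval _ x) \in G by rewrite AG; exact: sfval_in.
have [ai aiE] := choice (fun x => sfvalP G_closed (iA x)).
have ai_zmod : zmod_morphism ai.
  by move=> x y; apply: (fmorph_inj (sfval (mk_subfield G_closed))); rewrite rmorphB !aiE !rmorphB.
have ai_monoid : monoid_morphism ai.
  split=> [|x y]; apply: (fmorph_inj (sfval (mk_subfield G_closed))).
    by rewrite aiE !rmorph1.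
  by rewrite rmorphM !aiE !rmorphM.
pose aiz := GRing.isZmodMorphism.Build Af Gf ai ai_zmod.
pose aim := GRing.isMonoidMorphism.Build Af Gf ai ai_monoid.
pose aiR : {rmorphism Af -> Gf} := HB.pack ai aiz aim.
have [|jt|x [[u0 xu0] xE]] := @dependent_descent _ _ aiR I (J * 'I_n)%type (fun u jt => a (u, jt.1) jt.2) v'.
- by have [u u0] := v0; exists u; rewrite -(fmorph_eq0 (sfval (mk_subfield G_closed))) v'E.
- apply: (fmorph_inj (sfval (mk_subfield G_closed))); rewrite rmorph0 rmorph_sum.
  pose g t := \sum_u v u * i (sfval _ (a (u, jt.1) t)).
  have gG t : g t \in G.
    apply: (@rpred_sum _ (subfield_pred (mk_subfield G_closed))) => u _.
    apply: (@rpredM _ (subfield_pred (mk_subfield G_closed))); first exact: vG.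
    by rewrite -aiE; exact: sfval_in.
  have g0 : \sum_t g t * i th ^+ t = 0.
    rewrite -[RHS](vE jt.1); under eq_bigr => t _ do rewrite mulr_suml.
    rewrite exchange_big; apply: eq_bigr => u _.
    rewrite (aE (u, jt.1)) rmorph_sum mulr_sumr; apply: eq_bigr => t _.
    by rewrite rmorphM rmorphXn mulrA.
  rewrite -[RHS](free g gG g0 jt.2); apply: eq_bigr => u _.
  by rewrite rmorphM v'E; congr (_ * _); exact: aiE.
exists (fun u => sfval _ (x u)); split=> [|u|j]; [|exact: sfval_in|].
  by exists u0; rewrite fmorph_eq0.
transitivity (\sum_(t < n) sfval (mk_subfield A_closed) (\sum_u x u * a (u, j) t) * th ^+ t).
  under [RHS]eq_bigr => t _ do rewrite rmorph_sum mulr_suml.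
  rewrite exchange_big; apply: eq_bigr => u _; rewrite (aE (u, j)) mulr_sumr.
  by apply: eq_bigr => t _; rewrite rmorphM mulrA.
by rewrite big1 // => t _; rewrite (xE (j, t)) rmorph0 mul0r.
Qed.

(** The same expansion, applied to the coefficients [l u], splits a relation over
    [L] into relations over [A]. *)
Lemma disjoint_independent (I : finType) (g : I -> M) :
  (forall u, g u \in G) ->
  (forall a : I -> L, (forall u, a u \in A) -> \sum_u i (a u) * g u = 0 -> forall u, a u = 0) ->
  forall l : I -> L, \sum_u i (l u) * g u = 0 -> forall u, l u = 0.
Proof.
move=> gG indep l l0.
have [n [th [span free]]] := disjoint_powers [seq l u | u <- enum I].
have meml u : l u \in [seq l u | u <- enum I] by rewrite map_f // mem_enum.
have [a aE] := choice (fun u => span _ (meml u)).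
pose h t := \sum_u i (sfval _ (a u t)) * g u.
have hG t : h t \in G.
  apply: (@rpred_sum _ (subfield_pred (mk_subfield G_closed))) => u _.
  apply: (@rpredM _ (subfield_pred (mk_subfield G_closed))); last exact: gG.
  by have := sfval_in (a u t); rewrite -AG.
have h0 : \sum_t h t * i th ^+ t = 0.
  rewrite -[RHS]l0; under eq_bigr => t _ do rewrite mulr_suml.
  rewrite exchange_big; apply: eq_bigr => u _; rewrite aE rmorph_sum mulr_suml.
  by apply: eq_bigr => t _; rewrite rmorphM rmorphXn mulrAC.
move=> u; rewrite aE big1 // => t _.
have := indep (fun u => sfval _ (a u t)) (fun u => sfval_in (a u t)) (free h hG h0 t) u.
by move=> /= ->; rewrite mul0r.
Qed.

End Disjoint.

Lemma bound2 (R : nzRingType) (T : eqType) (s : seq T) (Z : T -> {poly {poly R}}) :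
  exists B, forall o, o \in s -> (size (Z o) <= B)%N /\ forall a, (size ((Z o)`_a)%R <= B)%N.
Proof.
elim: s => [|o s [B BP]]; first by exists 0%N.
pose c := (\max_(a < size (Z o)) size ((Z o)`_a)%R)%N.
exists (B + (size (Z o) + c))%N => o'; rewrite inE => /orP[/eqP->|/BP[h1 h2]].
  split=> [|a]; first by rewrite addnCA leq_addr.
  have [al|al] := ltnP a (size (Z o)); last by rewrite nth_default ?size_poly0.
  rewrite addnA (leq_trans _ (leq_addl _ _)) //.
  exact: (leq_bigmax (F := fun a : 'I_(size (Z o)) => size ((Z o)`_a)%R) (Ordinal al)).
by split=> [|a]; rewrite (leq_trans _ (leq_addr _ _)).
Qed.

(** Comparing coefficients turns a polynomial relation into a linear system over
    the field of the given polynomials, to which descent of solutions applies. *)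
Lemma relation_system (R : nzRingType) (O : finType) N (Z : O -> {poly {poly R}}) :
  exists (J : finType) (E : O * 'I_N.+1 -> J -> R),
    forall (S : comNzRingType) (h : {rmorphism R -> S}) (qs : O -> {poly S}),
    (forall o, (size (qs o) <= N.+1)%N) ->
    (\sum_o (qs o)%:P * map_poly (map_poly h) (Z o) = 0 <->
     forall j, \sum_(u : O * 'I_N.+1) (qs u.1)`_u.2 * h (E u j) = 0).
Proof.
have [B BP] := bound2 (enum O) Z.
pose T := (N.+1 + B)%N.
exists ('I_T * 'I_T)%type, (fun (u : O * 'I_N.+1) (j : 'I_T * 'I_T) => ('X^(u.2) * (Z u.1)`_(j.1))`_(j.2)) => S h qs sq.
have cE a b : (\sum_o (qs o)%:P * map_poly (map_poly h) (Z o))`_a`_b =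
    \sum_(u : O * 'I_N.+1) (qs u.1)`_u.2 * h ('X^(u.2) * (Z u.1)`_a)`_b.
  rewrite !coef_sum -(pair_bigA _ (fun o (l : 'I_N.+1) => (qs o)`_l * h ('X^l * (Z o)`_a)`_b)).
  apply: eq_bigr => o _; rewrite coefCM coef_map /=.
  have {1}-> : qs o = \sum_(l < N.+1) (qs o)`_l *: 'X^l.
    by rewrite -poly_def; apply/polyP => l; rewrite coef_poly; case: ltnP => // /(leq_trans (sq o)) /(nth_default 0).
  rewrite mulr_suml coef_sum; apply: eq_bigr => l _.
  rewrite -scalerAl coefZ -(coef_map h) rmorphM /= map_polyXn; congr (_ * _).
split=> [s0 [a b]|s0]; first by rewrite -cE s0 !coef0.
apply/polyP => a; apply/polyP => b; rewrite !coef0.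
have [aT|aT] := ltnP a T; last first.
  rewrite coef_sum big1 ?coef0 // => o _; rewrite coefCM coef_map (nth_default _ (_ : (size (Z o) <= a)%N)).
    by rewrite raddf0 mulr0.
  have [h1 _] := BP o (mem_enum _ _); apply: leq_trans h1 (leq_trans (leq_addl _ _) aT).
have [bT|bT] := ltnP b T; first by rewrite cE; exact: (s0 (Ordinal aT, Ordinal bT)).
rewrite nth_default // (leq_trans _ bT) // coef_sum (leq_trans (size_sum _ _ _)) //.
apply/bigmax_leqP => o _; rewrite coefCM coef_map (leq_trans (size_polyMleq _ _)) //=.
have [_ /(_ a) h2] := BP o (mem_enum _ _).
have h3 := leq_trans (size_poly _ _ : (size (map_poly h (Z o)`_a) <= _)%N) h2.
by rewrite (leq_trans (leq_pred _)) // leq_add.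
Qed.

Lemma solution_poly (R : nzRingType) (O : finType) N (v : O * 'I_N.+1 -> R) :
  exists rs : O -> {poly R}, forall o, (size (rs o) <= N.+1)%N /\ forall l : 'I_N.+1, (rs o)`_l = v (o, l).
Proof.
exists (fun o => \poly_(l < N.+1) v (o, inord l)) => o; split; first exact: size_poly.
by move=> l; rewrite coef_poly ltn_ord inord_val.
Qed.

Section Relations.
Variables (L : fieldType) (M : closedFieldType) (i : {rmorphism L -> M}).
Variables (O : finType) (N : nat) (Z : O -> {poly {poly L}}).

Let sum_pairs (R : comNzRingType) (w : O * 'I_N.+1 -> R) (rs : O -> {poly R}) (c : O * 'I_N.+1 -> R) :
  (forall o, forall l : 'I_N.+1, (rs o)`_l = w (o, l)) ->
  \sum_(u : O * 'I_N.+1) (rs u.1)`_u.2 * c u = \sum_u w u * c u.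
Proof. by move=> h; apply: eq_bigr => -[k l] _; rewrite /= h. Qed.

Lemma relation_descent (qs : O -> {poly M}) :
  (forall o, (size (qs o) <= N.+1)%N) -> (exists o, qs o != 0) ->
  \sum_o (qs o)%:P * map_poly (map_poly i) (Z o) = 0 ->
  exists rs : O -> {poly L}, [/\ forall o, (size (rs o) <= N.+1)%N, exists o, rs o != 0 &
    \sum_o (rs o)%:P * Z o = 0].
Proof.
move=> sq [k0 q0] rel; have [J [E EP]] := relation_system N Z.
have /(EP _ _ _ sq) sys := rel.
have [|v [[[k1 l1] v0] vE]] := dependent_descent (f := i) (A := E) (v' := fun u : O * 'I_N.+1 => (qs u.1)`_u.2) _ sys.
  have lq : ((size (qs k0)).-1 < N.+1)%N by rewrite prednK ?size_poly_gt0 // ; exact: sq.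
  by exists (k0, Ordinal lq); rewrite /= -lead_coefE lead_coef_eq0.
have [rs rsP] := solution_poly v; exists rs; split=> [k||].
- by have [] := rsP k.
- exists k1; apply: contraNneq v0 => r0; have [_ /(_ l1) <-] := rsP k1.
  by rewrite r0 coef0.
- have := EP _ (idfun : {rmorphism L -> L}) rs (fun o => (rsP o).1).
  rewrite (eq_bigr (fun o => (rs o)%:P * Z o)) => [->|o _]; last first.
    by congr (_ * _); apply/polyP => a; apply/polyP => b; rewrite !coef_map.
  move=> j; rewrite -[RHS](vE j); apply: sum_pairs => o; exact: (rsP o).2.
Qed.

Variables (G : {pred M}) (A : {pred L}) (G_closed : divring_closed G) (A_closed : divring_closed A).
Hypothesis AG : forall l, (i l \in G) = (l \in A).
Hypothesis L_closed : alg_closed L.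
Hypothesis L_alg : forall l : L, algebraicOver (sfval (mk_subfield A_closed)) l.
Hypothesis charL : [pchar L] =i pred0.

Lemma relation_disjoint (qs : O -> {poly M}) :
  (forall o, (size (qs o) <= N.+1)%N /\ coefs_in G (qs o)) -> (exists o, qs o != 0) ->
  \sum_o (qs o)%:P * map_poly (map_poly i) (Z o) = 0 ->
  exists rs : O -> {poly L}, [/\ forall o, (size (rs o) <= N.+1)%N /\ coefs_in A (rs o), exists o, rs o != 0 &
    \sum_o (rs o)%:P * Z o = 0].
Proof.
move=> sq [k0 q0] rel; have [J [E EP]] := relation_system N Z.
have /(EP _ _ _ (fun o => (sq o).1)) sys := rel.
have [|u|v [[[k1 l1] v0] vA vE]] := disjoint_relation G_closed AG L_closed L_alg charL (E := E) (v := fun u : O * 'I_N.+1 => (qs u.1)`_u.2) _ _ sys.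
- have lq : ((size (qs k0)).-1 < N.+1)%N by rewrite prednK ?size_poly_gt0 //; case: (sq k0).
  by exists (k0, Ordinal lq); rewrite /= -lead_coefE lead_coef_eq0.
- exact: (sq u.1).2.
have [rs rsP] := solution_poly v; exists rs; split=> [k||].
- have [h1 h2] := rsP k; split => // l; have [lN|lN] := ltnP l N.+1.
    by rewrite (h2 (Ordinal lN)).
  by rewrite nth_default ?(leq_trans h1) // (natural_closed A_closed 0).
- exists k1; apply: contraNneq v0 => r0; have [_ /(_ l1) <-] := rsP k1.
  by rewrite r0 coef0.
- have := EP _ (idfun : {rmorphism L -> L}) rs (fun o => (rsP o).1).
  rewrite (eq_bigr (fun o => (rs o)%:P * Z o)) => [->|o _]; last first.
    by congr (_ * _); apply/polyP => a; apply/polyP => b; rewrite !coef_map.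
  move=> j; rewrite -[RHS](vE j); apply: sum_pairs => o; exact: (rsP o).2.
Qed.

End Relations.

(** * Specializing finitely many elements *)

Lemma horner_in (K : fieldType) (G : {pred K}) (G_closed : divring_closed G) (q : {poly K}) z :
  coefs_in G q -> z \in G -> q.[z] \in G.
Proof.
move=> qG zG; have [q' ->] := poly_lift G_closed qG; have [z' <-] := sfvalP G_closed zG.
by rewrite horner_map; exact: sfval_in.
Qed.

Lemma horner_map_wide (R S : nzRingType) (f : {rmorphism R -> S}) (q : {poly R}) z N :
  (size q <= N)%N -> (map_poly f q).[z] = \sum_(s < N) f q`_s * z ^+ s.
Proof.
move=> sq; rewrite (horner_coef_wide _ (_ : (_ <= N)%N)).
  by apply: eq_bigr => s _; rewrite coef_map.
by rewrite (leq_trans (size_poly _ _)).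
Qed.

Lemma map_horner_CM (R : nzRingType) (S : comNzRingType) (f : {rmorphism R -> S}) c (q : {poly R}) z :
  (map_poly f (c%:P * q)).[z] = f c * (map_poly f q).[z].
Proof. by rewrite rmorphM hornerM /= map_polyC hornerC. Qed.

Lemma ann_rmodp (R : idomainType) (M : fieldType) (rho : {rmorphism R -> M}) (P q : {poly R}) z :
  P \is monic -> ann rho z P ->
  (map_poly rho (Pdiv.Ring.rmodp q P)).[z] = (map_poly rho q).[z].
Proof.
move=> Pm Pz; rewrite [in RHS](Pdiv.RingMonic.rdivp_eq Pm q) rmorphD rmorphM hornerD hornerM.
by rewrite [X in _ * X]Pz mulr0 add0r.
Qed.

Lemma ann_cons (R : idomainType) (M : fieldType) (rho : {rmorphism R -> M}) m q c :
  ann rho m (q * 'X + c%:P) -> (map_poly rho q).[m] * m + rho c = 0.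
Proof. by rewrite /ann rmorphD rmorphM /= map_polyX map_polyC !hornerE. Qed.

(** Division by a monic polynomial commutes with ring morphisms. *)
Lemma gen_pow_image (R : idomainType) (S : idomainType) (h : {rmorphism R -> S}) (P g : {poly {poly R}}) j :
  P \is monic ->
  Pdiv.Ring.rmodp (map_poly (map_poly h) g ^+ j) (map_poly (map_poly h) P) =
  map_poly (map_poly h) (Pdiv.Ring.rmodp (g ^+ j) P).
Proof.
move=> Pm; have Pm' : map_poly (map_poly h) P \is monic by exact: monic_map.
rewrite -rmorphXn {1}(Pdiv.RingMonic.rdivp_eq Pm (g ^+ j)) rmorphD rmorphM /=.
apply: Pdiv.RingMonic.rmodp_addl_mul_small => //.
rewrite (leq_ltn_trans (size_poly _ _)) // size_map_poly_id0; last first.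
  by rewrite (monicP Pm) rmorph1 oner_neq0.
by rewrite Pdiv.Ring.ltn_rmodpN0 // monic_neq0.
Qed.

(** An element [u] with [tau q = tau b * u] is a fraction [q / b] over [R]; its
    specialization is the value of this fraction under [sigma], independent of
    the fraction as every relation killed by [tau] is killed by [sigma]. *)
Section Transport.
Variables (R : comNzRingType) (M : fieldType) (tau sigma : {rmorphism R -> M}).
Hypothesis kill : forall h, tau h = 0 -> sigma h = 0.

Lemma transport_fraction b q b' q' u :
  sigma b != 0 -> sigma b' != 0 -> tau q = tau b * u -> tau q' = tau b' * u ->
  sigma q / sigma b = sigma q' / sigma b'.
Proof.
move=> n n' qE q'E; have : sigma (b' * q - b * q') = 0.
  by apply: kill; rewrite rmorphB !rmorphM qE q'E; ring.
rewrite rmorphB !rmorphM => /eqP; rewrite subr_eq0 => /eqP H.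
by apply/eqP; rewrite eqr_div // mulrC H mulrC.
Qed.

Lemma transport_sub b q b' q' b2 q2 u u' :
  sigma b != 0 -> sigma b' != 0 -> sigma b2 != 0 ->
  tau q = tau b * u -> tau q' = tau b' * u' -> tau q2 = tau b2 * (u - u') ->
  sigma q2 / sigma b2 = sigma q / sigma b - sigma q' / sigma b'.
Proof.
move=> n n' n2 qE q'E q2E.
rewrite (@transport_fraction b2 q2 (b * b') (q * b' - q' * b) (u - u')) //.
- by rewrite rmorphB !rmorphM; field; rewrite n n'.
- by rewrite rmorphM mulf_neq0.
- by rewrite rmorphB !rmorphM qE q'E; ring.
Qed.

Lemma transport_mul b q b' q' b2 q2 u u' :
  sigma b != 0 -> sigma b' != 0 -> sigma b2 != 0 ->
  tau q = tau b * u -> tau q' = tau b' * u' -> tau q2 = tau b2 * (u * u') ->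
  sigma q2 / sigma b2 = sigma q / sigma b * (sigma q' / sigma b').
Proof.
move=> n n' n2 qE q'E q2E.
rewrite (@transport_fraction b2 q2 (b * b') (q * q') (u * u')) //.
- by rewrite !rmorphM; field; rewrite n n'.
- by rewrite rmorphM mulf_neq0.
- by rewrite !rmorphM qE q'E; ring.
Qed.

End Transport.

Section Finite.
Variables (M : closedFieldType) (G : {pred M}) (G_closed : divring_closed G) (pt : M -> Prop).
Hypotheses (charM : [pchar M] =i pred0) (genG : generic G pt) (ptG : forall x, pt x -> x \in G).
Variables (L : fieldType) (i i' : {rmorphism L -> M}) (A : {pred L}) (A_closed : divring_closed A).
Hypotheses (AG : forall l, (i l \in G) = (l \in A)) (AG' : forall l, (i' l \in G) = (l \in A)).
Hypothesis L_closed : alg_closed L.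
Hypothesis L_alg : forall l : L, algebraicOver (sfval (mk_subfield A_closed)) l.
Variable (x : M).
Hypotheses (xG : x \in G) (x_out : forall l, i l != x).

Notation Af := (subfield_type (mk_subfield A_closed)).
Notation val := (sfval (mk_subfield A_closed)).

Let charL : [pchar L] =i pred0.
Proof. by move=> p; rewrite -(fmorph_pchar i) charM. Qed.

(** The element [x] is transcendental over the algebraically closed field [L],
    so evaluation at [x] identifies polynomials with elements of [M]. *)
Definition evalL : {rmorphism {poly L} -> M} := horner_eval x \o map_poly i.
Definition evalA : {rmorphism {poly Af} -> M} := evalL \o map_poly val.

Arguments evalL : simpl never.
Arguments evalA : simpl never.

Lemma evalLC l : evalL l%:P = i l.
Proof. by rewrite /evalL /= /horner_eval map_polyC hornerC. Qed.

Lemma evalLX : evalL 'X = x.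
Proof. by rewrite /evalL /= /horner_eval map_polyX hornerX. Qed.

Lemma evalAC a : evalA a%:P = i (val a).
Proof. by rewrite -[LHS]/(evalL (map_poly val a%:P)) map_polyC evalLC. Qed.

Lemma evalAX : evalA 'X = x.
Proof. by rewrite -[LHS]/(evalL (map_poly val 'X)) map_polyX evalLX. Qed.

Lemma evalL_inj : injective evalL.
Proof.
have ker q : evalL q = 0 -> q = 0.
  move=> q0; apply: contraTeq isT => qn0.
  have lq : lead_coef q != 0 by rewrite lead_coef_eq0.
  have qm : (lead_coef q)^-1 *: q \is monic by rewrite monicE lead_coefZ mulVf.
  have [rs rsE] := alg_closed_split L_closed qm.
  have : root (map_poly i (\prod_(r <- rs) ('X - r%:P))) x.
    by rewrite -rsE map_polyZ /root hornerZ [X in _ * X]q0 mulr0.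
  have -> : map_poly i (\prod_(r <- rs) ('X - r%:P)) = \prod_(r <- map i rs) ('X - r%:P).
    by rewrite rmorph_prod big_map; apply: eq_bigr => r _; rewrite rmorphB /= map_polyX map_polyC.
  by rewrite root_prod_XsubC => /mapP[r _ xE]; have := x_out r; rewrite xE eqxx.
move=> p q /eqP; rewrite -subr_eq0 -rmorphB => /eqP/ker/eqP.
by rewrite subr_eq0 => /eqP.
Qed.

Lemma evalA_inj : injective evalA.
Proof. by move=> p q /evalL_inj; apply: map_poly_inj. Qed.

Lemma evalL_eq0 q : (evalL q == 0) = (q == 0).
Proof. by rewrite -(inj_eq evalL_inj) rmorph0. Qed.

Lemma evalA_eq0 q : (evalA q == 0) = (q == 0).
Proof. by rewrite -(inj_eq evalA_inj) rmorph0. Qed.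

Lemma evalL_in q : coefs_in A q -> evalL q \in G.
Proof.
by move=> qA; apply: horner_in => // j; rewrite coef_map AG.
Qed.

Lemma evalA_in q : evalA q \in G.
Proof. by apply: evalL_in => j; rewrite coef_map; exact: sfval_in. Qed.

Lemma alg_evalL m : alg_over evalA m -> alg_over evalL m.
Proof.
move=> [p p0 pm]; exists (map_poly (map_poly val) p).
  by rewrite -size_poly_gt0 size_map_inj_poly ?raddf0 ?size_poly_gt0 //; exact: map_poly_inj.
by rewrite /ann -map_poly_comp.
Qed.

Lemma alg_base l : alg_over evalA (i l).
Proof.
have [p p0 /rootP pl] := L_alg l; exists (map_poly polyC p).
  by rewrite map_polyC_eq0.
rewrite /ann; have -> : map_poly evalA (map_poly polyC p) = map_poly i (map_poly val p).
  by apply/polyP => j; rewrite !coef_map; exact: evalAC.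
by rewrite horner_map pl rmorph0.
Qed.

Lemma alg_gen : alg_over evalA x.
Proof.
by rewrite -evalAX; exact: alg_over_id evalA_inj _.
Qed.

Lemma alg_eval q : alg_over evalA (evalL q).
Proof.
elim/poly_ind: q => [|q c IHq]; first by rewrite rmorph0; exact: (alg_over0 evalA_inj).
rewrite rmorphD rmorphM; have -> : evalL q * evalL 'X + evalL c%:P = evalL q * x - (0 - i c).
  by rewrite sub0r opprK evalLC evalLX.
apply: (alg_over_sub evalA_inj); first by apply: (alg_over_mul evalA_inj) => //; exact: alg_gen.
by apply: (alg_over_sub evalA_inj); [exact: (alg_over0 evalA_inj)|exact: alg_base].
Qed.

(** A nonzero polynomial over [L] divides one over [A]: the constant term of an
    equation that it satisfies. *)
Lemma norm_multiple e : e != 0 -> exists e' (a : {poly Af}), a != 0 /\ e * e' = map_poly val a.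
Proof.
move=> e0; have ee0 : evalL e != 0 by rewrite -(rmorph0 evalL) (inj_eq evalL_inj).
have [p p0 pe] := alg_eval e; elim/poly_ind: p p0 pe => [|q c IHq] p0 pe; first by rewrite eqxx in p0.
have [c0|c0] := eqVneq c 0.
  apply: IHq; first by apply: contraNneq p0 => ->; rewrite c0 polyC0 mul0r addr0.
  move/ann_cons/eqP: pe; rewrite c0 rmorph0 addr0.
  by rewrite mulf_eq0 (negPf ee0) orbF => /eqP.
exists (- (map_poly (map_poly val) q).[e]), c; split => //.
apply: evalL_inj; rewrite rmorphM rmorphN -horner_map -map_poly_comp.
move/ann_cons/eqP: pe; rewrite addr_eq0 mulrC mulrN => /eqP ->; rewrite opprK.
by [].
Qed.

Section Powers.
Variables (y w : M) (f : {poly {poly Af}}) (P g : {poly {poly L}}).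
Hypotheses (yG : y \in G) (fmin : minimal_at evalA y f) (Pmin : minimal_at evalL w P).
Hypothesis gE : (map_poly evalL g).[w] = y.

Let V j := Pdiv.Ring.rmodp (g ^+ j) P.
Notation d := (size f).-1.

Lemma eval_power j : (map_poly evalL (V j)).[w] = y ^+ j.
Proof.
have [Pm Pw _] := Pmin.
by rewrite (ann_rmodp _ Pm Pw) rmorphXn horner_exp gE.
Qed.

(** The powers of [y] below its degree over [A(x)], multiplied by powers of [x],
    are elements of [G] independent over [A], hence independent over [L] by
    linear disjointness. *)
Lemma powers_independent (rs : 'I_d -> {poly L}) :
  \sum_(j < d) (rs j)%:P * V j = 0 -> forall j, rs j = 0.
Proof.
move=> rel; have [fm fy fle] := fmin; have sf := minimal_size fmin.
have rel' : \sum_(j < d) evalL (rs j) * y ^+ j = 0.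
  have := congr1 (fun q => (map_poly evalL q).[w]) rel.
  rewrite rmorph0 horner0 rmorph_sum horner_sum => h; rewrite -[RHS]h; apply: eq_bigr => j _.
  by rewrite rmorphM /= map_polyC hornerM hornerC eval_power.
pose N := (\sum_(j < d) size (rs j))%N.
have sN j : (size (rs j) <= N)%N by rewrite /N (bigD1 j) //= leq_addr.
pose I : finType := ('I_d * 'I_N)%type.
pose gg (u : I) := x ^+ u.2 * y ^+ u.1.
have powG z n : z \in G -> z ^+ n \in G.
  by move=> zG; apply: (@rpredX _ (subfield_pred (mk_subfield G_closed))).
have ggG u : gg u \in G by apply: (@rpredM _ (subfield_pred (mk_subfield G_closed))); exact: powG.
have indep (a : I -> L) : (forall u, a u \in A) -> \sum_u i (a u) * gg u = 0 -> forall u, a u = 0.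
  move=> aA a0; have [a' a'E] := choice (fun u => sfvalP A_closed (aA u)).
  pose p : {poly {poly Af}} := \poly_(j < d) (if insub j is Some j then \poly_(s < N) (if insub s is Some s then a' (j, s) else 0) else 0).
  have pE (j : 'I_d) (s : 'I_N) : p`_j`_s = a' (j, s).
    by rewrite coef_poly ltn_ord valK coef_poly ltn_ord valK.
  have sp j : (size (p`_j)%R <= N)%N.
    rewrite coef_poly; case: ifP => _; last by rewrite size_poly0.
    by case: (insub j) => [j'|]; [exact: size_poly|rewrite size_poly0].
  have p0 : p = 0.
    apply: contraTeq isT => p0; have := fle p p0; rewrite leqNgt.
    rewrite (leq_ltn_trans (size_poly _ _)) ?(ltn_predK sf) //; apply.
    rewrite /ann (horner_coef_wide _ (_ : (_ <= d)%N)); last first.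
      by rewrite (leq_trans (size_poly _ _)) // size_poly.
    transitivity (\sum_(j < d) \sum_(s < N) i (a (j, s)) * gg (j, s)); last first.
      by rewrite -[RHS]a0 pair_bigA; apply: eq_bigr; case.
    apply: eq_bigr => j _; rewrite coef_map.
    transitivity ((\sum_(s < N) i (val p`_j`_s) * x ^+ s) * y ^+ j).
      congr (_ * _); rewrite -[LHS]/((map_poly i (map_poly val p`_j)).[x]).
      rewrite (horner_map_wide _ _ (_ : (_ <= N)%N)); last by rewrite size_map_poly.
      by apply: eq_bigr => s _; congr (i _ * _); rewrite coef_map.
    by rewrite mulr_suml; apply: eq_bigr => s _; rewrite pE a'E mulrA.
  by move=> [j s]; rewrite -a'E -pE p0 !coef0 rmorph0.
have := disjoint_independent G_closed AG L_closed L_alg charL ggG indep (l := fun u => (rs u.1)`_u.2).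
move=> all0 j; apply/polyP => s; rewrite coef0.
have [sNs|sNs] := ltnP s N; last by rewrite nth_default // (leq_trans (sN j)).
apply: (all0 _ (j, Ordinal sNs)).
transitivity (\sum_(j < d) \sum_(s < N) i (rs j)`_s * gg (j, s)).
  by rewrite pair_bigA; apply: eq_bigr; case.
rewrite -[RHS]rel'.
apply: eq_bigr => j' _.
rewrite -[evalL _]/((map_poly i (rs j')).[x]) (horner_map_wide _ _ (sN j')).
by rewrite mulr_suml; apply: eq_bigr => s' _; rewrite mulrA.
Qed.

(** The data over [L] are moved to [M] by the second embedding [i'], and relations
    over [G] between them come back to relations over [A] between the original
    data, by linear disjointness for [i'].  Evaluated at [x] and [w], such a
    relation would put [v] into [G]. *)
Lemma well_posed_image B (zs : seq {poly {poly L}}) (zeta : {poly Af}) :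
  (forall z, z \in zs -> (size z < size P)%N /\ exists b : {poly Af}, exists v,
     [/\ b != 0, v \notin G & (map_poly evalL z).[w] = evalA b * v]) ->
  (forall j, (j < d)%N -> forall l, (size ((V j)`_l)%R <= B.+1)%N) ->
  (forall z, z \in zs -> forall l, (size (z`_l)%R <= B.+1)%N) ->
  zeta != 0 ->
  well_posed G (Problem d B (map_poly (map_poly i') P) (map_poly (map_poly i') (map_poly (map_poly val) f))
    (map_poly (map_poly i') g) [seq map_poly (map_poly i') z | z <- zs] (map_poly i' (map_poly val zeta))).
Proof.
move=> zsP sV sz zeta0; have [fm fy fle] := fmin; have sf := minimal_size fmin.
have [Pm Pw Ple] := Pmin; have Pirr := minimal_irreducible Pmin.
have i'2 : injective (map_poly i') by exact: map_poly_inj.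
have size2 (q : {poly {poly L}}) : size (map_poly (map_poly i') q) = size q.
  by rewrite size_map_inj_poly ?raddf0.
have sizeV q l : size ((map_poly (map_poly i') q)`_l) = size (q`_l).
  by rewrite coef_map size_map_poly.
set D := Problem _ _ _ _ _ _ _.
have VE j : gen_pow D j = map_poly (map_poly i') (V j) by exact: gen_pow_image.
split.
- split; first by rewrite /= -ltnS (ltn_predK sf).
    change (map_poly i' (map_poly val zeta) != 0).
    by rewrite -size_poly_gt0 !size_map_poly size_poly_gt0.
  by move=> j jd l; rewrite VE sizeV; exact: sV.
- by split; [exact: monic_map|exact: irreducible_extension].
- split.
  + by do 2!apply: monic_map.
  + rewrite -[LHS]/(size (map_poly (map_poly i') (map_poly (map_poly val) f))) size2 (ltn_predK sf).
    by rewrite size_map_inj_poly ?raddf0 //; exact: map_poly_inj.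
  + by move=> l m; rewrite !coef_map AG'; exact: sfval_in.
  + have [s sE] : exists s, map_poly (map_poly val) f \Po g = s * P.
      apply: (minimal_dvd Pmin).
      rewrite /ann map_comp_poly horner_comp gE -map_poly_comp.
      exact: fy.
    by exists (map_poly (map_poly i') s); rewrite /= -map_comp_poly sE rmorphM.
- move=> ps sps; rewrite /combination => rel j; apply: contrapT => /eqP psj.
  have [|rs [srs [j0 r0] relL]] := relation_descent (i := i') (Z := fun j : 'I_d => V j) sps (ex_intro _ j psj).
    by rewrite -[RHS]rel; apply: eq_bigr => l _; rewrite VE.
  by rewrite (powers_independent relL) eqxx in r0.
- move=> z' /mapP[z zzs ->] {z'}; have [szP [b [v [b0 vG zE]]]] := zsP z zzs.
  split; first by rewrite /= !size2.
    by move=> l; rewrite sizeV; exact: sz.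
  move=> p ps sp pG psG rel; apply: contrapT => /eqP p0.
  pose Z (o : option 'I_d) := if o is Some j then V j else z.
  pose qs (o : option 'I_d) := if o is Some j then - ps j else p.
  have [|||rs [srs [k0 r0] relL]] := relation_disjoint G_closed AG' L_closed L_alg charL (N := (d * B)%N) (Z := Z) (qs := qs).
  + move=> [j|] //=; have [h1 h2] := psG j; rewrite size_polyN; split => // l.
    by rewrite coefN; apply: (@rpredNr _ (subfield_pred (mk_subfield G_closed))); exact: h2.
  + by exists None.
  + rewrite (bigD1 None) //= [X in X + _]rel.
    rewrite (reindex_omap Some id) => [|[j|]] //=.
    rewrite /combination (eq_bigl xpredT) => [|j]; last by rewrite eqxx.
    rewrite -big_split big1 // => j _.
    by rewrite VE /= polyCN mulNr subrr.
  have sumE : (rs None)%:P * z + \sum_(j < d) (rs (Some j))%:P * V j = 0.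
    rewrite -[RHS]relL (bigD1 None) //=; congr (_ + _).
    rewrite [RHS](reindex_omap Some id) => [|[j|]] //=.
    by apply: eq_bigl => j; rewrite eqxx.
  have [rN|rN] := eqVneq (rs None) 0.
    case: k0 r0 => [j|]; last by rewrite rN eqxx.
    move: sumE; rewrite rN polyC0 mul0r add0r => /powers_independent ->.
    by rewrite eqxx.
  have := congr1 (fun q => (map_poly evalL q).[w]) sumE.
  rewrite rmorph0 horner0 rmorphD rmorphM /= map_polyC hornerD hornerM hornerC zE.
  rewrite rmorph_sum horner_sum => /eqP; rewrite addr_eq0 => /eqP vE.
  move: vG; apply/negP; rewrite negbK.
  have c0 : evalL (rs None) * evalA b != 0.
    by apply: mulf_neq0; [rewrite evalL_eq0|rewrite evalA_eq0].
  rewrite -[v](mulKf c0) -mulrA [X in _ * X](vE : evalL (rs None) * (evalA b * v) = _).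
  apply: (@rpredM _ (subfield_pred (mk_subfield G_closed))).
    apply: (@rpredVr _ (subfield_pred (mk_subfield G_closed))).
    apply: (@rpredM _ (subfield_pred (mk_subfield G_closed))); last exact: evalA_in.
    by apply: evalL_in; case: (srs None).
  apply: (@rpredNr _ (subfield_pred (mk_subfield G_closed))).
  apply: (@rpred_sum _ (subfield_pred (mk_subfield G_closed))) => j _.
  rewrite rmorphM /= map_polyC hornerM hornerC eval_power.
  apply: (@rpredM _ (subfield_pred (mk_subfield G_closed))).
    by apply: evalL_in; case: (srs (Some j)).
  by apply: (@rpredX _ (subfield_pred (mk_subfield G_closed))).
Qed.

End Powers.

Lemma reach_norm w P u : minimal_at evalL w P -> reach evalL w u ->
  exists bQ : {poly Af} * {poly {poly L}}, [/\ bQ.1 != 0, (size bQ.2 < size P)%N &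
    (map_poly evalL bQ.2).[w] = evalA bQ.1 * u].
Proof.
move=> [Pm Pw _] [b [q [b0 qE]]]; have [b' [a [a0 aE]]] := norm_multiple b0.
exists (a, Pdiv.Ring.rmodp (b'%:P * q) P); split=> //=.
  by rewrite Pdiv.Ring.ltn_rmodpN0 // monic_neq0.
rewrite (ann_rmodp _ Pm Pw) map_horner_CM -qE mulrA; congr (_ * _).
by rewrite mulrC -[RHS]/(evalL (map_poly val a)) -aE [RHS]rmorphM.
Qed.

(** A primitive element [y] for the part of [vs] inside [G], over [A(x)], becomes
    the generator of a problem, a primitive element [w] for [y] and all of [vs],
    over [L(x)], becomes the primitive element, and the numerators of the part
    of [vs] outside of [G] become the forbidden elements.  The denominators are
    taken in [A(x)], where they do not affect membership in [G], and [avoid]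
    keeps them from vanishing.  A solution specializes [x] and [w]; the map [z]
    is the induced specialization of fractions. *)
Theorem specialize_finite (vs : seq M) : (forall v, v \in vs -> alg_over evalA v) ->
  exists z : M -> M, [/\
    forall a b, a \in vs -> b \in vs -> a - b \in vs -> z (a - b) = z a - z b,
    forall a b, a \in vs -> b \in vs -> a * b \in vs -> z (a * b) = z a * z b,
    forall l, i l \in vs -> z (i l) = i' l,
    forall a, a \in vs -> (z a \in G) = (a \in G) &
    x \in vs -> pt (z x)].
Proof.
move=> vsa.
have [y [ya yS [e1 [e10 e1us]]]] : exists y, [/\ alg_over evalA y,
    forall S : M -> Prop, S 0 -> (forall x y, S x -> S y -> S (x - y)) ->
      (forall u, u \in [seq v <- vs | v \in G] -> S u) -> S y &
    exists e, e != 0 /\ forall u, u \in [seq v <- vs | v \in G] ->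
      exists Q : {poly {poly Af}}, evalA e * u = (map_poly evalA Q).[y]].
  by apply: (primitive_element evalA_inj charM) => u; rewrite mem_filter => /andP[_ /vsa].
have Gsub a b : a \in G -> b \in G -> a - b \in G.
  exact: (@rpredB _ (subfield_pred (mk_subfield G_closed))).
have G0 : 0 \in G := natural_closed G_closed 0.
have yG : y \in G.
  by apply: (yS (fun m => m \in G)) => // u; rewrite mem_filter => /andP[].
have [w [wa _ [e2 [e20 e2us]]]] : exists w, [/\ alg_over evalL w,
    forall S : M -> Prop, S 0 -> (forall x y, S x -> S y -> S (x - y)) ->
      (forall u, u \in y :: vs -> S u) -> S w &
    exists e, e != 0 /\ forall u, u \in y :: vs ->
      exists Q : {poly {poly L}}, evalL e * u = (map_poly evalL Q).[w]].
  apply: (primitive_element evalL_inj charM) => u; rewrite inE => /orP[/eqP->|/vsa]; exact: alg_evalL.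
have [d2 [d20 d2P]] := minimal_exists evalL_inj wa.
have [P Pmin] := d2P 1 (oner_neq0 _); rewrite mulr1 in Pmin.
set w1 := evalL d2 * w in Pmin.
have reachu u : u \in y :: vs -> reach evalL w1 u.
  move=> /e2us[Q QE]; apply: (reach_div e20); rewrite QE; apply: reach_horner.
  by apply: (reach_div d20); exact: reach_gen.
have [[by_ Qy] /= [by0 _ QyE]] := reach_norm Pmin (reachu y (mem_head _ _)).
have [d3 [d30 d3P]] := minimal_exists evalA_inj ya.
have [f fmin] := d3P by_ by0; set y2 := evalA (d3 * by_) * y in fmin.
pose g : {poly {poly L}} := (map_poly val d3)%:P * Qy.
have gE : (map_poly evalL g).[w1] = y2.
  rewrite /g map_horner_CM QyE mulrA; congr (_ * _).
  by rewrite [RHS]rmorphM.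
have y2G : y2 \in G.
  by apply: (@rpredM _ (subfield_pred (mk_subfield G_closed))); [exact: evalA_in|].
have bQex v : exists bQ : {poly Af} * {poly {poly L}}, bQ.1 != 0 /\ (v \in vs ->
    (size bQ.2 < size P)%N /\ (map_poly evalL bQ.2).[w1] = evalA bQ.1 * v).
  have [vvs|_] := boolP (v \in vs); last by exists (1, 0); rewrite oner_neq0.
  have [|bQ [h1 h2 h3]] := reach_norm Pmin (reachu v _); first by rewrite inE vvs orbT.
  by exists bQ.
have [bQ bQP] := choice bQex.
have aqex v : exists aq : {poly Af} * {poly {poly Af}}, aq.1 != 0 /\ (v \in vs -> v \in G ->
    evalA aq.1 * v = (map_poly evalA aq.2).[y2]).
  have [/andP[vvs vG]|none] := boolP ((v \in vs) && (v \in G)); last first.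
    exists (1, 0); rewrite oner_neq0; split => // h1 h2; by rewrite h1 h2 in none.
  have [a [q [a0 aE]]] : reach evalA y2 v.
    have [|Q QE] := e1us v; first by rewrite mem_filter vG.
    apply: (reach_div e10); rewrite QE; apply: reach_horner.
    by apply: (reach_div (mulf_neq0 d30 by0)); exact: reach_gen.
  by exists (a, q).
have [aq aqP] := choice aqex.
pose zeta : {poly Af} := \prod_(v <- vs) ((bQ v).1 * (aq v).1).
have zeta0 : zeta != 0.
  rewrite prodf_seq_neq0; apply/allP => v _ /=.
  by rewrite mulf_neq0 //; [case: (bQP v)|case: (aqP v)].
pose outs := [seq (bQ v).2 | v <- vs & v \notin G].
have [B BP] := bound2 ([seq Pdiv.Ring.rmodp (g ^+ j) P | j <- index_iota 0 (size f).-1] ++ outs) id.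
have wp := @well_posed_image y2 w1 f P g y2G fmin Pmin gE B outs zeta _ _ _ zeta0.
have [|||x0 [w0 [ptx0 Pw0 zx0 gG outG]]] := genG (wp _ _ _).
- move=> z0 /mapP[v]; rewrite mem_filter => /andP[vG vvs] -> {z0}.
  have [b0 /(_ vvs)[h1 h2]] := bQP v; split => //.
  by exists (bQ v).1, v.
- move=> j jd l; rewrite (leq_trans _ (leqnSn _)) //.
  have [|_] := BP (Pdiv.Ring.rmodp (g ^+ j) P); last exact.
    rewrite mem_cat; apply/orP; left; apply/mapP; exists j => //.
    by rewrite mem_index_iota.
- move=> z zo l; rewrite (leq_trans _ (leqnSn _)) //.
  by have [|_] := BP z; [rewrite mem_cat zo orbT|exact].
rewrite /= in Pw0 zx0 gG outG.
pose tau : {rmorphism {poly {poly L}} -> M} := horner_eval w1 \o map_poly evalL.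
pose sigma : {rmorphism {poly {poly L}} -> M} :=
  horner_eval w0 \o (spec x0 \o map_poly (map_poly i')).
have sigE H : sigma H = (spec x0 (map_poly (map_poly i') H)).[w0] by [].
have tauE H : tau H = (map_poly evalL H).[w1] by [].
have kill H : tau H = 0 -> sigma H = 0.
  move=> H0; have [s ->] := minimal_dvd Pmin H0.
  by rewrite rmorphM [X in _ * X]Pw0 mulr0.
have tauC q : tau q%:P = evalL q by rewrite tauE map_polyC hornerC.
have sigC q : sigma q%:P = (map_poly i' q).[x0] by rewrite sigE !map_polyC hornerC.
pose c (a : {poly Af}) : {poly {poly L}} := (map_poly val a)%:P.
have tauc a : tau (c a) = evalA a by rewrite tauE /c map_polyC hornerC.
have sigc a : sigma (c a) = (map_poly i' (map_poly val a)).[x0].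
  by rewrite sigE /c !map_polyC hornerC.
have sigM a1 a2 : sigma (c (a1 * a2)) = sigma (c a1) * sigma (c a2).
  by rewrite /c (rmorphM (map_poly val)) polyCM (rmorphM sigma).
have x0G := ptG ptx0.
have sigcG a : sigma (c a) \in G.
  by rewrite sigc; apply: horner_in => // l; rewrite !coef_map AG'; exact: sfval_in.
have nz v : v \in vs -> sigma (c (bQ v).1) != 0 /\ sigma (c (aq v).1) != 0.
  move=> vvs; move: zx0; rewrite -[_.[x0]]/((map_poly i' (map_poly val zeta)).[x0]) -sigc.
  have -> : zeta = (bQ v).1 * (aq v).1 * \prod_(u <- rem v vs) ((bQ u).1 * (aq u).1).
    exact: big_rem.
  rewrite sigM mulf_eq0 negb_or => /andP[+ _].
  by rewrite sigM mulf_eq0 negb_or => /andP.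
pose Q v := (bQ v).2; pose b v := c (bQ v).1.
have tauQ v : v \in vs -> tau (Q v) = tau (b v) * v.
  by move=> vvs; rewrite tauc tauE; have [_ /(_ vvs)[]] := bQP v.
exists (fun v => sigma (Q v) / sigma (b v)); split.
- move=> u v uvs vvs uvvs.
  by apply: (transport_sub kill (nz _ uvs).1 (nz _ vvs).1 (nz _ uvvs).1); exact: tauQ.
- move=> u v uvs vvs uvvs.
  by apply: (transport_mul kill (nz _ uvs).1 (nz _ vvs).1 (nz _ uvvs).1); exact: tauQ.
- move=> l lvs; have [n1 _] := nz _ lvs.
  have tl : tau l%:P%:P = i l by rewrite tauC evalLC.
  have sl : sigma l%:P%:P = i' l by rewrite sigC map_polyC hornerC.
  rewrite (transport_fraction kill (b' := 1) (q' := l%:P%:P) n1 _ (tauQ _ lvs)).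
  - by rewrite sl rmorph1 divr1.
  - by rewrite rmorph1 oner_neq0.
  - by rewrite tl rmorph1 mul1r.
- move=> v vvs; have [n1 n2] := nz _ vvs.
  have [vG|vG] := boolP (v \in G); last first.
    apply/negP => zG.
    have : sigma (Q v) \notin G.
      rewrite sigE; apply: outG; apply/mapP; exists (Q v) => //.
      by apply/mapP; exists v => //; rewrite mem_filter vG.
    apply/negP; rewrite negbK -[sigma (Q v)](divfK n1).
    by apply: (@rpredM _ (subfield_pred (mk_subfield G_closed))); [|exact: sigcG].
  pose q := map_poly (map_poly val) (aq v).2 \Po g.
  have tq : tau q = (map_poly evalA (aq v).2).[y2].
    by rewrite tauE /q map_comp_poly horner_comp gE -map_poly_comp.
  have sq : sigma q \in G.
    rewrite sigE /q !map_comp_poly horner_comp; apply: horner_in => // l.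
    rewrite !coef_map; apply: horner_in => // m.
    by rewrite !coef_map AG'; exact: sfval_in.
  have [_ /(_ vvs vG) aE] := aqP v.
  rewrite (transport_fraction kill (b' := c (aq v).1) (q' := q) n1 n2 (tauQ _ vvs)); last first.
    by rewrite tauc tq aE.
  apply: (@rpredM _ (subfield_pred (mk_subfield G_closed))) => //.
  apply: (@rpredVr _ (subfield_pred (mk_subfield G_closed))); exact: sigcG.
- move=> xvs; have [n1 _] := nz _ xvs.
  have tx : tau 'X%:P = x by rewrite tauC evalLX.
  have sx : sigma 'X%:P = x0 by rewrite sigC map_polyX hornerX.
  rewrite (transport_fraction kill (b' := 1) (q' := 'X%:P) n1 _ (tauQ _ xvs)).
  - by rewrite sx rmorph1 divr1.
  - by rewrite rmorph1 oner_neq0.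
  - by rewrite tx rmorph1 mul1r.
Qed.

End Finite.

(** * Extending partial isomorphisms *)

Lemma ae_premise (P : Prop) (Q : nat -> Prop) : (P -> ae Q) -> ae (fun n => P -> Q n).
Proof.
move=> h; have [p|np] := pselect P; last exact: aeT.
by apply: ae_imp (h p) _ => n q _.
Qed.

Lemma urep_sub (K : closedFieldType) (a b : upow K) :
  ae (fun n => urep (a - b) n = urep a n - urep b n).
Proof.
rewrite -{1}(urepK a) -{1}(urepK b) -rmorphB; exact: urep_ulim.
Qed.

Lemma urep_mul (K : closedFieldType) (a b : upow K) :
  ae (fun n => urep (a * b) n = urep a n * urep b n).
Proof.
rewrite -{1}(urepK a) -{1}(urepK b) -rmorphM; exact: urep_ulim.
Qed.

Section Saturation.
Variables (K : closedFieldType) (F : {pred K}).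
Notation M := (upow K).
Notation G := (upred F).

(** For an enumeration of [L2], the conditions on the images of the first [J]
    elements are satisfied at almost all indices by the given finite
    specializations.  Saturation finds a sequence of images that satisfies each
    condition at almost all indices, that is, an embedding into the ultrapower. *)
Theorem saturate (L L2 : fieldType) (i i' : {rmorphism L -> M}) (j : {rmorphism L2 -> M}) (x : M) :
  enumerable L2 ->
  (forall vs : seq M, (forall v, v \in vs -> exists m, j m = v) -> exists z : M -> M, [/\
    forall a b, a \in vs -> b \in vs -> a - b \in vs -> z (a - b) = z a - z b,
    forall a b, a \in vs -> b \in vs -> a * b \in vs -> z (a * b) = z a * z b,
    forall l, i l \in vs -> z (i l) = i' l,
    forall a, a \in vs -> (z a \in G) = (a \in G) &
    x \in vs -> unatural (z x)]) ->
  exists j' : {rmorphism L2 -> M}, [/\ forall m, (j' m \in G) = (j m \in G),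
    forall m l, j m = i l -> j' m = i' l & forall m, j m = x -> unatural (j' m)].
Proof.
move=> [e eP] fin.
pose c k := j (e k).
pose Cadd k1 k2 k3 (f : nat -> K) := c k3 = c k1 - c k2 -> f k3 = f k1 - f k2.
pose Cmul k1 k2 k3 (f : nat -> K) := c k3 = c k1 * c k2 -> f k3 = f k1 * f k2.
pose Cbase k n (f : nat -> K) := forall l, c k = i l -> f k = urep (i' l) n.
pose Cin k (f : nat -> K) := (f k \in F) = (c k \in G).
pose Cpt k (f : nat -> K) := c k = x -> exists m : nat, f k = m%:R.
pose D J n f :=
  (forall k1, (k1 < J)%N -> forall k2, (k2 < J)%N -> forall k3, (k3 < J)%N -> Cadd k1 k2 k3 f /\ Cmul k1 k2 k3 f) /\
  (forall k, (k < J)%N -> [/\ Cbase k n f, Cin k f & Cpt k f]).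
have [||||s sP] := @ae_saturation (nat -> K) D.
- by move=> n f; split.
- exact: (inhabits (fun=> 0)).
- move=> J n f [h1 h2]; split=> [k1 J1 k2 J2 k3 J3|k Jk].
    by apply: h1; exact: ltnW.
  by apply: h2; exact: ltnW.
- move=> J; pose vs := [seq c k | k <- iota 0 J].
  have mem k : (k < J)%N -> c k \in vs by move=> kJ; apply/mapP; exists k; rewrite ?mem_iota.
  have [|z [zB zM zi zG zx]] := fin vs.
    by move=> v /mapP[k _ ->]; exists (e k).
  have : ae (fun n => D J n (fun k => urep (z (c k)) n)).
    apply: ae_and.
      apply: ae_all_lt => k1 J1; apply: ae_all_lt => k2 J2; apply: ae_all_lt => k3 J3.
      apply: ae_and; apply: ae_premise => cE.
        have := zB (c k1) (c k2) (mem _ J1) (mem _ J2); rewrite -cE => /(_ (mem _ J3)).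
        by move=> ->; exact: urep_sub.
      have := zM (c k1) (c k2) (mem _ J1) (mem _ J2); rewrite -cE => /(_ (mem _ J3)).
      by move=> ->; exact: urep_mul.
    apply: ae_all_lt => k Jk.
    have h1 : ae (fun n => Cbase k n (fun k => urep (z (c k)) n)).
      have [[l cl]|no] := pselect (exists l, c k = i l); last first.
        by apply: aeT => n l cl; exfalso; apply: no; exists l.
      apply: aeT => n l'; rewrite cl => /fmorph_inj <-; rewrite zi // -cl; exact: mem.
    have h2 : ae (fun n => Cin k (fun k => urep (z (c k)) n)).
      have zGk := zG (c k) (mem k Jk).
      have [cG|cG] := boolP (c k \in G).
        move: zGk; rewrite cG => /asboolP h; apply: ae_imp h _ => n h.
        by rewrite /Cin cG.
      have /ae_notE h : ~ ae (fun n => urep (z (c k)) n \in F).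
        by move=> h; move: zGk; rewrite (negPf cG) => /negP; apply; apply/asboolP.
      by apply: ae_imp h _ => n /negP/negPf h; rewrite /Cin h (negPf cG).
    have h3 : ae (fun n => Cpt k (fun k => urep (z (c k)) n)).
      apply: ae_premise => cx; have [|m mE] := zx; first by rewrite -cx; exact: mem.
      have := urep_ulim (fun n => (m n)%:R : K); rewrite -mE -cx => h.
      by apply: ae_imp h _ => n h; exists (m n).
    by apply: ae_imp2 h1 (ae_and h2 h3) _ => n ? [? ?].
  by move=> h; apply: ae_imp h _ => n h; exists (fun k => urep (z (c k)) n).
have [ix ixE] := choice eP.
pose j' m : M := ulim (fun n => s n (ix m)).
have cE m : c (ix m) = j m by rewrite /c ixE.
have bigJ m1 m2 m3 : exists J, [/\ (ix m1 < J)%N, (ix m2 < J)%N & (ix m3 < J)%N].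
  by exists (ix m1 + ix m2 + ix m3).+1; split; rewrite ltnS; lia.
have j'_zmod : zmod_morphism j'.
  move=> m1 m2; have [J [J1 J2 J3]] := bigJ m1 m2 (m1 - m2).
  rewrite /j' -rmorphB; apply/ulim_eq; apply: ae_imp (sP J) _ => n [h _].
  by have [/(_ _) -> //] := h _ J1 _ J2 _ J3; rewrite !cE rmorphB.
have base m l : j m = i l -> j' m = i' l.
  move=> ml; rewrite -[RHS]urepK; apply/ulim_eq; apply: ae_imp (sP (ix m).+1) _ => n [_ h].
  by have [hb _ _] := h _ (ltnSn _); apply: hb; rewrite cE.
have j'_monoid : monoid_morphism j'.
  split=> [|m1 m2]; first by rewrite (base 1 1) ?rmorph1.
  have [J [J1 J2 J3]] := bigJ m1 m2 (m1 * m2).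
  rewrite /j' -rmorphM; apply/ulim_eq; apply: ae_imp (sP J) _ => n [h _].
  by have [_ /(_ _) -> //] := h _ J1 _ J2 _ J3; rewrite !cE rmorphM.
pose jz := GRing.isZmodMorphism.Build L2 M j' j'_zmod.
pose jm := GRing.isMonoidMorphism.Build L2 M j' j'_monoid.
pose jR : {rmorphism L2 -> M} := HB.pack j' jz jm.
exists jR; split=> [m|m l|m mx]; last 1 first.
- have h : ae (fun n => exists k : nat, s n (ix m) = k%:R).
    apply: ae_imp (sP (ix m).+1) _ => n [_ h]; have [_ _ hp] := h _ (ltnSn _).
    by apply: hp; rewrite cE.
  have [k kE] := ae_choice 0%N h.
  by exists k; apply/ulim_eq.
- apply/idP/idP => [/upredP h|mG].
    have [n [hF [_ hn]]] := ae_ex (ae_and h (sP (ix m).+1)).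
    by rewrite -cE; have [_ <- _] := hn _ (ltnSn _).
  apply/upredP; apply: ae_imp (sP (ix m).+1) _ => n [_ hn].
  by have [_ hc _] := hn _ (ltnSn _); move: mG; rewrite -cE -hc.
- exact: base.
Qed.

End Saturation.

Section Extension.
Variables (K : closedFieldType) (F : {pred K}) (F_closed : divring_closed F).
Hypotheses (charK : [pchar K] =i pred0) (genF : generic F (@natural K)).
Notation M := (upow K).
Notation G := (upred F).

(** Positions of the back-and-forth game.  The last field makes the trace of [G]
    the only part of the field over which problems need data. *)
Record position := Position {
  pos_field : fieldType;
  pos_left : {rmorphism pos_field -> M};
  pos_right : {rmorphism pos_field -> M};
  pos_closed : alg_closed pos_field;
  pos_enum : enumerable pos_field;
  pos_same : forall l, (pos_left l \in G) = (pos_right l \in G);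
  pos_alg : forall l, exists p : {poly pos_field},
    [/\ p != 0, p.[l] = 0 & forall k, pos_left p`_k \in G] }.

Definition pos_swap (p : position) : position.
Proof.
exists (pos_field p) (pos_right p) (pos_left p).
- exact: pos_closed.
- exact: pos_enum.
- by move=> l; rewrite pos_same.
- by move=> l; have [q [q0 ql qG]] := pos_alg l; exists q; split => // k; rewrite -pos_same.
Defined.

Let charM : [pchar M] =i pred0.
Proof. by move=> q; rewrite (fmorph_pchar (@udiag K)) charK. Qed.

(** If [x] is in the left image there is nothing to do.  Otherwise the new field is
    the algebraic closure of [L(x)] in [M], whose right embedding is assembled by
    [saturate] from the specializations of its finite parts. *)
Theorem extend_position (p : position) (x : M) : x \in G ->
  exists (p2 : position) (e : pos_field p -> pos_field p2) (x2 : pos_field p2),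
    [/\ forall l, pos_left p2 (e l) = pos_left p l, forall l, pos_right p2 (e l) = pos_right p l,
        pos_left p2 x2 = x & (exists l, pos_left p l = x) \/ unatural (pos_right p2 x2)].
Proof.
move=> xG; case: p => L i i' Lc Le AG' Lalg /=.
have [[l lx]|no] := pselect (exists l, i l = x).
  exists (Position Lc Le AG' Lalg), id, l; split => //=; by left; exists l.
have x_out l : i l != x by apply/eqP => e; apply: no; exists l.
have Gc := upred_closed F_closed.
pose A : {pred L} := fun l => i l \in G.
have Ac : divring_closed A.
  have [G1 Gs Gd] := Gc; split=> [|a b aA bA|a b aA bA]; rewrite /in_mem /= /A.
  - by rewrite rmorph1.
  - by rewrite rmorphB; exact: Gs.
  - by rewrite rmorphM fmorphV; exact: Gd.
have AG l : (i l \in G) = (l \in A) by [].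
have AGr l : (i' l \in G) = (l \in A) by rewrite -AG' AG.
have L_alg l : algebraicOver (sfval (mk_subfield Ac)) l.
  have [q [q0 ql qG]] := Lalg l; have [q' qE] := poly_lift Ac (qG : forall k, q`_k \in A).
  exists q'; last by apply/rootP; rewrite -qE.
  by apply: contraNneq q0 => q'0; rewrite qE q'0 rmorph0.
have rho_inj := evalA_inj (A_closed := Ac) Lc x_out.
pose rho := evalA i Ac x.
pose C : {pred M} := fun m => `[< alg_over rho m >].
have CP m : reflect (alg_over rho m) (m \in C) by exact: asboolP.
have Cc : divring_closed C.
  split=> [|a b /CP aC /CP bC|a b /CP aC /CP bC]; apply/CP.
  - by rewrite -(rmorph1 rho); exact: alg_over_id.
  - exact: alg_over_sub.
  - by apply: alg_over_mul => //; exact: alg_over_inv.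
pose L2 := subfield_type (mk_subfield Cc).
pose j : {rmorphism L2 -> M} := sfval (mk_subfield Cc).
have L2c : alg_closed L2.
  move=> q sq; have [r rq] : exists r, root (map_poly j q) r.
    by apply: poly_root_exists; rewrite size_map_poly.
  have [|r' rE] := sfvalP Cc (_ : r \in C).
    apply/CP; apply: (alg_over_root rho_inj _ rq) => [|k].
      by rewrite -size_poly_gt0 size_map_poly; apply: ltnW.
    by rewrite coef_map; apply/CP; exact: sfval_in.
  by exists r'; rewrite -(fmorph_root j) rE.
have Ae : enumerable (subfield_type (mk_subfield Ac)).
  have cl l : exists a : subfield_type (mk_subfield Ac), l \in A -> sfval _ a = l.
    have [lA|_] := boolP (l \in A); last by exists 0.
    by have [a aE] := sfvalP Ac lA; exists a.
  have [f fE] := choice cl.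
  apply: (enumerable_image (f := f) Le) => a; exists (sfval _ a).
  by apply: (fmorph_inj (sfval (mk_subfield Ac))); rewrite fE //; exact: sfval_in.
have L2e : enumerable L2.
  have [s sP] := enumerable_algebraic rho_inj (enumerable_poly Ae).
  have cl n : exists m : L2, s n \in C -> j m = s n.
    have [sC|_] := boolP (s n \in C); last by exists 0.
    by have [m mE] := sfvalP Cc sC; exists m.
  have [f fE] := choice cl.
  exists f => m; have mC : j m \in C by exact: sfval_in.
  have [n nE] := sP (j m) (CP _ mC); exists n.
  by apply: (fmorph_inj j); rewrite fE nE.
have [|j' [j'G j'i j'x]] := saturate (F := F) (i := i) (i' := i') (j := j) (x := x) L2e.
  move=> vs vsC.
  apply: (specialize_finite Gc charM (generic_upow F_closed genF) _ AG AGr Lc L_alg xG x_out).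
    move=> y [s ->]; apply/upredP; apply: aeT => n; exact: natural_closed.
  by move=> v /vsC[m <-]; apply/CP; exact: sfval_in.
have [e eE] := choice (fun l => sfvalP Cc (introT (CP _) (alg_base i L_alg x l))).
have [x2 x2E] := sfvalP Cc (introT (CP _) (alg_gen Ac Lc x_out)).
have L2alg m : exists q : {poly L2}, [/\ q != 0, q.[m] = 0 & forall k, j q`_k \in G].
  have /CP[q q0 qm] : j m \in C by exact: sfval_in.
  have [|q2 q2E] := poly_lift Cc (q := map_poly rho q) _.
    by move=> k; rewrite coef_map; apply/CP; exact: alg_over_id.
  exists q2; split=> [||k].
  - apply: contraNneq q0 => q20; move: q2E; rewrite q20 rmorph0 => /eqP.
    by rewrite -size_poly_eq0 size_map_inj_poly ?rmorph0 // size_poly_eq0.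
  - by apply: (fmorph_inj j); rewrite rmorph0 -horner_map -q2E.
  - by rewrite -coef_map -[map_poly j q2]q2E coef_map; exact: evalA_in.
have same m : (j m \in G) = (j' m \in G) by rewrite j'G.
exists (Position L2c L2e same L2alg), e, x2; split=> //= [l|].
- by apply: j'i; exact: eE.
- by right; apply: j'x.
Qed.

End Extension.

(** * First-order formulas in subfields *)

Section Satisfaction.
Variable (R0 : unitRingType).

Definition update (T : Type) (e : nat -> T) k x : nat -> T := fun l => if l == k then x else e l.

Lemma update_comp (T U : Type) (f : T -> U) (e : nat -> T) k x :
  (fun l => f (update e k x l)) = update (fun l => f (e l)) k (f x).
Proof. by apply/funext => l; rewrite /update; case: eqP. Qed.

Lemma update_ext (T : Type) (e e' : nat -> T) k x : (forall l, e l = e' l) -> update e k x = update e' k x.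
Proof. by move=> ee; congr update; apply/funext. Qed.

Fixpoint term_eval (R : nzRingType) (e : nat -> R) (t : GRing.term R0) : R :=
  match t with
  | GRing.Var k => e k
  | GRing.NatConst n => n%:R
  | GRing.Const _ | GRing.Inv _ => 0
  | GRing.Opp t1 => - term_eval e t1
  | GRing.NatMul t1 n => term_eval e t1 *+ n
  | GRing.Exp t1 n => term_eval e t1 ^+ n
  | GRing.Add t1 t2 => term_eval e t1 + term_eval e t2
  | GRing.Mul t1 t2 => term_eval e t1 * term_eval e t2
  end.

(** Truth of a parameter-free formula in the subring [G] of [R]: quantifiers are
    relativized to [G], so subfields of different fields can be compared. *)
Fixpoint sat_in (R : nzRingType) (G : {pred R}) (e : nat -> R) (f : GRing.formula R0) : Prop :=
  match f with
  | GRing.Bool b => b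
  | GRing.Unit _ => False
  | GRing.Equal t1 t2 => term_eval e t1 = term_eval e t2
  | GRing.And f1 f2 => sat_in G e f1 /\ sat_in G e f2
  | GRing.Or f1 f2 => sat_in G e f1 \/ sat_in G e f2
  | GRing.Implies f1 f2 => sat_in G e f1 -> sat_in G e f2
  | GRing.Not f1 => ~ sat_in G e f1
  | GRing.Exists k f1 => exists2 x, x \in G & sat_in G (update e k x) f1
  | GRing.Forall k f1 => forall x, x \in G -> sat_in G (update e k x) f1
  end.

Lemma term_eval_morph (R S : nzRingType) (h : {rmorphism R -> S}) e (t : GRing.term R0) :
  term_eval (fun k => h (e k)) t = h (term_eval e t).
Proof.
elim: t => //= [|n|t1 IH1 t2 IH2|t1 IH1|t1 IH1 n|t1 IH1 t2 IH2|t1 IH1 |t1 IH1 n].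
- by rewrite rmorph0.
- by rewrite rmorph_nat.
- by rewrite rmorphD IH1 IH2.
- by rewrite rmorphN IH1.
- by rewrite rmorphMn IH1.
- by rewrite rmorphM IH1 IH2.
- by rewrite rmorph0.
- by rewrite rmorphXn IH1.
Qed.

End Satisfaction.

Lemma holds_sat_in (K : fieldType) (F : subfields K) (e : seq (subfield_type F)) f :
  ring_formula f -> GRing.holds e f <-> sat_in (subfield_pred F) (fun k => sfval F e`_k) f.
Proof.
have evalE e' t : ring_term t -> sfval F (GRing.eval e' t) = term_eval (fun k => sfval F e'`_k) t.
  elim: t => //= [n _|t1 IH1 t2 IH2 /andP[/IH1 <- /IH2 <-]|t1 IH1 /IH1 <-|t1 IH1 n /IH1 <-|t1 IH1 t2 IH2 /andP[/IH1 <- /IH2 <-]|t1 IH1 n /IH1 <-].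
  - exact: (rmorph_nat (sfval F)).
  - exact: (rmorphD (sfval F)).
  - exact: (rmorphN (sfval F)).
  - exact: (rmorphMn (sfval F)).
  - exact: (rmorphM (sfval F)).
  - exact: (rmorphXn (sfval F)).
have updE e' k x : (fun l => sfval F (set_nth 0 e' k x)`_l) = update (fun l => sfval F e'`_l) k (sfval F x).
  by apply/funext => l; rewrite nth_set_nth /= /update; case: eqP.
elim: f e => //= [t1 t2|f1 IH1 f2 IH2|f1 IH1 f2 IH2|f1 IH1 f2 IH2|f1 IH1|k f1 IH1|k f1 IH1] e.
- move=> /andP[h1 h2]; rewrite -!evalE //; split=> [->//|]; exact: fmorph_inj.
- by move=> /andP[/IH1 h1 /IH2 h2]; rewrite h1 h2.
- by move=> /andP[/IH1 h1 /IH2 h2]; rewrite h1 h2.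
- by move=> /andP[/IH1 h1 /IH2 h2]; rewrite h1 h2.
- by move=> /IH1 h1; rewrite h1.
- move=> rf; split=> [[x /(IH1 _ rf)]|[x xF h]].
    by rewrite updE; exists (sfval F x) => //; exact: (valP x).
  by exists (exist _ x xF); apply/(IH1 _ rf); rewrite updE.
- move=> rf; split=> [h x xF|h x].
    by have /(IH1 _ rf) := h (exist _ x xF); rewrite updE.
  by apply/(IH1 _ rf); rewrite updE; apply: h; exact: (valP x).
Qed.

(** Łoś's theorem for the subfield [upred F] of the ultrapower. *)
Lemma los (R0 : unitRingType) (K : closedFieldType) (F : {pred K}) (e : nat -> nat -> K) (f : GRing.formula R0) :
  ring_formula f ->
  sat_in (upred F) (fun k => ulim (e k)) f <-> ae (fun n => sat_in F (fun k => e k n) f).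
Proof.
have updE e' k (s : nat -> K) : (fun l => ulim (update e' k s l)) = update (fun l => ulim (e' l)) k (ulim s).
  exact: update_comp.
have updn e' k (s : nat -> K) n : (fun l => update e' k s l n) = update (fun l => e' l n) k (s n).
  exact: (update_comp (fun s : nat -> K => s n)).
elim: f e => //= [b|t1 t2|f1 IH1 f2 IH2|f1 IH1 f2 IH2|f1 IH1 f2 IH2|f1 IH1|k f1 IH1|k f1 IH1] e.
- by move=> _; split=> [h|/ae_const//]; exact: aeT.
- move=> _; rewrite !(term_eval_morph (@ulim K)) ulim_eq.
  have tn t n : term_eval (fun k => e k n) t = term_eval e t n.
    exact: (term_eval_morph (at_ n) e t).
  by split=> h; apply: ae_imp h _ => n; rewrite !tn.
- by move=> /andP[/IH1 h1 /IH2 h2]; rewrite h1 h2 ae_andE.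
- by move=> /andP[/IH1 h1 /IH2 h2]; rewrite h1 h2 ae_orE.
- move=> /andP[/IH1 h1 /IH2 h2]; rewrite h1 h2; split=> [h|h a].
    have [/h b|/ae_notE nb] := pselect (ae (fun n => sat_in F (fun k => e k n) f1)).
      by apply: ae_imp b _ => n b _.
    by apply: ae_imp nb _ => n nb /nb.
  by apply: ae_imp2 h a _ => n.
- by move=> /IH1 h1; rewrite h1 ae_notE.
- move=> rf; split=> [[x xG]|h].
    rewrite -(urepK x) -updE => /(IH1 _ rf) h.
    have /asboolP xF : x \in upred F by [].
    by apply: ae_imp2 h xF _ => n; rewrite updn => h hF; exists (urep x n).
  have [s sP] := @ae_choice K 0 (fun n x => x \in F /\ sat_in F (update (fun l => e l n) k x) f1)
     (ae_imp h (fun n '(ex_intro2 x xF xs) => ex_intro _ x (conj xF xs))).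
  exists (ulim s); first by apply/upredP; apply: ae_imp sP _ => n [].
  by rewrite -updE; apply/(IH1 _ rf); apply: ae_imp sP _ => n [_]; rewrite updn.
- move=> rf; split=> [h|h x xG].
    apply: contrapT => /ae_notE bad.
    have bad' : ae (fun n => exists x, x \in F /\ ~ sat_in F (update (fun l => e l n) k x) f1).
      by apply: ae_imp bad _ => n /existsNP[x /not_implyP[xF xs]]; exists x.
    have [s sP] := @ae_choice K 0 (fun n x => x \in F /\ ~ sat_in F (update (fun l => e l n) k x) f1) bad'.
    have := h (ulim s); rewrite -updE => hs.
    have /(IH1 _ rf) hs' := hs ((upredP _ _).2 (ae_imp sP (fun n a => a.1))).
    by have [n [[_ n1]]] := ae_ex (ae_and sP hs'); rewrite updn.
  rewrite -(urepK x) -updE; apply/(IH1 _ rf).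
  have /asboolP xF := xG.
  by apply: ae_imp2 h xF _ => n h hF; rewrite updn; exact: h.
Qed.

(** The back-and-forth argument of Ehrenfeucht and Fraisse: [extend_position]
    answers a quantifier on the left, and on the right after exchanging the two
    embeddings. *)
Lemma position_equivalence (R0 : unitRingType) (K : closedFieldType) (F : {pred K})
    (F_closed : divring_closed F) (charK : [pchar K] =i pred0) (genF : generic F (@natural K))
    (p : position F) (e : nat -> pos_field p) (f : GRing.formula R0) : ring_formula f ->
  sat_in (upred F) (fun k => pos_left p (e k)) f <-> sat_in (upred F) (fun k => pos_right p (e k)) f.
Proof.
have forth := extend_position F_closed charK genF.
elim: f p e => //= [t1 t2|f1 IH1 f2 IH2|f1 IH1 f2 IH2|f1 IH1 f2 IH2|f1 IH1|k f1 IH1|k f1 IH1] p e.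
- move=> _; rewrite !term_eval_morph; split=> /fmorph_inj -> //.
- by move=> /andP[/IH1 h1 /IH2 h2]; rewrite h1 h2.
- by move=> /andP[/IH1 h1 /IH2 h2]; rewrite h1 h2.
- by move=> /andP[/IH1 h1 /IH2 h2]; rewrite h1 h2.
- by move=> /IH1 h1; rewrite h1.
- move=> rf; split=> -[x xG].
    have [p2 [ext [x2 [h1 h2 h3 _]]]] := forth p x xG.
    have := IH1 p2 (update (fun l => ext (e l)) k x2) rf; rewrite !update_comp h3.
    rewrite (update_ext _ _ (fun l => h1 (e l))) (update_ext _ _ (fun l => h2 (e l))).
    by move=> /[apply]; exists (pos_right p2 x2) => //; rewrite -pos_same h3.
  have [p2 [ext [x2 [h1 h2 h3 _]]]] := forth (pos_swap p) x xG.
  have := IH1 p2 (update (fun l => ext (e l)) k x2) rf; rewrite !update_comp h3.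
  rewrite (update_ext _ _ (fun l => h1 (e l))) (update_ext _ _ (fun l => h2 (e l))).
  by move=> /[apply]; exists (pos_right p2 x2) => //; rewrite -pos_same h3.
- move=> rf; split=> h x xG.
    have [p2 [ext [x2 [h1 h2 h3 _]]]] := forth (pos_swap p) x xG.
    have := IH1 p2 (update (fun l => ext (e l)) k x2) rf; rewrite !update_comp h3.
    rewrite (update_ext _ _ (fun l => h1 (e l))) (update_ext _ _ (fun l => h2 (e l))).
    by move=> ->; apply: h; rewrite -pos_same h3.
  have [p2 [ext [x2 [h1 h2 h3 _]]]] := forth p x xG.
  have := IH1 p2 (update (fun l => ext (e l)) k x2) rf; rewrite !update_comp h3.
  rewrite (update_ext _ _ (fun l => h1 (e l))) (update_ext _ _ (fun l => h2 (e l))).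
  by move=> ->; apply: h; rewrite -pos_same h3.
Qed.

Local Open Scope classical_set_scope.

(** * The space of subfields *)

Section Space.
Variable K : fieldType.

Lemma open_mem (x : K) (b : bool) : open [set F : subfields K | (x \in subfield_pred F) = b].
Proof.
have ev : continuous (fun F : subfields K => (set_val F : {ptws K -> bool}) x).
  move=> F; apply: (@continuous_comp _ {ptws K -> bool} bool
     (fun F : subfields K => (set_val F : {ptws K -> bool})) (fun g => g x)).
    exact: initial_continuous.
  exact: (@proj_continuous K (fun=> bool) x).
have -> : [set F : subfields K | (x \in subfield_pred F) = b] =
          (fun F : subfields K => (set_val F : {ptws K -> bool}) x) @^-1` [set b].
  by apply/seteqP; split => F.
apply: open_comp => [F _|]; first exact: ev.
exact: discrete_open.
Qed.

(** The sets that contain all functions agreeing with [F0] on some finite set form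
    a filter, which converges to [F0] because each coordinate does. *)
Lemma open_cylinder (W : set (subfields K)) (F0 : subfields K) : open W -> W F0 ->
  exists s : seq K, forall F : subfields K,
    {in s, forall x, (x \in subfield_pred F) = (x \in subfield_pred F0)} -> W F.
Proof.
move=> [B Bo <-] BF0.
pose f : {ptws K -> bool} := set_val F0.
pose Fil : set_system {ptws K -> bool} :=
  [set A | exists s : seq K, forall g : K -> bool, {in s, g =1 f} -> A g].
have FilF : Filter Fil.
  split.
  - by exists [::].
  - move=> P Q [s sP] [t tQ]; exists (s ++ t) => g gf; split.
      by apply: sP => x xs; apply: gf; rewrite mem_cat xs.
    by apply: tQ => x xs; apply: gf; rewrite mem_cat xs orbT.
  - by move=> P Q PQ [s sP]; exists s => g gf; apply: PQ; exact: sP.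
have : Fil --> f.
  apply/cvg_sup => x; apply/cvg_image.
    by rewrite eqEsubset; split=> v // _; exists (cst v).
  move=> A /nbhs_singleton Af; rewrite nbhs_simpl /=.
  exists ((fun g : K -> bool => g x) @^-1` A).
    by exists [:: x] => g gf; rewrite /= (gf x) ?inE.
  by rewrite eqEsubset; split => [j [? + <-//]|j Wj]; exists (fun _ => j).
move=> /(_ B (open_nbhs_nbhs (conj Bo BF0))) [s sB].
by exists s => F FF0; apply: sB => x xs; exact: FF0.
Qed.

(** An open set contained in the closure of [A] would meet [A], hence [O], which is
    disjoint from that closure. *)
Lemma nowhere_dense_open (T : topologicalType) (A O : set T) : open O -> A `&` O = set0 ->
  (forall W a, open W -> W a -> A a -> exists b, W b /\ O b) -> nowhere_dense A.
Proof.
move=> Oo AO dense; rewrite /nowhere_dense -subset0 => a.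
rewrite interiorEbigcup => -[W [Wo WA] Wa].
have [[c [Ac Wc]]|no] := pselect (exists c, A c /\ W c).
  have [b [Wb Ob]] := dense W c Wo Wc Ac.
  have [c' [Ac' Oc']] := WA b Wb O (open_nbhs_nbhs (conj Oo Ob)).
  exfalso; have : (A `&` O) c' by split.
  by rewrite AO.
have [c [Ac Wc]] := WA a Wa W (open_nbhs_nbhs (conj Wo Wa)).
by apply: no; exists c.
Qed.

End Space.

(** * The generic subfields are comeager *)

Section Comeager.
Variables (K : closedFieldType) (iota : {rmorphism rat -> K}).
Hypothesis K_alg : forall a : K, algebraicOver iota a.

(** For fixed [x] and [w] only finitely many memberships are required. *)
Lemma open_solved D : open [set F : subfields K | solved (subfield_pred F) (@natural K) D].
Proof.
have -> : [set F : subfields K | solved (subfield_pred F) (@natural K) D] =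
  \bigcup_(xw in [set xw : K * K | [/\ natural xw.1, (spec xw.1 (prim_min D)).[xw.2] = 0 &
       (avoid D).[xw.1] != 0]])
    [set F : subfields K | [/\ (spec xw.1 (gen D)).[xw.2] \in subfield_pred F &
       forall z, z \in outs D -> (spec xw.1 z).[xw.2] \notin subfield_pred F]].
  apply/seteqP; split => F.
    by move=> [x [w [h1 h2 h3 h4 h5]]]; exists (x, w).
  by move=> [[x w] [h1 h2 h3] [h4 h5]]; exists x, w.
apply: bigcup_open => -[x w] _ /=.
elim: (outs D) => [|z zs IHz].
  rewrite [X in open X](_ : _ = [set F : subfields K | ((spec x (gen D)).[w] \in subfield_pred F) = true]).
    exact: open_mem.
  by apply/seteqP; split => F /=; [case|].
rewrite [X in open X](_ : _ = [set F : subfields K | (spec x (gen D)).[w] \in subfield_pred F /\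
       forall z, z \in zs -> (spec x z).[w] \notin subfield_pred F] `&`
  [set F : subfields K | ((spec x z).[w] \in subfield_pred F) = false]).
  by apply: openI => //; exact: open_mem.
apply/seteqP; split => F /=.
  move=> [h1 h2]; split; last by apply/negbTE/h2; rewrite inE eqxx.
  by split => // u us; apply: h2; rewrite inE us orbT.
move=> [[h1 h2] h3]; split=> // u; rewrite inE => /orP[/eqP->|]; last exact: h2.
by rewrite h3.
Qed.

(** Each problem gives a nowhere dense set of bad subfields, and there are only
    countably many problems. *)
Theorem nongeneric_meager : exists N : nat -> set (subfields K),
  (forall n, nowhere_dense (N n)) /\
  forall F : subfields K, ~ generic (subfield_pred F) (@natural K) -> exists n, N n F.
Proof.
have [e eP] := enumerable_problem (enumerable_closure K_alg).
exists (fun n => [set F | well_posed (subfield_pred F) (e n) /\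
                         ~ solved (subfield_pred F) (@natural K) (e n)]); split; last first.
  move=> F /existsNP[D /not_implyP[wD sD]]; have [n nD] := eP D.
  by exists n; rewrite /= nD.
move=> n; apply: (nowhere_dense_open (open_solved (e n))).
  by apply/seteqP; split => F //= -[[_ ?]].
move=> W F0 Wo WF0 [wF0 _].
have [s sW] := open_cylinder Wo WF0.
have [F1 [F1c F1s F1D]] := density K_alg s (@subfield_pred_closed _ F0) wF0.
by exists (mk_subfield F1c); split => //; exact: sW.
Qed.

End Comeager.

(** * Definable subsets of generic subfields *)

(** A rational algebraic integer is an integer. *)
Lemma not_integral_half n : ~ integralOver (intr : int -> rat) (n%:R + 2^-1).
Proof.
move=> [p pm pr].
set r : rat := n%:R + 2^-1 in pr *.
have rA : (ratr r : algC) \in Aint.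
  apply: (@root_monic_Aint (map_poly intr p)).
  - have := pr; rewrite -(fmorph_root (ratr : {rmorphism rat -> algC})).
    by congr (root _ _); apply/polyP => k; rewrite !coef_map /=; exact: ratr_int.
  - exact: monic_map.
  - by apply/polyOverP => k; rewrite coef_map; exact: intr_int.
have /intrP[z zE] := Cint_rat_Aint (Crat_rat r) rA.
have {}zE : r = z%:~R.
  apply: (fmorph_inj (ratr : {rmorphism rat -> algC})); apply: etrans zE _.
  exact/esym/ratr_int.
have : (z * 2 : int) = n%:Z * 2 + 1.
  apply: (@intr_inj rat); rewrite [LHS]intrM -zE [RHS]intrD [X in X + _]intrM /r -pmulrn.
  by field.
by lia.
Qed.

Section Generic.
Variables (K : closedFieldType) (iota : {rmorphism rat -> K}).
Hypothesis K_alg : forall a : K, algebraicOver iota a.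

Let charK : [pchar K] =i pred0.
Proof. by move=> p; rewrite (fmorph_pchar iota) pchar_num. Qed.

Lemma rat_in (F : {pred K}) : divring_closed F -> forall r, iota r \in F.
Proof.
move=> Fc r; rewrite -(divq_num_den r) fmorph_div !rmorph_int.
have intF z : z%:~R \in F.
  by apply: (@rpred_int _ (subfield_pred (mk_subfield Fc))).
by have [_ _ Fd] := Fc; exact: Fd.
Qed.

(** The algebraic closure itself, with the diagonal embedding on both sides; its
    elements are algebraic over the rationals, which lie in every subfield. *)
Definition start_position (F : {pred K}) (F_closed : divring_closed F) : position F.
Proof.
exists K (@udiag K) (@udiag K).
- by move=> p sp; apply: poly_root_exists.
- exact: enumerable_closure K_alg.
- by [].
- move=> l; have [p p0 pl] := K_alg l; exists (map_poly iota p); split.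
  + by rewrite map_poly_eq0.
  + exact/rootP.
  + by move=> k; apply/upredP; apply: aeT => n; rewrite coef_map; exact: rat_in.
Defined.

Lemma half_not_integral (F : subfields K) n : ~ ring_of_integers (subfield_type F) (n%:R + 2^-1).
Proof.
move=> [p pm /rootP pr]; apply: (@not_integral_half n); exists p => //; apply/rootP.
apply: (fmorph_inj iota); rewrite rmorph0 -horner_map.
have := congr1 (sfval F) pr; rewrite rmorph0 -horner_map => <-.
rewrite rmorphD fmorphV !rmorph_nat; congr (_.[_]).
  by apply/polyP => k; rewrite !coef_map /= -[sval _]/(sfval F _) !rmorph_int.
by rewrite (rmorphD (sfval F)) (fmorphV (sfval F)) !(rmorph_nat (sfval F)).
Qed.

(** No formula separates the integers from the half-integers of a generic
    subfield: an infinite half-integer is equivalent to an infinite integer. *)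
Theorem generic_undefinable (F : subfields K) (S : set (subfield_type F)) :
  generic (subfield_pred F) (@natural K) -> definable S ->
  (forall m : nat, S m%:R) -> (forall n : nat, ~ S (n%:R + 2^-1)) -> False.
Proof.
move=> genF [f [c [rf SE]]] Snat Shalf.
have Fc := @subfield_pred_closed _ F.
have SP (a : subfield_type F) : S a <-> sat_in (subfield_pred F) (fun k => sfval F (a :: c)`_k) f.
  by rewrite SE -holds_sat_in.
pose h n : subfield_type F := n%:R + 2^-1.
pose t : upow K := ulim (fun n => sfval F (h n)).
have tG : t \in upred (subfield_pred F) by apply/upredP; apply: aeT => n; exact: (valP (h n)).
have [p2 [ext [x2 [h1 h2 h3 h4]]]] := extend_position Fc charK genF (start_position Fc) tG.
have [m mE] : unatural (pos_right p2 x2).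
  case: h4 => // -[l /= /ulim_eq lt].
  have [n0 n0E] := ae_ex lt; have [n1 [n1E n1l]] := ae_ex (ae_and lt (ae_ge n0.+1)).
  have : h n0 = h n1 by apply: (fmorph_inj (sfval F)); rewrite -n0E -n1E.
  move=> /addIr /(congr1 (sfval F)); rewrite !(rmorph_nat (sfval F)) => /(natr_inj charK) n01.
  by rewrite n01 ltnn in n1l.
pose e k := if k is k'.+1 then ext (sfval F c`_k') else x2.
have eq := @position_equivalence (subfield_type F) _ _ Fc charK genF p2 e f rf.
have left_false : ~ sat_in (upred (subfield_pred F)) (fun k => pos_left p2 (e k)) f.
  have -> : (fun k => pos_left p2 (e k)) = (fun k => ulim (fun n => sfval F (h n :: c)`_k)).
    by apply/funext => -[|k] /=; [exact: h3|rewrite h1].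
  move=> /(@los _ _ _ (fun k n => sfval F (h n :: c)`_k) f rf) hs; have [n /SP] := ae_ex hs; exact: Shalf.
apply: left_false; apply/eq.
have -> : (fun k => pos_right p2 (e k)) = (fun k => ulim (fun n => sfval F ((m n)%:R :: c)`_k)).
  apply/funext => -[|k] /=; last by rewrite h2.
  by rewrite mE; congr ulim; apply/funext => n; exact/esym/(rmorph_nat (sfval F)).
by apply/(@los _ _ _ (fun k n => sfval F ((m n)%:R :: c)`_k) f rf); apply: aeT => n; apply/SP.
Qed.

End Generic.

Lemma nowhere_dense_subset (T : topologicalType) (A B : set T) :
  A `<=` B -> nowhere_dense B -> nowhere_dense A.
Proof.
rewrite /nowhere_dense => AB B0; rewrite -subset0 -B0.
by apply: interiorS; exact: closureS.
Qed.

Theorem corollary5 (K : closedFieldType) (iota : {rmorphism rat -> K})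
    (K_alg : forall x : K, algebraicOver iota x) :
  meager [set F : subfields K |
    definable (integers (subfield_type F)) \/
    definable (ring_of_integers (subfield_type F))].
Proof.
have [N [Nnd NP]] := nongeneric_meager K_alg.
set Def := [set F | _].
exists (fun n => N n `&` Def) => [n|].
  by apply: nowhere_dense_subset (Nnd n) => F [].
apply/seteqP; split=> [F FDef|F [n _ []//]].
have [|n nF] := NP F; last by exists n.
have intZ (z : int) : ring_of_integers (subfield_type F) z%:~R.
  by exists ('X - z%:P); rewrite ?monicXsubC // rmorphB /= map_polyX map_polyC root_XsubC.
move=> genF; case: FDef => Fdef.
  apply: (generic_undefinable K_alg genF Fdef) => [m|n [z _ zE]].
    by exists m%:Z.
  have := half_not_integral iota (F := F) (n := n).
  by rewrite -zE; apply.
apply: (generic_undefinable K_alg genF Fdef) => [m|n]; first exact: (intZ m%:Z).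
exact: (half_not_integral iota).
Qed.
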